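(* For any initial data $(u_0,\mu_0)\in\mathcal{D}$ the Hunter--Saxton equation $$u_t+uu_x=\tfrac14\Big(\int_{-\infty}^x d\mu(t,z)-\int_x^{\infty}d\mu(t,z)\Big),\qquad \mu_t+(u\mu)_x=0$$ has a unique global weak conservative solution $(u,\mu)$ (with $(u(t),\mu(t))\in\mathcal{D}$) in the sense defined below, with $(u(0,\cdot),\mu(0))=(u_0,\mu_0)$.
   Context: Fix $\psi^+,\psi^-\in C^\infty(\mathbb{R})$ with $\psi^++\psi^-\equiv1$, $0\le\psi^\pm\le1$, $\operatorname{supp}\psi^-\subset(-\infty,1)$, $\operatorname{supp}\psi^+\subset(-1,\infty)$. Let $E_1=\{\bar f+a\psi^+:\bar f\in H^1(\mathbb{R}),a\in\mathbb{R}\}$, $E_2=\{\bar f+a\psi^++b\psi^-:\bar f\in H^1(\mathbb{R}),a,b\in\mathbb{R}\}$, and let $E_1^0,E_2^0$ be defined in the same way with $\bar f\in L^2(\mathbb{R})$ instead of $H^1(\mathbb{R})$, with norms $\|\bar f+a\psi^+\|_{E_1^0}=(\|\bar f\|_{L^2}^2+a^2)^{1/2}$, $\|\bar f+a\psi^++b\psi^-\|_{E_2^0}=(\|\bar f\|_{L^2}^2+a^2+b^2)^{1/2}$. The set $\mathcal{D}$ consists of all pairs $(u,\mu)$ with $u\in E_2$, $\mu$ a positive finite Radon measure on $\mathbb{R}$, $x\mapsto\mu((-\infty,x))$ in $E_1^0$, and absolutely continuous part $d\mu_{\rm ac}=u_x^2dx$. A pair $(u,\mu)$ ($u:[0,\infty)\times\mathbb{R}\to\mathbb{R}$,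 $\mu(t)$ positive finite Radon measures) is a weak conservative solution with initial data $(u(0,\cdot),\mu(0))\in\mathcal{D}$ if: (i) $u(t,\cdot)\in E_2$ for each $t$; (ii) $\mu(t,(-\infty,\cdot))\in E_1^0$ and $d\mu_{\rm ac}(t)=u_x^2(t,\cdot)dx$ for each $t$; (iii) for all $\phi\in C_c^\infty([0,\infty)\times\mathbb{R})$, $\int_0^\infty\!\int_{\mathbb{R}}\big[u\phi_t+\tfrac12u^2\phi_x+\tfrac14\big(\int_{-\infty}^xd\mu(t)-\int_x^\infty d\mu(t)\big)\phi\big]dxdt=-\int_{\mathbb{R}}u\phi|_{t=0}dx$ and $\int_0^\infty\!\int_{\mathbb{R}}(\phi_t+u\phi_x)d\mu(t)dt=-\int_{\mathbb{R}}\phi|_{t=0}d\mu(0)$; (iv) for every $T>0$, $u$ is Hölder continuous on $[0,T]\times\mathbb{R}$ and $t\mapsto u(t,\cdot)$ is Lipschitz continuous from $[0,T]$ into $E_2^0$; (v) there is a Lebesgue null set $\mathcal{N}$ such that for $t\notin\mathcal{N}$ the measure $\mu(t)$ is absolutely continuous with density $u_x^2(t,\cdot)$; (vi) $t\mapsto\mu(t)$ is continuous with respect to weak convergence of measures. *)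

(* Defs.v *)
From HB Require Import structures.
From mathcomp Require Import all_boot all_order all_algebra.
From mathcomp Require Import all_classical all_reals all_analysis.
Set Implicit Arguments. Unset Strict Implicit. Unset Printing Implicit Defensive.
Import Order.TTheory GRing.Theory Num.Theory.
Import numFieldNormedType.Exports.
Local Open Scope classical_set_scope.
Local Open Scope ring_scope.

Section HunterSaxton.
Context {R : realType}.

Local Notation leb := (@lebesgue_measure R).
(* positive finite (Borel, hence Radon) measures on R *)
Local Notation fmeasure := {finite_measure set (measurableTypeR R) -> \bar R}.

Definition iter_deriv (n : nat) (f : R -> R) : R -> R :=
  iter n (fun g => derive1 g) f.

Definition smooth (f : R -> R) : Prop :=
  forall (n : nat) (x : R), derivable (iter_deriv n f) x 1.

Definition partition_of_unity (pp pm : R -> R) : Prop :=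
  [/\ smooth pp, smooth pm, (forall x, pp x + pm x = 1),
      (forall x, 0 <= pp x <= 1) /\ (forall x, 0 <= pm x <= 1) &
      (closure [set x | pm x != 0] `<=` `]-oo, 1[) /\
      (closure [set x | pp x != 0] `<=` `]-1, +oo[) ].

Definition L2norm2 (f : R -> R) : \bar R := (\int[leb]_x ((f x) ^+ 2)%R%:E)%E.

Definition L2 (f : R -> R) : Prop :=
  measurable_fun [set: measurableTypeR R] f /\ (L2norm2 f < +oo)%E.

(* g is the (weak) derivative of f: f is locally absolutely continuous with
   f y - f x = int_x^y g. *)
Definition has_weak_deriv (f g : R -> R) : Prop :=
  measurable_fun [set: measurableTypeR R] g /\
  forall x y : R, x <= y ->
    leb.-integrable `[x, y] (EFin \o g) /\
    ((f y - f x)%:E = \int[leb]_(z in `[x, y]) (g z)%:E)%E.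

(* H^1(R) (continuous representative) *)
Definition H1 (f : R -> R) : Prop :=
  L2 f /\ exists g, L2 g /\ has_weak_deriv f g.

Definition E2 (pp pm : R -> R) (u : R -> R) : Prop :=
  exists (f : R -> R) (a b : R),
    H1 f /\ u = (fun x => f x + a * pp x + b * pm x).

Definition E1_0 (pp : R -> R) (F : R -> R) : Prop :=
  exists (f : R -> R) (a : R), L2 f /\ F = (fun x => f x + a * pp x).

(* || g ||_{E_2^0} <= c  (for c >= 0) *)
Definition E2_0_norm_le (pp pm : R -> R) (g : R -> R) (c : R) : Prop :=
  exists (f : R -> R) (a b : R),
    [/\ L2 f, g = (fun x => f x + a * pp x + b * pm x) &
        fine (L2norm2 f) + a ^+ 2 + b ^+ 2 <= c ^+ 2].

(* the absolutely continuous part of mu is u_x^2 dx (Lebesgue decomposition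
   written out: mu = u_x^2 dx + (mu restricted to a Lebesgue-null set)) *)
Definition ac_part_is_sq (mu : fmeasure) (u : R -> R) : Prop :=
  exists g : R -> R, has_weak_deriv u g /\
    exists N : set (measurableTypeR R),
      [/\ measurable N, leb N = 0%E &
          forall A, measurable A ->
            mu A = (\int[leb]_(x in A) ((g x) ^+ 2)%R%:E + mu (A `&` N))%E].

Definition in_D (pp pm : R -> R) (u : R -> R) (mu : fmeasure) : Prop :=
  [/\ E2 pp pm u,
      E1_0 pp (fun x => fine (mu `]-oo, x[%classic)) &
      ac_part_is_sq mu u].

Definition dt (phi : R -> R -> R) : R -> R -> R :=
  fun t x => derive1 (fun s => phi s x) t.
Definition dx (phi : R -> R -> R) : R -> R -> R :=
  fun t x => derive1 (phi t) x.
Definition pderiv (b : bool) (phi : R -> R -> R) : R -> R -> R :=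
  if b then dt phi else dx phi.

Definition smooth2 (phi : R -> R -> R) : Prop :=
  forall s : seq bool,
    let psi := foldr pderiv phi s in
    (forall t x, derivable (fun r => psi r x) t 1 /\ derivable (psi t) x 1) /\
    continuous (fun p : R * R => psi p.1 p.2).

(* restrictions to [0,oo) x R of C_c^oo(R^2) functions *)
Definition test_fun (phi : R -> R -> R) : Prop :=
  smooth2 phi /\
  exists K : R, forall t x, K < `|t| \/ K < `|x| -> phi t x = 0.

Definition holder_on (T : R) (u : R -> R -> R) : Prop :=
  exists alpha C : R, [/\ 0 < alpha <= 1, 0 <= C &
    forall t s x y, 0 <= t <= T -> 0 <= s <= T ->
      `|u t x - u s y| <= C * (`|t - s| + `|x - y|) `^ alpha].

Definition lipschitz_E2_0 (pp pm : R -> R) (T : R) (u : R -> R -> R) : Prop :=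
  exists L : R, 0 <= L /\
    forall t s, 0 <= t <= T -> 0 <= s <= T ->
      E2_0_norm_le pp pm (fun x => u t x - u s x) (L * `|t - s|).

Definition weak_cont (mu : R -> fmeasure) : Prop :=
  forall f : R -> R, continuous f -> (exists M : R, forall x, `|f x| <= M) ->
    {within [set t : R | 0 <= t],
      continuous (fun t => (\int[mu t]_x (f x)%:E)%E)}.

Definition weak_cons_sol (pp pm : R -> R) (u : R -> R -> R) (mu : R -> fmeasure)
  : Prop :=
  [/\
      (forall t, 0 <= t -> in_D pp pm (u t) (mu t)),
      (forall phi, test_fun phi ->
        (\int[leb]_(t in [set t : R | (0 <= t)%R]) \int[leb]_x
           (u t x * dt phi t x + 2^-1 * (u t x) ^+ 2 * dx phi t x
            + 4^-1 * (fine (mu t `]-oo, x[%classic) - fine (mu t `]x, +oo[%classic))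
                   * phi t x)%R%:E
         = - \int[leb]_x (u 0%R x * phi 0%R x)%R%:E)%E /\
        (\int[leb]_(t in [set t : R | (0 <= t)%R]) \int[mu t]_x
           (dt phi t x + u t x * dx phi t x)%R%:E
         = - \int[mu 0%R]_x (phi 0%R x)%R%:E)%E),
      (forall T, 0 < T -> holder_on T u /\ lipschitz_E2_0 pp pm T u),
      (exists N : set (measurableTypeR R), [/\ measurable N, leb N = 0%E &
         forall t, 0 <= t -> ~ N t ->
           exists g : R -> R, has_weak_deriv (u t) g /\
             forall A, measurable A ->
               mu t A = (\int[leb]_(x in A) ((g x) ^+ 2)%R%:E)%E]) &
      weak_cont mu ].

Definition has_init (u : R -> R -> R) (mu : R -> fmeasure)
  (u0 : R -> R) (mu0 : fmeasure) : Prop :=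
  u 0 = u0 /\ forall A, measurable A -> mu 0 A = mu0 A.

End HunterSaxton.

(* Main.v *)
Require Import Defs.
From HB Require Import structures.
From mathcomp Require Import all_boot all_order all_algebra.
From mathcomp Require Import all_classical all_reals all_analysis.
From mathcomp Require Import measurable_realfun ring lra.
Set Implicit Arguments. Unset Strict Implicit. Unset Printing Implicit Defensive.
Import Order.TTheory GRing.Theory Num.Theory.
Import numFieldNormedType.Exports.
Local Open Scope classical_set_scope.
Local Open Scope ring_scope.

(** Existence is explicit in Lagrangian labels. Label the line by [xi = x + mu0 (-oo, x]], so that
    position [y], velocity [U] and cumulative energy [H] become Lipschitz functions of [xi], even where
    [mu0] has atoms; then [H] is constant in time, [U] is affine and [y] quadratic in time, and the
    solution is [u (t, y) = U] with [mu t] the image of [dH] under [y t].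

    For uniqueness, let [chi t] be the [eta]-quantile of [mu t].  Testing the energy equation with a
    smooth step moving along a line shows that energy crosses a line faster than [u] only leftwards and
    a line slower than [u] only rightwards; hence [chi' = u (t, chi)].  Testing the momentum equation with a bump of width [k] around [chi]
    gives the rate of change of the averaged velocity as [eta / 2 - M / 4] plus an error bounded by
    [C * mu t ]chi - k, chi + k]], because [u] is locally Hoelder 1/2 with respect to [mu t].  For almost
    every [t] the measure [mu t] has no atoms, so as [k] tends to 0 the velocity along [chi] is
    [u0 (chi 0) + t (eta / 2 - M / 4)].  All quantile curves, hence [mu t], and the velocity on them
    are thus determined by the data, and the Hoelder bound determines [u t] elsewhere. *)

(** * Primitives of bounded functions *)

(** The velocity is only Hoelder 1/2 in space, so characteristics need not be unique, and at
    exceptional times the energy may have atoms. A quantile, by contrast, is a single point for each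
    level at every time; that it moves with the fluid is a conclusion, not its definition. Two
    restrictions on test functions shape the argument. They must be smooth, and a quantile curve is
    not, so every test travels along a straight line; the averaged velocity along a quantile is
    compared with the one along the tangent line, which it meets to first order. They must have
    compact support, so a step in space is paired with a second, very wide step far away, whose flux
    is negligible. The rate [eta / 2 - M / 4] is the source [(eta - (M - eta)) / 4] at a point with
    energy [eta] on its left. In the construction, the relation [w ^+ 2 = a * h] between the label
    derivatives encodes that the absolutely continuous energy is the squared slope. It survives the
    flow and yields at once that positions stay ordered, that velocity is a function of position,
    and that the energy density is again the squared slope. *)

Section BoundedPrimitives.
Context {R : realType}.
Local Notation leb := (@lebesgue_measure R).
Implicit Types (a b : R).

Lemma leb_oc a b : a <= b -> leb `]a, b] = (b - a)%:E.
Proof.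
rewrite le_eqVlt => /predU1P[->|ab].
  by rewrite set_itvoc0 measure0 subrr.
by rewrite lebesgue_measure_itv/= lte_fin ab.
Qed.

Lemma leb_cc a b : a <= b -> leb `[a, b] = (b - a)%:E.
Proof.
rewrite le_eqVlt => /predU1P[->|ab].
  by rewrite set_itv1 lebesgue_measure_set1 subrr.
by rewrite lebesgue_measure_itv/= lte_fin ab.
Qed.

Lemma bounded_integrable d (T : measurableType d) (mu : {measure set T -> \bar R})
  (D : set T) (f : T -> R) (C : R) : measurable D ->
  (mu D < +oo)%E -> measurable_fun D f -> (forall x, D x -> `|f x| <= C) ->
  mu.-integrable D (EFin \o f).
Proof.
move=> mD Dfin mf fC; apply: measurable_bounded_integrable => //.
exists C; split; first exact: num_real.
by move=> M CM x Dx; exact: le_trans (fC x Dx) (ltW CM).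
Qed.

Lemma integrableZ_EFin d (T : measurableType d) (mu : {measure set T -> \bar R})
  (D : set T) (c : R) (f : T -> R) : measurable D ->
  mu.-integrable D (EFin \o f) -> mu.-integrable D (EFin \o (fun x => c * f x)).
Proof. by move=> mD /(integrableZl mD c). Qed.

Lemma integrableD_EFin d (T : measurableType d) (mu : {measure set T -> \bar R})
  (D : set T) (f g : T -> R) : measurable D ->
  mu.-integrable D (EFin \o f) -> mu.-integrable D (EFin \o g) ->
  mu.-integrable D (EFin \o (fun x => f x + g x)).
Proof. by move=> mD intf intg; have := integrableD mD intf intg. Qed.

Lemma integrableB_EFin d (T : measurableType d) (mu : {measure set T -> \bar R})
  (D : set T) (f g : T -> R) : measurable D ->
  mu.-integrable D (EFin \o f) -> mu.-integrable D (EFin \o g) ->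
  mu.-integrable D (EFin \o (fun x => f x - g x)).
Proof. by move=> mD intf intg; have := integrableB mD intf intg. Qed.

Lemma oc_integrable (f : R -> R) C a b : measurable_fun setT f -> (forall x, `|f x| <= C) ->
  leb.-integrable `]a, b] (EFin \o f).
Proof.
move=> mf fC; apply: (@bounded_integrable _ _ _ _ _ C) => //.
- rewrite [X in (X < _)%E]lebesgue_measure_itv/=; case: ifPn => _; last by rewrite ltry.
  by rewrite -EFinB ltry.
- exact: measurable_funTS.
Qed.

Lemma Rint_oc_cat (f : R -> R) C a b c : measurable_fun setT f -> (forall x, `|f x| <= C) ->
  a <= b -> b <= c ->
  \int[leb]_(x in `]a, c]) f x = \int[leb]_(x in `]a, b]) f x + \int[leb]_(x in `]b, c]) f x.
Proof.
move=> mf fC ab bc.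
have E : `]a, c]%classic = `]a, b] `|` `]b, c].
  by rewrite -itv_bndbnd_setU// bnd_simp.
rewrite E Rintegral_setU//.
- by rewrite -E; exact: oc_integrable fC.
- apply/disj_setPS => x [] /=; rewrite !in_itv/= => /andP[_ xb] /andP[bx _].
  by move: (lt_le_trans bx xb); rewrite ltxx.
Qed.

Lemma Rint_oc0 (f : R -> R) a : \int[leb]_(x in `]a, a]) f x = 0.
Proof. by rewrite set_itvoc0 Rintegral_set0. Qed.

Lemma Rint_oc_cst a b c : a <= b -> \int[leb]_(x in `]a, b]) c = c * (b - a).
Proof. by move=> ab; rewrite Rintegral_cst// [X in fine X]leb_oc. Qed.

Lemma Rint_oc_bound (f : R -> R) C K a b : measurable_fun setT f -> (forall x, `|f x| <= C) ->
  a <= b -> (forall x, a < x <= b -> `|f x| <= K) ->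
  `|\int[leb]_(x in `]a, b]) f x| <= K * (b - a).
Proof.
move=> mf fC ab fK.
apply: le_trans.
  by apply: le_normr_Rintegral => //; exact: oc_integrable fC.
rewrite -Rint_oc_cst//; apply: le_Rintegral => //.
- by apply: (@oc_integrable _ C) => [|x]; [exact: measurableT_comp|rewrite normr_id].
- by apply: (@oc_integrable _ `|K|) => [|x//].
Qed.

(** Stands for a Lipschitz function with almost everywhere derivative [w]. Constraining only the
    integrals of a bounded, everywhere defined [w] avoids differentiation almost everywhere, and
    half-open intervals concatenate without counting endpoints twice. *)
Definition bprim (w W : R -> R) := [/\ measurable_fun setT w,
  exists C, forall x, `|w x| <= C &
  forall a b, a <= b -> W b - W a = \int[leb]_(x in `]a, b]) w x].

Lemma bprim_exists (w : R -> R) : measurable_fun setT w -> (exists C, forall x, `|w x| <= C) ->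
  exists W, bprim w W.
Proof.
move=> mw [C wC].
pose W x := if 0 <= x then \int[leb]_(z in `]0, x]) w z else - \int[leb]_(z in `]x, 0]) w z.
exists W; split => //; first by exists C.
move=> a b ab; rewrite /W; have [a0|a0] := leP 0 a.
  by rewrite (le_trans a0 ab) (Rint_oc_cat mw wC a0 ab); ring.
have [b0|b0] := leP 0 b.
  by rewrite (Rint_oc_cat mw wC (ltW a0) b0); ring.
by rewrite (Rint_oc_cat mw wC ab (ltW b0)); ring.
Qed.

Lemma bprim_lip w W C : bprim w W -> (forall x, `|w x| <= C) ->
  forall a b, `|W b - W a| <= C * `|b - a|.
Proof.
case=> mw _ WE wC.
have H a b : a <= b -> `|W b - W a| <= C * `|b - a|.
  move=> ab; rewrite WE// (ger0_norm (_ : 0 <= b - a)) ?subr_ge0//.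
  exact: (Rint_oc_bound mw wC ab (fun x _ => wC x)).
move=> a b; have [/H//|/ltW/H] := leP a b.
by rewrite distrC (distrC a).
Qed.

Lemma lip_continuous (W : R -> R) C : (forall a b, `|W b - W a| <= C * `|b - a|) ->
  continuous W.
Proof.
move=> WC x; apply/cvgrPdist_le => e e0.
have C1 : 0 < `|C| + 1 by rewrite ltr_pwDr.
near=> y; apply: (le_trans (WC y x)).
apply: (@le_trans _ _ ((`|C| + 1) * `|x - y|)).
  by rewrite ler_wpM2r// (le_trans (ler_norm _))// lerDl.
rewrite -ler_pdivlMl// mulrC.
by near: y; apply: cvgr_dist_le => //; exact: divr_gt0.
Unshelve. all: by end_near. Qed.

Lemma bprim_continuous w W : bprim w W -> continuous W.
Proof. by move=> H; have [_ [C wC] _] := H; exact: lip_continuous (bprim_lip H wC). Qed.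

Lemma bprim_ext w v W V : bprim w W -> w =1 v -> W =1 V -> bprim v V.
Proof. by move=> + /funext <- /funext <-. Qed.

Lemma bprim_cst c : bprim (fun=> 0) (fun=> c).
Proof.
split=> //; first by exists 0 => x; rewrite normr0.
by move=> a b ab; rewrite subrr Rint_oc_cst// mul0r.
Qed.

Lemma bprim_id : bprim (fun=> 1) id.
Proof.
split=> //; first by exists 1 => x; rewrite normr1.
by move=> a b ab; rewrite Rint_oc_cst// mul1r.
Qed.

Lemma bprimD w v W V : bprim w W -> bprim v V -> bprim (w \+ v) (W \+ V).
Proof.
move=> [mw [C wC] WE] [mv [D vD] VE]; split; first exact: measurable_funD.
  by exists (C + D) => x; rewrite (le_trans (ler_normD _ _))// lerD.
move=> a b ab /=; rewrite RintegralD//; [|exact: oc_integrable wC|exact: oc_integrable vD].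
rewrite -WE// -VE//; lra.
Qed.

Lemma bprimZ c w W : bprim w W -> bprim (fun x => c * w x) (fun x => c * W x).
Proof.
move=> [mw [C wC] WE]; split; first exact: measurable_funM.
  by exists (`|c| * C) => x; rewrite normrM ler_wpM2l.
by move=> a b ab /=; rewrite RintegralZl//; [rewrite -WE// mulrBr|exact: oc_integrable wC].
Qed.

(* Both sides have the same derivative: the difference of [F] and any
   primitive of [k] has derivative zero everywhere. *)
Lemma bprim_criterion (k F : R -> R) : measurable_fun setT k ->
  (exists C, forall x, `|k x| <= C) ->
  (forall x e, 0 < e -> exists2 d, 0 < d & forall a b, a <= x <= b -> b - a < d ->
    `|F b - F a - \int[leb]_(z in `]a, b]) k z| <= e * (b - a)) ->
  bprim k F.
Proof.
move=> mk kC H; have [K pK] := bprim_exists mk kC; have [_ _ KE] := pK.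
pose G := F \- K.
have dG (x : R) : is_derive x 1 G (0 : R).
  have dG0 : (fun h => h^-1 *: ((G \o shift x) (h *: 1) - G x)) @ 0^' --> (0 : R^o).
    apply/cvgrPdist_le => e e0; have [d d0 Hd] := H x e e0.
    near=> h.
    have h0 : h != 0 by near: h; exact: nbhs_dnbhs_neq.
    have hd : `|h| < d.
      by near: h; apply: dnbhs0_lt.
    rewrite sub0r normrN /= scaler1 normrZ normfV ler_pdivrMl ?normr_gt0//.
    rewrite /G /= addrC; have [h1|h1] := leP 0 h.
      have := Hd x (h + x).
      rewrite lexx lerDr h1 addrK (ger0_norm h1) -KE ?lerDr// => /(_ isT).
      rewrite ger0_norm// in hd; move=> /(_ hd); rewrite mulrC.
      by congr (`| _ | <= _); lra.
    have hx : h + x <= x by rewrite gerDr ltW.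
    have := Hd (h + x) x; rewrite lexx hx -KE// (ltr0_norm h1).
    rewrite ltr0_norm// in hd.
    move=> /(_ isT); rewrite (_ : x - (h + x) = - h); last by lra.
    move=> /(_ hd); rewrite distrC mulrC; congr (`| _ | <= _); lra.
  split; first by apply/cvg_ex; exists 0.
  exact: cvg_lim dG0.
split => // a b ab.
have := is_derive_0_is_cst b a dG; rewrite /G/= -KE//; lra.
Unshelve. all: by end_near. Qed.

(** The increment of the product is exactly the integral of [w z * V b + W a * v z], with one factor
    frozen at each end. Replacing this by the claimed integrand costs a quadratic error in [b - a],
    which [bprim_criterion] tolerates. *)
Lemma bprimM (w v W V : R -> R) (CW CV : R) : bprim w W -> bprim v V ->
  (forall x, `|W x| <= CW) -> (forall x, `|V x| <= CV) ->
  bprim (fun x => w x * V x + W x * v x) (fun x => W x * V x).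
Proof.
move=> pW pV WC VC.
have [mw [C wC] WE] := pW; have [mv [D vD] VE] := pV.
have mW : measurable_fun setT W by apply: continuous_measurable_fun; exact: bprim_continuous pW.
have mV : measurable_fun setT V by apply: continuous_measurable_fun; exact: bprim_continuous pV.
have C0 : 0 <= C by exact: le_trans (normr_ge0 _) (wC 0).
have D0 : 0 <= D by exact: le_trans (normr_ge0 _) (vD 0).
have mk : measurable_fun setT (fun x => w x * V x + W x * v x).
  by apply: measurable_funD; exact: measurable_funM.
have kC x : `|w x * V x + W x * v x| <= C * CV + CW * D.
  by rewrite (le_trans (ler_normD _ _))// lerD// normrM ler_pM.
apply: bprim_criterion => //; first by exists (C * CV + CW * D).
move=> x e e0.
(* The two freezing errors are at most [C * D * (b - a)] each; the added 1 keeps the denominator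
   positive. *)
exists (e / (C * D + D * C + 1)); first by rewrite divr_gt0// ltr_wpDl// addr_ge0 ?mulr_ge0.
move=> a b /andP[ax xb]; have ab := le_trans ax xb.
rewrite ltr_pdivlMr ?ltr_wpDl// ?addr_ge0 ?mulr_ge0// => bae.
have iw c : \int[leb]_(z in `]a, b]) (w z * c) = (W b - W a) * c.
  by rewrite RintegralZr ?WE//; exact: oc_integrable wC.
have iv c : \int[leb]_(z in `]a, b]) (c * v z) = c * (V b - V a).
  by rewrite RintegralZl ?VE//; exact: oc_integrable vD.
have -> : W b * V b - W a * V a =
   \int[leb]_(z in `]a, b]) (w z * V b + W a * v z).
  rewrite RintegralD//; first by rewrite iw iv; lra.
  - apply: (@oc_integrable _ (C * CV)) => [|z]; first exact: measurable_funM.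
    by rewrite normrM ler_pM.
  - apply: (@oc_integrable _ (CW * D)) => [|z]; first exact: measurable_funM.
    by rewrite normrM ler_pM.
have k'C z : `|w z * V b + W a * v z| <= C * CV + CW * D.
  by rewrite (le_trans (ler_normD _ _))// lerD// normrM ler_pM.
have mk' : measurable_fun setT (fun z => w z * V b + W a * v z).
  by apply: measurable_funD; exact: measurable_funM.
rewrite -RintegralB//; [|exact: oc_integrable k'C|exact: oc_integrable kC].
apply: (le_trans (@Rint_oc_bound _ ((C * CV + CW * D) + (C * CV + CW * D)) (C * (D * (b - a)) + (C * (b - a)) * D) _ _ _ _ _ _)) => //.
- exact: measurable_funB.
- by move=> z; rewrite (le_trans (ler_normB _ _))// lerD.
- move=> z /andP[az zb].
  rewrite (_ : _ - _ = w z * (V b - V z) + (W a - W z) * v z); last by lra.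
  rewrite (le_trans (ler_normD _ _))// lerD// normrM ler_pM//.
    rewrite (le_trans (bprim_lip pV vD _ _))// ler_wpM2l//.
    by rewrite ger0_norm ?subr_ge0// lerB// ltW.
  rewrite distrC (le_trans (bprim_lip pW wC _ _))// ler_wpM2l//.
  by rewrite ger0_norm ?subr_ge0 ?(ltW az)// lerB.
- have ba0 : 0 <= b - a by rewrite subr_ge0.
  apply: ler_wpM2r => //; nra.
Qed.

(** On a short interval the mean value theorem gives the increment of [f] as [f' c * (Y b - Y a)]
    with [c] between the two values of [Y]; continuity of [f'] then replaces [f' c] by [f' (Y z)]
    under the integral. *)
Lemma bprim_comp (rho Y f f' : R -> R) (C : R) : bprim rho Y -> (forall x : R, is_derive x 1 f (f' x)) ->
  continuous f' -> (forall x, `|f' x| <= C) ->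
  bprim (fun x => f' (Y x) * rho x) (f \o Y).
Proof.
move=> pY df cf' f'C; have [mr [D rD] YE] := pY.
have cY := bprim_continuous pY.
have mf'Y : measurable_fun setT (f' \o Y).
  by apply: continuous_measurable_fun => x; apply: continuous_comp; [exact: cY|exact: cf'].
have D0 : 0 <= D by exact: le_trans (normr_ge0 _) (rD 0).
have mk : measurable_fun setT (fun x => f' (Y x) * rho x) by exact: measurable_funM.
have kC x : `|f' (Y x) * rho x| <= C * D by rewrite normrM ler_pM.
apply: bprim_criterion => //; first by exists (C * D).
move=> x e e0.
have e1 : 0 < e / (2 * (D + 1)) by rewrite divr_gt0// mulr_gt0// ltr_wpDl.
have /cvgrPdist_le/(_ _ e1) := cf' (Y x).
rewrite near_nbhs => /nbhs_ballP[d /= d0 Hd].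
exists (d / (D + 1)); first by rewrite divr_gt0// ltr_wpDl.
move=> a b /andP[ax xb]; have ab := le_trans ax xb.
rewrite ltr_pdivlMr ?ltr_wpDl// => bad.
have near_Y z : a <= z <= b -> `|Y x - Y z| < d.
  move=> /andP[az zb]; apply: le_lt_trans bad.
  rewrite distrC (le_trans (bprim_lip pY rD _ _))//.
  have zx : `|z - x| <= b - a by rewrite ler_norml; apply/andP; split; lra.
  by rewrite mulrC ler_pM// lerDl.
have [c /andP[c1 c2] fbE] : exists2 c, Num.min (Y a) (Y b) <= c <= Num.max (Y a) (Y b) &
    f (Y b) - f (Y a) = f' c * (Y b - Y a).
  have cf z : {for z, continuous f}.
    by apply: differentiable_continuous; apply/derivable1_diffP; have [] := df z.
  have [yab|yba] := leP (Y a) (Y b).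
    have [|c cab E] := @MVT_segment R f f' (Y a) (Y b) yab (fun z _ => df z).
      exact: continuous_subspaceT.
    by exists c => //; move: cab; rewrite in_itv.
  have [|c cab E] := @MVT_segment R f f' (Y b) (Y a) (ltW yba) (fun z _ => df z).
    exact: continuous_subspaceT.
  by exists c; [move: cab; rewrite in_itv|lra].
have cx : `|Y x - c| < d.
  have := near_Y a; have := near_Y b; rewrite lexx ab lexx => /(_ isT) + /(_ isT).
  move: c1 c2; rewrite ge_min le_max; rewrite !ltr_norml => /orP[] ? /orP[] ?; lra.
rewrite /= fbE YE//.
have ir : leb.-integrable `]a, b] (EFin \o rho) by exact: oc_integrable rD.
rewrite -RintegralZl// -RintegralB//; last 2 first.
- apply: (@oc_integrable _ (C * D)) => [|z]; first exact: measurable_funM.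
  by rewrite normrM ler_pM.
- exact: oc_integrable kC.
apply: (le_trans (@Rint_oc_bound _ (C * D + C * D) e _ _ _ _ _ _)) => //.
- by apply: measurable_funB => //; exact: measurable_funM.
- move=> z; rewrite (le_trans (ler_normB _ _))// lerD// normrM ler_pM//.
- move=> z /andP[az zb]; rewrite -mulrBl normrM.
  have h1 : `|f' (Y x) - f' c| <= e / (2 * (D + 1)) by exact: Hd.
  have h2 : `|f' (Y x) - f' (Y z)| <= e / (2 * (D + 1)).
    by apply: Hd; apply: near_Y; rewrite (ltW az).
  have h3 : `|f' c - f' (Y z)| <= e / (D + 1).
    rewrite (_ : e / (D + 1) = e / (2 * (D + 1)) + e / (2 * (D + 1))); last by field; lra.
    by move: h1 h2; rewrite !ler_norml; lra.
  apply: (@le_trans _ _ (e / (D + 1) * (D + 1))); first by rewrite ler_pM// (le_trans (rD z))// lerDl.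
  by rewrite divfK// gt_eqF// ltr_wpDl.
Qed.

(** The polynomial [l ^+ 2 * Q + 2 * l * P + S] is the integral of a nonnegative function for every
    [l]. The pointwise form [p ^+ 2 <= q * r] avoids square roots and matches the relation between
    the label derivatives. *)
Lemma CauchySchwarz_Rint d (T : measurableType d) (mu : {measure set T -> \bar R})
  (D : set T) (p q r : T -> R) : measurable D ->
  mu.-integrable D (EFin \o p) -> mu.-integrable D (EFin \o q) ->
  mu.-integrable D (EFin \o r) ->
  (forall x, D x -> [/\ 0 <= q x, 0 <= r x & p x ^+ 2 <= q x * r x]) ->
  (\int[mu]_(x in D) p x) ^+ 2 <= (\int[mu]_(x in D) q x) * (\int[mu]_(x in D) r x).
Proof.
move=> mD ip iq ir H.
set P := Rintegral _ _ p; set Q := Rintegral _ _ q; set S := Rintegral _ _ r.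
have Q0 : 0 <= Q by apply: Rintegral_ge0 => x /H[].
have S0 : 0 <= S by apply: Rintegral_ge0 => x /H[].
have K l : 0 <= l ^+ 2 * Q + 2 * l * P + S.
  rewrite -!RintegralZl// -!RintegralD//; do ?[exact: integrableZ_EFin|apply: integrableD_EFin => //].
  apply: Rintegral_ge0 => x /H[q0 r0 pqr].
  have [qx0|qN0] := eqVneq (q x) 0.
    move: pqr; rewrite qx0 mul0r => p0.
    have -> : p x = 0 by apply/eqP; rewrite -sqrf_eq0 eq_le p0 sqr_ge0.
    lra.
  have q1 : 0 < q x by rewrite lt0r qN0.
  rewrite -(pmulr_rge0 _ q1); have := sqr_ge0 (l * q x + p x); nra.
have [Q1|Q1] := eqVneq Q 0.
  rewrite Q1 mul0r; have [->|P0] := eqVneq P 0; first by rewrite expr0n.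
  (* With [Q = 0] the polynomial is affine in [l]; this value of [l] would make it equal to -1. *)
  have := K (- (S + 1) / (2 * P)); rewrite Q1 (_ : 2 * (- (S + 1) / (2 * P)) * P = - (S + 1)); last by field.
  lra.
have Q2 : 0 < Q by rewrite lt0r Q1.
have := K (- P / Q); rewrite (_ : _ + _ = (Q * S - P ^+ 2) / Q); last by field.
by rewrite pmulr_lge0 ?invr_gt0// subr_ge0.
Qed.

End BoundedPrimitives.

(** * Distribution functions of finite measures *)

Section MeasureTools.
Context {R : realType}.
Local Notation leb := (@lebesgue_measure R).
Import HBNNSimple.
Local Notation measR := {measure set (measurableTypeR R) -> \bar R}.
Local Notation fmeasure := {finite_measure set (measurableTypeR R) -> \bar R}.

Lemma measure_eq_oc (m1 m2 : measR) :
  (forall a b : R, a <= b -> m1 `]a, b]%classic = m2 `]a, b]%classic) ->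
  (forall a b : R, (m1 `]a, b]%classic < +oo)%E) ->
  forall A, measurable A -> m1 A = m2 A.
Proof.
move=> m12 m1oo A mA.
have cover : \bigcup_k (`](- k%:R)%R, k%:R]%classic : set R) = setT.
  rewrite -subTset => x _; have := archi_boundP (normr_ge0 x).
  set n := Num.bound _ => xn; exists n => //=; rewrite in_itv/=.
  by move: xn; rewrite ltr_norml => /andP[-> /ltW].
apply: (@measure_unique _ R (measurableTypeR R) (@ocitv R)
  (fun k => `](- k%:R)%R, k%:R]%classic)) => //.
- exact: ocitvI.
- by move=> k; exact: is_ocitv.
- move=> _ [[a b] _ <-] /=; have [/m12//|ba] := leP a b.
  by rewrite set_itv_ge ?measure0// bnd_simp -leNgt ltW.
Qed.

(* Both sides are additive and monotone in [k], so indicators suffice. *)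
Lemma ge0_integral_density d d' (T : measurableType d) (T' : measurableType d')
  (lam : {measure set T -> \bar R}) (lam' : {measure set T' -> \bar R})
  (X : T -> T') (r : T' -> R) (D : set T') (k : T' -> \bar R) :
  measurable_fun setT X -> measurable_fun setT r -> (forall x, 0 <= r x) ->
  (forall A, measurable A -> A `<=` D -> lam (X @^-1` A) = \int[lam']_(x in A) (r x)%:E)%E ->
  measurable_fun setT k -> (forall x, 0 <= k x)%E -> (forall x, ~ D x -> k x = 0%E) ->
  (\int[lam]_x k (X x) = \int[lam']_x (k x * (r x)%:E))%E.
Proof.
move=> mX mr r0 E mk k0 kD.
pose mXm := isMeasurableFun.Build _ _ _ _ _ mX.
pose Xm : {mfun _ >-> _} := HB.pack X mXm.
rewrite -[LHS]/(\int[lam]_(x in X @^-1` setT) (k \o X) x)%E.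
rewrite -ge0_integral_pushforward//.
have mR : measurable_fun setT (EFin \o r) by exact/measurable_EFinP.
pose h := nnsfun_approx measurableT mk.
have kE x : k x = lim ((EFin \o h n) x @[n --> \oo]).
  by apply/esym/cvg_lim => //; exact: cvg_nnsfun_approx.
have -> : (\int[pushforward lam X]_y k y)%E =
    lim ((\int[pushforward lam X]_y (EFin \o h n) y)%E @[n --> \oo]).
  under eq_integral => x _ do rewrite kE.
  apply: (@monotone_convergence _ _ _ (pushforward lam Xm)) => //.
  - by move=> n; apply/measurable_EFinP; exact/measurable_funP.
  - by move=> n x _ //=; rewrite lee_fin.
  - by move=> x _ a b ab; rewrite lee_fin; exact/lefP/nd_nnsfun_approx.
have -> : (\int[lam']_x (k x * (r x)%:E))%E =
    lim ((\int[lam']_x ((EFin \o h n) x * (r x)%:E))%E @[n --> \oo]).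
  have fg x : (k x * (r x)%:E)%E = lim ((((EFin \o h n) x * (r x)%:E)%E) @[n --> \oo]).
    apply/esym/cvg_lim => //; apply: cvgeZr => //; exact: cvg_nnsfun_approx.
  under eq_integral => x _ do rewrite fg.
  apply: monotone_convergence => //.
  - by move=> n; apply: emeasurable_funM => //; apply/measurable_EFinP; exact/measurable_funP.
  - by move=> n x _ /=; rewrite mule_ge0 ?lee_fin.
  - by move=> x _ a b ab /=; rewrite lee_wpmul2r ?lee_fin//; exact/lefP/nd_nnsfun_approx.
suff suf n : (\int[pushforward lam X]_y (EFin \o h n) y)%E =
    (\int[lam']_x ((EFin \o h n) x * (r x)%:E))%E.
  by under eq_fun do rewrite suf.
transitivity (\int[lam']_x (\sum_(y \in range (h n))
    (y * \1_(h n @^-1` [set y]) x)%:E * (r x)%:E))%E; last first.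
  apply: eq_integral => x _.
  rewrite -ge0_mule_fsuml => [|y]; last exact: nnfun_muleindic_ge0.
  by rewrite fsumEFin // -(fimfunE _ x).
transitivity (\int[pushforward lam X]_x (\sum_(y \in range (h n))
   (y * \1_(h n @^-1` [set y]) x)%:E))%E.
  congr integral; apply/funext => t.
  by rewrite fsumEFin // -(fimfunE _ t).
have indich y : measurable_fun setT (fun x => (y * \1_(h n @^-1` [set y]) x)%:E).
  by apply/measurable_EFinP; exact: measurable_funM.
rewrite (@ge0_integral_fsum _ _ _ (pushforward lam Xm))//; last first.
  by move=> y x _; exact: nnfun_muleindic_ge0.
rewrite ge0_integral_fsum//; last 2 first.
  - by move=> y; apply: emeasurable_funM.
  - by move=> y x _; rewrite mule_ge0 ?lee_fin// -lee_fin nnfun_muleindic_ge0.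
apply: eq_fsbigr => y yh.
have y0 : 0 <= y by move: yh; rewrite inE => -[t _ <-].
have mh : measurable (h n @^-1` [set y]) by [].
have [->|yN0] := eqVneq y 0.
  by under eq_integral do rewrite mul0r; under [RHS]eq_integral do rewrite mul0r mul0e; rewrite !integral0.
have hD : h n @^-1` [set y] `<=` D.
  move=> t /= ht; apply: contrapT => /kD kt; move/negP : yN0; apply; rewrite -ht eq_le fun_ge0 andbT.
  have : ((h n t)%:E <= k t)%E by rewrite /h nnsfun_approxE; exact: le_approx.
  by rewrite kt lee_fin.
under eq_integral do rewrite EFinM.
rewrite (@ge0_integralZl_EFin _ _ _ (pushforward lam Xm))//; last first.
  by apply/measurable_EFinP; exact: measurable_indic.
rewrite (@integral_indic _ _ _ (pushforward lam Xm))// setIT.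
under [RHS]eq_integral do rewrite EFinM -muleA.
rewrite ge0_integralZl_EFin//; last 2 first.
  - by move=> x _; rewrite mule_ge0 ?lee_fin.
  - by apply: emeasurable_funM => //; apply/measurable_EFinP; exact: measurable_indic.
congr (_ * _)%E; rewrite [LHS]E// integral_mkcond; apply: eq_integral => x _.
rewrite patchE indicE; case: ifPn; first by rewrite mul1e.
by rewrite mul0e.
Qed.

(** The density formula is required only inside [D], and the integrand must vanish outside. For the
    initial labels [D] is the complement of the null set that carries the singular part of [mu0],
    where there is no density to speak of. *)
Lemma integral_density d d' (T : measurableType d) (T' : measurableType d')
  (lam : {measure set T -> \bar R}) (lam' : {measure set T' -> \bar R})
  (X : T -> T') (r : T' -> R) (D : set T') (k : T' -> \bar R) :
  measurable_fun setT X -> measurable_fun setT r -> (forall x, 0 <= r x) ->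
  (forall A, measurable A -> A `<=` D -> lam (X @^-1` A) = \int[lam']_(x in A) (r x)%:E)%E ->
  measurable_fun setT k -> (forall x, ~ D x -> k x = 0%E) ->
  (\int[lam]_x k (X x) = \int[lam']_x (k x * (r x)%:E))%E.
Proof.
move=> mX mr r0 E mk kD.
rewrite integralE [RHS]integralE; congr (_ - _)%E.
  under eq_integral do rewrite -/((k \o X) _) funepos_comp/=.
  rewrite (ge0_integral_density mX mr r0 E)//; [|exact: measurable_funepos|by move=> x /kD; rewrite funeposE => ->; rewrite maxxx].
  by apply: eq_integral => x _; rewrite !funeposE maxe_pMl ?lee_fin// mul0e.
under eq_integral do rewrite -/((k \o X) _) funeneg_comp/=.
rewrite (ge0_integral_density mX mr r0 E)//; [|exact: measurable_funeneg|by move=> x /kD; rewrite funenegE => ->; rewrite oppe0 maxxx].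
by apply: eq_integral => x _; rewrite !funenegE maxe_pMl ?lee_fin// mul0e mulNe.
Qed.

Section Cdf.
Variable mu : fmeasure.

(** The closed half-line makes this right-continuous, which is what turns quantiles into Galois
    adjoints. The definition of a solution uses the open half-line instead; the two differ by the
    mass of an atom. *)
Definition cdfm (x : R) : R := fine (mu `]-oo, x]%classic).

Lemma fmE (A : set (measurableTypeR R)) : measurable A -> (fine (mu A))%:E = mu A.
Proof. by move=> mA; rewrite fineK// fin_num_measure. Qed.

Lemma fine_fm_le (A B : set (measurableTypeR R)) : measurable A -> measurable B -> A `<=` B ->
  fine (mu A) <= fine (mu B).
Proof.
by move=> mA mB AB; rewrite -lee_fin !fmE// le_measure// inE.
Qed.

Lemma fine_fm_ge0 (A : set (measurableTypeR R)) : 0 <= fine (mu A).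
Proof. by rewrite fine_ge0. Qed.

Lemma fine_fmU (A B : set (measurableTypeR R)) : measurable A -> measurable B ->
  A `&` B = set0 -> fine (mu (A `|` B)) = fine (mu A) + fine (mu B).
Proof.
by move=> mA mB AB; rewrite measureU// fineD// fin_num_measure.
Qed.

Lemma cdfm_oc a b : a <= b -> fine (mu `]a, b]%classic) = cdfm b - cdfm a.
Proof.
move=> ab; rewrite /cdfm.
have -> : `]-oo, b]%classic = `]-oo, a] `|` `]a, b].
  by rewrite -itv_bndbnd_setU// bnd_simp.
rewrite fine_fmU//; first by rewrite addrC addKr.
apply/seteqP; split=> // x /= []; rewrite !in_itv/= => xa /andP[ax _].
by move: (le_lt_trans xa ax); rewrite ltxx.
Qed.

Lemma cdfm_y a : fine (mu `]a, +oo[%classic) = fine (mu setT) - cdfm a.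
Proof.
rewrite /cdfm; have -> : [set: R] = `]-oo, a] `|` `]a, +oo[.
  by rewrite -itv_bndbnd_setU ?bnd_simp// set_itvNyy.
rewrite fine_fmU//; first by rewrite addrC addKr.
apply/seteqP; split=> // x /= []; rewrite !in_itv/= andbT => xa ax.
by move: (le_lt_trans xa ax); rewrite ltxx.
Qed.

Lemma cdfm_ge0 x : 0 <= cdfm x. Proof. exact: fine_fm_ge0. Qed.

Lemma cdfm_leT x : cdfm x <= fine (mu setT).
Proof. exact: fine_fm_le. Qed.

Lemma cdfm_nd : {homo cdfm : x y / x <= y}.
Proof.
move=> x y xy; apply: fine_fm_le => // z /=; rewrite !in_itv/= => /le_trans; exact.
Qed.

Lemma fine_cvg_mu (F : (set (measurableTypeR R))^nat) (A : set (measurableTypeR R)) :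
  (forall n, measurable (F n)) -> measurable A ->
  mu \o F @ \oo --> mu A -> fine (mu (F n)) @[n --> \oo] --> fine (mu A).
Proof. by move=> mF mA H; apply: fine_cvg; rewrite fmE. Qed.

(** Right-continuity, phrased through lower bounds: for a monotone function this is the exact
    hypothesis of [galois_point]. *)
Lemma cdfm_rc x c : (forall y, x < y -> c <= cdfm y) -> c <= cdfm x.
Proof.
move=> H; have E := itvNycEbigcap false x.
have : cdfm (x + n.+1%:R^-1) @[n --> \oo] --> cdfm x.
  apply: (@fine_cvg_mu (fun n => `]-oo, x + n.+1%:R^-1]%classic)) => //.
  rewrite E; apply: nonincreasing_cvg_mu => //.
  - by rewrite ltey_eq fin_num_measure.
  - exact: bigcap_measurable.
  - move=> n m nm; apply/subsetPset => z /=; rewrite !in_itv/= => /le_trans; apply.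
    by rewrite lerD2l lef_pV2 ?posrE// ler_nat.
move=> /cvgr_to_ge; apply; apply: nearW => n; apply: H; by rewrite ltrDl invr_gt0.
Qed.

Lemma cdfm_lo e : 0 < e -> exists x, cdfm x < e.
Proof.
move=> e0.
have : cdfm (- n%:R) @[n --> \oo] --> fine (mu set0).
  apply: (@fine_cvg_mu (fun n => `]-oo, - n%:R]%classic)) => //.
  have <- : \bigcap_n (`]-oo, (- n%:R)%R]%classic : set R) = set0.
    rewrite -subset0 => t /(_ (Num.bound `|t|) I) /=; rewrite in_itv/=.
    by have := archi_boundP (normr_ge0 t); rewrite ltr_norml => /andP[? _]; rewrite leNgt => /negP.
  apply: nonincreasing_cvg_mu => //.
  - by rewrite ltey_eq fin_num_measure.
  - exact: bigcap_measurable.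
  - move=> n m nm; apply/subsetPset => z /=; rewrite !in_itv/= => /le_trans; apply.
    by rewrite lerN2 ler_nat.
rewrite measure0/= => /cvgr_lt/(_ _ e0)[n _ /(_ n (leqnn n)) ?].
by exists (- n%:R).
Qed.

Lemma cdfm_hi e : 0 < e -> exists x, fine (mu setT) - e < cdfm x.
Proof.
move=> e0.
have : cdfm (n%:R) @[n --> \oo] --> fine (mu setT).
  apply: (@fine_cvg_mu (fun n => `]-oo, n%:R]%classic)) => //.
  have <- : \bigcup_n (`]-oo, n%:R]%classic : set R) = setT.
    rewrite -subTset => t _/=.
    exists (Num.bound `|t|) => //=; rewrite in_itv/=.
    by have := archi_boundP (normr_ge0 t); rewrite ltr_norml => /andP[_ /ltW].
  apply: nondecreasing_cvg_mu => //.
  - exact: bigcup_measurable.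
  - move=> n m nm; apply/subsetPset => z /=; rewrite !in_itv/= => /le_trans; apply.
    by rewrite ler_nat.
have e1 : fine (mu setT) - e < fine (mu setT) by rewrite ltrBlDr ltrDl.
move=> /cvgr_gt/(_ _ e1)[n _ /(_ n (leqnn n)) ?].
by exists n%:R.
Qed.

(** The left limit of [cdfm] is the mass of the open half-line. At a quantile of level [eta] it
    bounds the energy strictly to the left by [eta], even when the quantile is an atom. *)
Lemma cdfm_open x c : (forall y, y < x -> cdfm y <= c) -> fine (mu `]-oo, x[%classic) <= c.
Proof.
move=> H.
have : cdfm (x - n.+1%:R^-1) @[n --> \oo] --> fine (mu `]-oo, x[%classic).
  apply: (@fine_cvg_mu (fun n => `]-oo, x - n.+1%:R^-1]%classic)) => //.
  have -> : `]-oo, x[%classic = \bigcup_n (`]-oo, (x - n.+1%:R^-1)%R]%classic : set R).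
    apply/seteqP; split => z /=; rewrite in_itv/=; last first.
      move=> [n _ /=]; rewrite in_itv/= => /le_lt_trans; apply; by rewrite ltrBlDr ltrDl invr_gt0.
    move=> zx; have xz : 0 < x - z by rewrite subr_gt0.
    have [n ] := @near_infty_natSinv_lt R (PosNum xz).
    move=> _ /(_ n (leqnn n)) /= nxz.
    have {}nxz : n.+1%:R^-1 < x - z by [].
    by exists n => //=; rewrite in_itv/= lerBrDl -lerBrDr ltW.
  apply: nondecreasing_cvg_mu => //.
  - exact: bigcup_measurable.
  - move=> n m nm; apply/subsetPset => z /=; rewrite !in_itv/= => /le_trans; apply.
    by rewrite lerD2l lerN2 lef_pV2 ?posrE// ler_nat.
move=> /cvgr_to_le; apply; apply: nearW => n; apply: H; by rewrite ltrBlDr ltrDl invr_gt0.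
Qed.

End Cdf.

Lemma cdfm_inj (mu nu : fmeasure) : cdfm mu =1 cdfm nu ->
  forall A, measurable A -> mu A = nu A.
Proof.
move=> E; apply: measure_eq_oc.
  move=> a b ab; transitivity (fine (mu `]a, b]%classic))%:E; first by rewrite fmE.
  transitivity (fine (nu `]a, b]%classic))%:E; last by rewrite fmE.
  by congr EFin; rewrite !cdfm_oc// !E.
by move=> a b; rewrite ltey_eq fin_num_measure.
Qed.

(** The infimum of the points with [c <= S x], attained by right-continuity. An equivalence, rather
    than a case analysis on jumps and flat pieces, describes this generalised inverse; it produces
    the initial labels, the inverse of the flow and the energy quantiles. *)
Lemma galois_point (S : R -> R) (c x0 x1 : R) : {homo S : x y / x <= y} ->
  (forall x, (forall y, x < y -> c <= S y) -> c <= S x) ->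
  S x0 < c -> c <= S x1 -> exists q, forall x, (q <= x) = (c <= S x).
Proof.
move=> Snd Src Sx0 Sx1; pose E := [set x | c <= S x].
have lE : lbound E x0.
  move=> x /= cx; rewrite leNgt; apply/negP => xx0.
  by have := lt_le_trans Sx0 (le_trans cx (Snd _ _ (ltW xx0))); rewrite ltxx.
have hE : has_inf E by split; [exists x1|exists x0].
exists (inf E) => x; apply/idP/idP => [ix|cx]; last by apply: ge_inf => //; case: hE.
apply: Src => y xy.
have yx : 0 < y - x by rewrite subr_gt0.
have [z Ez zy] := inf_adherent yx hE.
apply: (le_trans Ez); apply: Snd; lra.
Qed.

End MeasureTools.

(** * Lagrangian labels *)

Section LagrangianMeasure.
Context {R : realType}.
Local Notation leb := (@lebesgue_measure R).
Local Notation T := (measurableTypeR R).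
Variables (h y : T -> T).

(** The image under [y] of the measure with density [h]. The proofs are arguments of the term so
    that the measure structure can be attached to it. *)
Definition lmeas (my : measurable_fun [set: T] y) (mh : measurable_fun [set: T] h)
  (h0 : forall x, 0 <= h x) (A : set T) : \bar R :=
  (\int[leb]_(x in y @^-1` A) (h x)%:E)%E.

Section Instances.
Variables (my : measurable_fun [set: T] y) (mh : measurable_fun [set: T] h)
  (h0 : forall x, 0 <= h x).

Let lmeas0 : lmeas my mh h0 set0 = 0%E.
Proof. by rewrite /lmeas preimage_set0 integral_set0. Qed.

Let lmeas_ge0 A : (0 <= lmeas my mh h0 A)%E.
Proof. by apply: integral_ge0 => x _; rewrite lee_fin. Qed.

Let lmeas_sigma : semi_sigma_additive (lmeas my mh h0).
Proof.
move=> F mF tF mUF; rewrite /lmeas preimage_bigcup.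
apply: (@semi_sigma_additive_nng_induced _ T R leb (EFin \o h)).
- exact/measurable_EFinP.
- by move=> x; rewrite lee_fin.
- by move=> i; rewrite -[X in measurable X]setTI; exact: my.
- apply/trivIsetP => i j _ _ ij; rewrite -preimage_setI.
  by move/trivIsetP : tF => /(_ i j I I ij) ->; rewrite preimage_set0.
- rewrite -preimage_bigcup -[X in measurable X]setTI; exact: my.
Qed.

HB.instance Definition _ := isMeasure.Build _ _ _ (lmeas my mh h0)
  lmeas0 lmeas_ge0 lmeas_sigma.
End Instances.

(** A copy of [lmeas] that also carries the proof of finite mass, so that the structure of finite
    measure can be inferred from the term. *)
Definition flmeas (my : measurable_fun [set: T] y) (mh : measurable_fun [set: T] h)
  (h0 : forall x, 0 <= h x) (hT : (\int[leb]_x (h x)%:E < +oo)%E) : set T -> \bar R :=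
  lmeas my mh h0.

Section FiniteInstance.
Variables (my : measurable_fun [set: T] y) (mh : measurable_fun [set: T] h)
  (h0 : forall x, 0 <= h x) (hT : (\int[leb]_x (h x)%:E < +oo)%E).

HB.instance Definition _ := Measure.on (flmeas my mh h0 hT).

Let flmeas_fin : fin_num_fun (flmeas my mh h0 hT).
Proof.
move=> A mA; rewrite ge0_fin_numE//; apply: le_lt_trans hT.
apply: ge0_subset_integral => //.
- by rewrite -[X in measurable X]setTI; exact: my.
- exact/measurable_EFinP.
- by move=> x _; rewrite lee_fin.
Qed.

HB.instance Definition _ := Measure_isFinite.Build _ _ _ (flmeas my mh h0 hT) flmeas_fin.
End FiniteInstance.

End LagrangianMeasure.

(** * Labels built from the initial data *)

Section LagrangianData.
Context {R : realType}.
Local Notation leb := (@lebesgue_measure R).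
Local Notation fmeasure := {finite_measure set (measurableTypeR R) -> \bar R}.

(* Lagrangian unknowns: position [y], velocity [U] and cumulative energy [H],
   all Lipschitz in the label, with derivatives [a], [w], [h]. *)
Record lagrangian (M : R) (y U H a w h : R -> R) : Prop := Lagrangian {
  lagr_y : bprim a y;
  lagr_U : bprim w U;
  lagr_H : bprim h H;
  lagr_a0 : forall xi, 0 <= a xi;
  lagr_h0 : forall xi, 0 <= h xi;
  lagr_ah : forall xi, a xi + h xi = 1;
  lagr_w2 : forall xi, w xi ^+ 2 = a xi * h xi;
  lagr_id : forall xi, y xi + H xi = xi;
  lagr_H0 : forall xi, 0 <= H xi;
  lagr_HM : forall xi, H xi <= M;
  lagr_Hoc : forall xi, (\int[leb]_(z in `]-oo, xi]) (h z)%:E)%E = (H xi)%:E;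
  lagr_hT : (\int[leb]_z (h z)%:E)%E = M%:E }.

Variables (u0 g : R -> R) (mu0 : fmeasure) (N : set (measurableTypeR R)).
Hypotheses (hg : has_weak_deriv u0 g) (mN : measurable N) (N0 : leb N = 0%E).
Hypothesis hmu : forall A, measurable A ->
  mu0 A = (\int[leb]_(x in A) ((g x) ^+ 2)%R%:E + mu0 (A `&` N))%E.

Let M := fine (mu0 setT).
Let F := cdfm mu0.

(** Inverts [x + F x], whose increments dominate those of [x], so the inverse is 1-Lipschitz; a jump
    of [F] at an atom becomes an interval of labels at one position. *)
Lemma label_exists : exists y0 : R -> R, forall xi x, (y0 xi <= x) = (xi <= x + F x).
Proof.
suff /choice[y0 hy] : forall xi, exists q, forall x, (q <= x) = (xi <= x + F x).
  by exists y0.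
move=> xi.
  (* Since [0 <= F <= M], the sum is at most [xi - 1] at the first point and at least [xi] at the
     second. *)
  apply: (@galois_point _ (fun x => x + F x) xi (xi - M - 1) xi).
  - by move=> x y xy; rewrite lerD// cdfm_nd.
  - move=> x Hx; rewrite -lerBlDl; apply: cdfm_rc => z xz.
    rewrite lerBlDl.
    apply/ler_addgt0Pr => e e0.
    (* Right-continuity is known for [F] alone: a point within [e] of [x] controls the linear term,
       and monotonicity of [F] carries the bound on to [z]. *)
    have [z' [xz' z'z z'x]] : exists z', [/\ x < z', z' <= z & z' <= x + e].
      by exists (Num.min z (x + e)); rewrite lt_min xz ltrDl e0 !ge_min !lexx orbT.
    have := Hx _ xz'; have := cdfm_nd mu0 z'z; rewrite -/F; lra.
  - have := cdfm_leT mu0 (xi - M - 1); rewrite -/M -/F; lra.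
  - by rewrite lerDl cdfm_ge0.
Qed.

Variable y0 : R -> R.
Hypothesis hy : forall xi x, (y0 xi <= x) = (xi <= x + F x).

Lemma label_nd : {homo y0 : x z / x <= z}.
Proof. by move=> x z xz; rewrite hy (le_trans xz)// -hy. Qed.

Lemma label_meas : measurable_fun [set: measurableTypeR R] (y0 : measurableTypeR R -> measurableTypeR R).
Proof. exact: (nondecreasing_measurable measurableT label_nd). Qed.

(** [x + F x] is the last label at position [x]; if [x] is an atom, the labels at [x] fill an
    interval that ends there. *)
Lemma labelS x : y0 (x + F x) = x.
Proof.
apply/eqP; rewrite eq_le hy lexx/= leNgt; apply/negP => lt.
have : x + F x <= y0 (x + F x) + F (y0 (x + F x)) by rewrite -hy.
have := cdfm_nd mu0 (ltW lt); rewrite -/F; lra.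
Qed.

Lemma label_preim a b : y0 @^-1` `]a, b] = `]a + F a, b + F b]%classic.
Proof.
apply/seteqP; split => xi /=; rewrite !in_itv/= hy; by rewrite !ltNge hy.
Qed.

(** Label length counts position plus energy: the preimage of []a, b]] runs between last labels and
    has length [(b - a) + (F b - F a)], and half-open intervals determine the measure. *)
Lemma label_push (A : set (measurableTypeR R)) : measurable A -> leb (y0 @^-1` A) = (leb A + mu0 A)%E.
Proof.
move=> mA.
have mm := label_meas.
pose mXm := isMeasurableFun.Build _ _ _ _ _ mm.
pose Xm : {mfun _ >-> _} := HB.pack (y0 : measurableTypeR R -> measurableTypeR R) mXm.
have ab_E (a b : R) : a <= b -> leb (y0 @^-1` `]a, b]) = (leb `]a, b]%classic + mu0 `]a, b]%classic)%E.
  move=> ab; rewrite label_preim (@leb_oc _ (a + F a)); last by rewrite lerD// cdfm_nd.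
  rewrite leb_oc// -(fmE mu0)// cdfm_oc// -/F -EFinD; congr EFin; lra.
rewrite -measure_addE.
apply: (@measure_eq_oc _ (pushforward leb Xm) (measure_add leb mu0) _ _ A mA).
  by move=> a b ab; apply: (eq_trans (ab_E _ _ ab)); exact/esym/measure_addE.
move=> a b; have [ab|ba] := leP a b.
  by rewrite [X in (X < _)%E]ab_E// leb_oc// -(fmE mu0)// ltry.
by rewrite set_itv_ge ?measure0 ?ltry// bnd_simp -leNgt ltW.
Qed.

Lemma setN_alpha x : \1_(~` N) x = (x \notin N)%:R :> R.
Proof. by rewrite indicE in_setC. Qed.

Lemma weak_meas : measurable_fun setT g. Proof. by case: hg. Qed.

(** Label derivatives of position and of velocity, as functions of position: a label step over [dx]
    has length [(1 + g ^+ 2) dx] where the energy has density [g ^+ 2]. On [N] both are zero, so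
    that there the whole label step is energy. *)
Let al (x : R) : R := \1_(~` N) x / (1 + g x ^+ 2).
Let be (x : R) : R := \1_(~` N) x * g x / (1 + g x ^+ 2).

Let pos1 x : 0 < 1 + g x ^+ 2.
Proof. by rewrite ltr_pwDl// sqr_ge0. Qed.

Let m1g : measurable_fun setT (fun x => 1 + g x ^+ 2).
Proof.
by apply: measurable_funD => //; apply: measurable_funX; exact: weak_meas.
Qed.

Let mi : measurable_fun setT (fun x => (1 + g x ^+ 2)^-1).
Proof.
have -> : (fun x => (1 + g x ^+ 2)^-1) = (fun x => x `^ (-1)) \o (fun x => 1 + g x ^+ 2).
  by apply/funext => x /=; rewrite powR_inv1// ltW.
by apply: measurableT_comp => //; exact: measurable_powR.
Qed.

Let mal : measurable_fun setT al.
Proof. by apply: measurable_funM => //; apply: measurable_indic; exact: measurableC. Qed.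

Let mbe : measurable_fun setT be.
Proof.
apply: measurable_funM => //; apply: measurable_funM => //; last exact: weak_meas.
by apply: measurable_indic; exact: measurableC.
Qed.

Let al01 x : 0 <= al x <= 1.
Proof.
rewrite /al setN_alpha; case: (x \notin N); last by rewrite mul0r lexx ler01.
by rewrite mul1r invr_ge0 ltW//= invf_le1// lerDl sqr_ge0.
Qed.

Let be2 x : be x ^+ 2 = al x * (1 - al x).
Proof.
rewrite /al /be setN_alpha; case: (x \notin N); last by rewrite !mul0r expr0n.
by rewrite !mul1r; field; rewrite gt_eqF.
Qed.

Let be1 x : `|be x| <= 1.
Proof.
have := be2 x; have /andP[? ?] := al01 x => E.
rewrite -(@ler_pXn2r _ 2%N) ?nnegrE// real_normK ?num_real// E expr1n; nra.
Qed.

(* [y0] is constant on the intervals coming from atoms of [mu0], and there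
   [k (y0 _) = 0] since atoms lie in [N]. *)
Lemma label_int (k : R -> R) C : measurable_fun setT k -> (forall x, `|k x| <= C) ->
  (forall x, N x -> k x = 0) -> forall a b, a <= b ->
  (\int[leb]_(xi in `]a, b]) (k (y0 xi))%:E =
   \int[leb]_(x in `]y0 a, y0 b]) (k x * (1 + g x ^+ 2))%:E)%E.
Proof.
move=> mk kC kN a b ab.
have mky : measurable_fun setT (k \o y0) by apply: measurableT_comp => //; exact: label_meas.
have kyC x : `|(k \o y0) x| <= C by exact: kC.
have int_ c d : leb.-integrable `]c, d] (EFin \o (k \o y0)) by exact: oc_integrable kyC.
have EI c d : (\int[leb]_(xi in `]c, d]) (k (y0 xi))%:E)%E = (\int[leb]_(xi in `]c, d]) (k (y0 xi)))%:E.
  by rewrite /Rintegral fineK//; exact: integrable_fin_num (int_ c d).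
(* From [c] to the last label at the same position the integrand is the constant [k (y0 c)]. Either
   it is zero, or the position lies off [N]; then it is not an atom and the label interval is
   empty. *)
have atom c : \int[leb]_(xi in `]c, y0 c + F (y0 c)]) (k (y0 xi)) = 0.
  have cS : c <= y0 c + F (y0 c) by rewrite -hy.
  have [kc|/eqP kc] := eqVneq (k (y0 c)) 0; last first.
    have yN : ~ N (y0 c) by move=> /kN.
    have : leb (y0 @^-1` [set y0 c]) = 0%E.
      rewrite label_push// lebesgue_measure_set1 add0e hmu//.
      have -> : [set y0 c] `&` N = set0 by apply/seteqP; split => // x /= [-> ].
      rewrite measure0 adde0; apply: null_set_integral => //; last exact: lebesgue_measure_set1.
      by apply/measurable_EFinP; apply: measurable_funTS; apply: measurable_funX; exact: weak_meas.
    move=> l0; have : (leb `]c, (y0 c + F (y0 c))%R]%classic <= 0)%E.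
      rewrite -l0; apply: le_measure; rewrite ?inE//.
        rewrite -[X in measurable X]setTI; exact: label_meas.
      move=> xi /=; rewrite in_itv/= => /andP[cx]; rewrite -hy => yx.
      by apply/eqP; rewrite eq_le yx label_nd// ltW.
    rewrite leb_oc// lee_fin subr_le0 => Sc.
    have -> : y0 c + F (y0 c) = c by apply/eqP; rewrite eq_le Sc cS.
    exact: Rint_oc0.
  rewrite (@eq_Rintegral _ _ _ _ _ (fun=> 0)) ?Rint_oc_cst ?mul0r//.
  move=> xi; rewrite inE/= in_itv/= => /andP[cx]; rewrite -hy => yx.
  by rewrite (_ : y0 xi = y0 c) ?kc//; apply/eqP; rewrite eq_le yx label_nd// ltW.
have aS : a <= y0 a + F (y0 a) by rewrite -hy.
have bS : b <= y0 b + F (y0 b) by rewrite -hy.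
have SS : y0 a + F (y0 a) <= y0 b + F (y0 b) by rewrite lerD ?cdfm_nd// label_nd.
(* Moving both ends to last labels changes nothing and makes the label interval the full preimage of
   []y0 a, y0 b]]. *)
rewrite EI -[X in X%:E](addr0) -{1}(atom b) -(Rint_oc_cat mky kyC ab bS).
rewrite (Rint_oc_cat mky kyC aS SS) (atom a) add0r -EI -label_preim.
rewrite [LHS]integral_mkcond.
transitivity (\int[leb]_xi ((k \_ `]y0 a, y0 b]) (y0 xi))%:E)%E.
  apply: eq_integral => xi _; rewrite !patchE.
  have -> : (xi \in y0 @^-1` `]y0 a, y0 b]) = (y0 xi \in `]y0 a, y0 b]%classic).
    by apply/idP/idP; rewrite !inE.
  by case: ifPn.
transitivity (\int[leb]_x ((((k \_ `]y0 a, y0 b]) x)%:E * (1 + g x ^+ 2)%R%:E)))%E.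
  apply: (@integral_density _ _ _ _ _ leb leb y0 (fun x => 1 + g x ^+ 2) (~` N)
     (fun x => ((k \_ `]y0 a, y0 b]) x)%:E)).
  - exact: label_meas.
  - exact: m1g.
  - by move=> x; exact: ltW.
  - move=> A mA AN; apply: (eq_trans (label_push mA)); rewrite hmu//.
    have -> : A `&` N = set0.
      by apply/seteqP; split => // x /= [/AN].
    rewrite measure0 adde0.
    under [RHS]eq_integral do rewrite EFinD.
    rewrite ge0_integralD//.
    + by rewrite integral_cst// mul1e.
    + by move=> x _; rewrite lee_fin sqr_ge0.
    + by apply/measurable_EFinP; apply: measurable_funTS; apply: measurable_funX; exact: weak_meas.
  - apply/measurable_EFinP. apply/(measurable_restrictT _ _).1 => //; exact: measurable_funTS.
  - move=> x /contrapT /kN kx; rewrite patchE; case: ifPn => _ //; by rewrite kx.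
rewrite [RHS]integral_mkcond; apply: eq_integral => x _; rewrite !patchE.
by case: ifPn => _; rewrite ?mul0e// EFinM.
Qed.

Let ya xi := al (y0 xi).
Let yb xi := be (y0 xi).
Let yh xi := 1 - al (y0 xi).

Let negN (f : R -> R) (A : set (measurableTypeR R)) : measurable A -> measurable_fun setT f ->
  (\int[leb]_(x in A) (\1_(~` N) x * f x)%:E = \int[leb]_(x in A) (f x)%:E)%E.
Proof.
move=> mA mf; apply: ae_eq_integral => //.
- apply/measurable_EFinP; apply: measurable_funTS; apply: measurable_funM => //.
  by apply: measurable_indic; exact: measurableC.
- by apply/measurable_EFinP; exact: measurable_funTS.
- exists N; split => // x /= H; apply: contrapT => Nx; apply: H => _.
  have nN : x \notin N by apply/negP; rewrite inE.
  by rewrite setN_alpha nN mul1r.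
Qed.

(** The weight [1 + g ^+ 2] produced by [label_int] cancels the denominator of [al] and leaves the
    indicator of the complement of a null set. For the velocity the same cancellation leaves [g]. *)
Lemma label_bprim : bprim ya y0.
Proof.
split.
- by apply: measurableT_comp => //; exact: label_meas.
- by exists 1 => x; have /andP[? ?] := al01 (y0 x); rewrite ger0_norm.
- move=> a b ab; rewrite /Rintegral (@label_int al 1)//.
  + rewrite (eq_integral (fun x => (\1_(~` N) x * (cst 1 x))%:E)).
      rewrite negN// [X in fine X](_ : _ = (1 * leb `]y0 a, y0 b]%classic)%E); last by apply: (@integral_cst _ _ _ leb `]y0 a, y0 b]%classic _ 1%E).
      by rewrite mul1e leb_oc// label_nd.
    by move=> x _; rewrite /al /cst mulr1 divfK// gt_eqF.
  + by move=> x; have /andP[? ?] := al01 x; rewrite ger0_norm.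
  + by move=> x Nx; rewrite /al setN_alpha mem_set// mul0r.
Qed.

Lemma label_U_bprim : bprim yb (u0 \o y0).
Proof.
split.
- by apply: measurableT_comp => //; exact: label_meas.
- by exists 1 => x; exact: be1.
- move=> a b ab; rewrite /Rintegral (@label_int be 1)//.
  + rewrite (eq_integral (fun x => (\1_(~` N) x * g x)%:E)).
      rewrite negN//; last exact: weak_meas.
      have [_ /(_ _ _ (label_nd ab))[_ Eg]] := hg.
      rewrite integral_itv_obnd_cbnd -?Eg//.
      by apply/measurable_EFinP; apply: measurable_funTS; exact: weak_meas.
    by move=> x _; rewrite /be divfK// gt_eqF.
  + by move=> x Nx; rewrite /be setN_alpha mem_set// !mul0r.
Qed.

Let yh0 xi : 0 <= yh xi.
Proof. by rewrite subr_ge0; have /andP[] := al01 (y0 xi). Qed.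

Let label_H_bprim : bprim yh (fun xi => xi - y0 xi).
Proof.
apply: (bprim_ext (bprimD (bprim_id) (bprimZ (-1) label_bprim))) => x /=.
  by rewrite mulN1r.
by rewrite mulN1r.
Qed.

Let myh : measurable_fun [set: measurableTypeR R] (yh : measurableTypeR R -> measurableTypeR R).
Proof. by case: label_H_bprim. Qed.

Let EH a b : a <= b -> (\int[leb]_(z in `]a, b]) (yh z)%:E)%E = ((b - y0 b) - (a - y0 a))%:E.
Proof.
have [_ [C hC] HE] := label_H_bprim => ab.
rewrite (HE _ _ ab) /Rintegral fineK//.
by apply: integrable_fin_num => //; exact: (oc_integrable _ _ myh hC).
Qed.

(** At a last label, label minus position is exactly [F], so the energy of the labels over []a, b]]
    is [F b - F a], atoms included. *)
Lemma label_mu0 (A : set (measurableTypeR R)) : measurable A -> (\int[leb]_(z in y0 @^-1` A) (yh z)%:E)%E = mu0 A.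
Proof.
move=> mA; rewrite -[LHS]/(lmeas label_meas myh yh0 A).
have ab_E (a b : R) : a <= b -> lmeas label_meas myh yh0 `]a, b]%classic = mu0 `]a, b]%classic.
  move=> ab; rewrite /lmeas label_preim EH; last by rewrite lerD// cdfm_nd.
  rewrite !labelS -(fmE mu0)// cdfm_oc// -/F; congr EFin; lra.
apply: (@measure_eq_oc _ (lmeas label_meas myh yh0) mu0 _ _ A mA) => //.
move=> a b; have [ab|ba] := leP a b.
  by rewrite [X in (X < _)%E]ab_E// -(fmE mu0)// ltry.
by rewrite set_itv_ge ?measure0 ?ltry// bnd_simp -leNgt ltW.
Qed.

Lemma label_lagrangian :
  lagrangian M y0 (u0 \o y0) (fun xi => xi - y0 xi) ya yb yh.
Proof.
split => //.
- exact: label_bprim.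
- exact: label_U_bprim.
- by move=> xi; have /andP[] := al01 (y0 xi).
- by move=> xi; rewrite /ya /yh addrC subrK.
- by move=> xi; rewrite /ya /yh be2.
- by move=> xi; rewrite addrC subrK.
- by move=> xi; rewrite subr_ge0 hy lerDl cdfm_ge0.
- move=> xi; have : xi <= y0 xi + F (y0 xi) by rewrite -hy.
  have := cdfm_leT mu0 (y0 xi); rewrite -/M -/F; lra.
(* The integral from [-oo] is first known up to the last label [S] at the position of [xi], where it
   is [mu0] of a half-line. Between [xi] and [S] the position is constant, so the energy to subtract
   is [S - xi]. *)
- move=> xi; have xS : xi <= y0 xi + F (y0 xi) by rewrite -hy.
  have [S [{}xS SE yS]] : exists S, [/\ xi <= S, S = y0 xi + F (y0 xi) & y0 S = y0 xi].
    by exists (y0 xi + F (y0 xi)); rewrite labelS.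
  have E1 : (\int[leb]_(z in `]-oo, S]) (yh z)%:E)%E = (F (y0 xi))%:E.
    have := label_mu0 (A := `]-oo, y0 xi]%classic).
    rewrite /F /cdfm fmE// => <- //; congr integral; apply/seteqP; split => z /=; by rewrite !in_itv/= hy SE.
  have SU : `]-oo, S]%classic = `]-oo, xi] `|` `]xi, S].
    by rewrite -itv_bndbnd_setU// bnd_simp.
  move: E1; rewrite SU ge0_integral_setU//; last 3 first.
  + by apply/measurable_EFinP; exact: measurable_funTS.
  + by move=> x _; rewrite lee_fin.
  + apply/disj_setPS => x [] /=; rewrite !in_itv/= => xa /andP[ax _].
    by move: (le_lt_trans xa ax); rewrite ltxx.
  rewrite EH// yS.
  set I := (\int[leb]_(x in _) _)%E => E1.
  have I0 : (0 <= I)%E by apply: integral_ge0 => x _; rewrite lee_fin.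
  have Ifin : I \is a fin_num.
    by rewrite fin_numE; move: E1 I0; case: I.
  by move: E1; rewrite -(fineK Ifin) -EFinD => -[] E1; congr EFin; lra.
- by have := label_mu0 measurableT; rewrite preimage_setT /M fmE.
Qed.

End LagrangianData.

(** * The Lagrangian flow *)

Section Evolution.
Context {R : realType}.
Local Notation leb := (@lebesgue_measure R).
Local Notation T := (measurableTypeR R).
Variables (M C0 : R) (y0 U0 H a w h : R -> R).
Hypothesis L : lagrangian M y0 U0 H a w h.
Hypothesis UC : forall xi, `|U0 xi| <= C0.

(** The explicit solution of [y' = U], [U' = (H - (M - H)) / 4] with [H] constant in time.
    [flow_jac] and [flowU_jac] are its derivatives in the label. *)
Definition flow (t xi : R) : R := y0 xi + t * U0 xi + t ^+ 2 / 8 * (2 * H xi - M).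
Definition flowU (t xi : R) : R := U0 xi + t / 4 * (2 * H xi - M).
Definition flow_jac (t xi : R) : R := a xi + t * w xi + t ^+ 2 / 4 * h xi.
Definition flowU_jac (t xi : R) : R := w xi + t / 2 * h xi.

Lemma C0_ge0 : 0 <= C0. Proof. exact: le_trans (normr_ge0 _) (UC 0). Qed.

Lemma lagr_M0 : 0 <= M.
Proof. exact: le_trans (lagr_H0 L 0) (lagr_HM L 0). Qed.

Lemma lagr_a01 xi : 0 <= a xi <= 1.
Proof. have := lagr_a0 L xi; have := lagr_h0 L xi; have := lagr_ah L xi => ? ? ?; apply/andP; split; lra. Qed.

Lemma lagr_h01 xi : 0 <= h xi <= 1.
Proof. have := lagr_a0 L xi; have := lagr_h0 L xi; have := lagr_ah L xi => ? ? ?; apply/andP; split; lra. Qed.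

Lemma lagr_w1 xi : `|w xi| <= 1.
Proof.
have := lagr_w2 L xi; have /andP[? ?] := lagr_a01 xi; have /andP[? ?] := lagr_h01 xi => E.
rewrite -(@ler_pXn2r _ 2%N) ?nnegrE// real_normK ?num_real// E expr1n; nra.
Qed.

Lemma lagr_HMb xi : `|2 * H xi - M| <= M.
Proof. have := lagr_H0 L xi; have := lagr_HM L xi => ? ?; rewrite ler_norml; apply/andP; split; lra. Qed.

Lemma flow_bprim t : bprim (flow_jac t) (flow t).
Proof.
have B2 := bprimZ (t ^+ 2 / 8) (bprimD (bprimZ 2 (lagr_H L)) (bprim_cst (- M))).
apply: (bprim_ext (bprimD (bprimD (lagr_y L) (bprimZ t (lagr_U L))) B2)) => x //=.
by rewrite /flow_jac; field.
Qed.

Lemma flowU_bprim t : bprim (flowU_jac t) (flowU t).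
Proof.
have B2 := bprimZ (t / 4) (bprimD (bprimZ 2 (lagr_H L)) (bprim_cst (- M))).
apply: (bprim_ext (bprimD (lagr_U L) B2)) => x //=.
by rewrite /flowU_jac; field.
Qed.

(** As a quadratic in [t] it has zero discriminant, because [w ^+ 2 = a * h]; multiplied by [a] it
    is the square of [a + t / 2 * w]. Positions thus stay ordered through wave breaking. *)
Lemma flow_jac_ge0 t xi : 0 <= flow_jac t xi.
Proof.
have /andP[a0 a1] := lagr_a01 xi; have /andP[h0 h1] := lagr_h01 xi.
have w2 := lagr_w2 L xi; have ah := lagr_ah L xi; rewrite /flow_jac.
have [a00|aN0] := eqVneq (a xi) 0.
  move: w2; rewrite a00 mul0r => /eqP; rewrite sqrf_eq0 => /eqP ->.
  by rewrite mulr0 !add0r mulr_ge0// divr_ge0// sqr_ge0.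
have a2 : 0 < a xi by rewrite lt0r aN0.
rewrite -(pmulr_rge0 _ a2).
have -> : a xi * (a xi + t * w xi + t ^+ 2 / 4 * h xi) = (a xi + t / 2 * w xi) ^+ 2.
  by rewrite sqrrD exprMn w2; field.
exact: sqr_ge0.
Qed.

(** The relation [w ^+ 2 = a * h] at later times. Divided by [flow_jac], it says that the energy
    density stays equal to the squared slope of the velocity. *)
Lemma flow_jac2 t xi : flowU_jac t xi ^+ 2 = flow_jac t xi * h xi.
Proof. by rewrite /flowU_jac /flow_jac sqrrD exprMn (lagr_w2 L); field. Qed.

Lemma flow_nd t : {homo flow t : x z / x <= z}.
Proof.
move=> x z xz; rewrite -subr_ge0; have [_ _ ->//] := flow_bprim t.
by apply: Rintegral_ge0 => s _; exact: flow_jac_ge0.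
Qed.

Lemma flow_continuous t : continuous (flow t).
Proof. exact: bprim_continuous (flow_bprim t). Qed.

Lemma flowU_continuous t : continuous (flowU t).
Proof. exact: bprim_continuous (flowU_bprim t). Qed.

Lemma flow_derive (xi t : R) : is_derive t 1 (fun t => flow t xi) (flowU t xi).
Proof.
rewrite /flow /flowU; set c := 2 * H xi - M.
apply: is_derive_eq; by rewrite /= !scaler1 /GRing.scale/=; field.
Qed.

Lemma flow_dist T0 t s xi : 0 <= t <= T0 -> 0 <= s <= T0 ->
  `|flow t xi - flow s xi| <= (C0 + T0 * M / 4) * `|t - s|.
Proof.
move=> /andP[t0 tT] /andP[s0 sT].
have -> : flow t xi - flow s xi = (U0 xi + (t + s) / 8 * (2 * H xi - M)) * (t - s).
  by rewrite /flow; field.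
rewrite normrM ler_wpM2r// (le_trans (ler_normD _ _))// lerD// normrM.
have -> : T0 * M / 4 = (T0 / 4) * M by field.
by rewrite ler_pM ?lagr_HMb// ger0_norm; lra.
Qed.

Lemma flowU_bound T0 t xi : 0 <= t <= T0 -> `|flowU t xi| <= C0 + T0 * M / 4.
Proof.
move=> /andP[t0 tT]; rewrite /flowU (le_trans (ler_normD _ _))// lerD// normrM.
have -> : T0 * M / 4 = (T0 / 4) * M by field.
by rewrite ler_pM ?lagr_HMb// ger0_norm; lra.
Qed.

(** A bounded distance between label and position makes the flow surjective, and turns compact
    support in position into compact support in the label. *)
Lemma flow_label t xi : `|flow t xi - xi| <= M + `|t| * C0 + t ^+ 2 / 8 * M.
Proof.
have -> : flow t xi - xi = (- H xi) + t * U0 xi + t ^+ 2 / 8 * (2 * H xi - M).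
  by rewrite /flow -[X in _ - X](lagr_id L xi); ring.
rewrite (le_trans (ler_normD _ _))// lerD//.
  rewrite (le_trans (ler_normD _ _))// lerD//.
    by rewrite normrN ger0_norm ?(lagr_H0 L)// (lagr_HM L).
  by rewrite normrM ler_wpM2l.
by rewrite normrM (ger0_norm (_ : 0 <= t ^+ 2 / 8)) ?divr_ge0 ?sqr_ge0// ler_wpM2l ?lagr_HMb// divr_ge0 ?sqr_ge0.
Qed.

Lemma unflow_exists t : exists Y : R -> R, forall x xi, (Y x <= xi) = (x <= flow t xi).
Proof.
suff /choice[Y hY] : forall x, exists q, forall xi, (q <= xi) = (x <= flow t xi) by exists Y.
move=> x; set K := M + `|t| * C0 + t ^+ 2 / 8 * M.
apply: (@galois_point _ (flow t) x (x - K - 1) (x + K)).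
- exact: flow_nd.
- move=> z Hz; have cf : flow t s @[s --> z^'+] --> flow t z.
    by apply: cvg_at_right_filter; exact: flow_continuous.
  apply: (cvgr_to_ge cf).
  by near=> s; apply: Hz; near: s; exact: nbhs_right_gt.
- have := flow_label t (x - K - 1); rewrite -/K ler_norml => /andP[]; lra.
- have := flow_label t (x + K); rewrite -/K ler_norml => /andP[]; lra.
Unshelve. all: by end_near. Qed.

(** The leftmost label at position [x]. The choice of label does not affect the velocity
    ([flowU_flat]), and the leftmost one makes the energy of the open half-line equal to [H] at that
    label. *)
Definition unflow (t : R) : R -> R := projT1 (cid (unflow_exists t)).

Lemma unflowE t x xi : (unflow t x <= xi) = (x <= flow t xi).
Proof. by rewrite /unflow; case: cid => Y /= ->. Qed.

Lemma unflow_lt t x xi : (xi < unflow t x) = (flow t xi < x).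
Proof. by rewrite !ltNge unflowE. Qed.

Lemma flowK t x : flow t (unflow t x) = x.
Proof.
apply/eqP; rewrite eq_le -unflowE lexx andbT.
have cf : flow t s @[s --> (unflow t x)^'-] --> flow t (unflow t x).
  by apply: cvg_at_left_filter; exact: flow_continuous.
apply: (cvgr_to_le cf).
near=> s; rewrite ltW// -unflow_lt; near: s; exact: nbhs_left_lt.
Unshelve. all: by end_near. Qed.

Lemma unflow_nd t : {homo unflow t : x z / x <= z}.
Proof. by move=> x z xz; rewrite unflowE (le_trans xz)// flowK. Qed.

Lemma unflow_ltW t x z : (unflow t x < unflow t z) = (x < z).
Proof. by rewrite unflow_lt flowK. Qed.

Lemma unflow_leW t x z : (unflow t x <= unflow t z) = (x <= z).
Proof. by rewrite unflowE flowK. Qed.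

Lemma unflow_meas t : measurable_fun [set: T] (unflow t : T -> T).
Proof. exact: (nondecreasing_measurable measurableT (@unflow_nd t)). Qed.

Lemma flow_meas t : measurable_fun [set: T] (flow t : T -> T).
Proof. exact: (nondecreasing_measurable measurableT (@flow_nd t)). Qed.

Lemma jac_meas t : measurable_fun [set: T] (flow_jac t : T -> T).
Proof. by case: (flow_bprim t). Qed.

Lemma Ujac_meas t : measurable_fun [set: T] (flowU_jac t : T -> T).
Proof. by case: (flowU_bprim t). Qed.

Lemma h_meas : measurable_fun [set: T] (h : T -> T).
Proof. by case: (lagr_H L). Qed.

Lemma jac_int t x z : x <= z ->
  (\int[leb]_(s in `]x, z]) (flow_jac t s)%:E)%E = (flow t z - flow t x)%:E.
Proof.
move=> xz; have [_ [C hC] ->//] := flow_bprim t.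
rewrite /Rintegral fineK//; apply: integrable_fin_num => //.
exact: (oc_integrable _ _ (jac_meas t) hC).
Qed.

Lemma h_int x z : x <= z -> (\int[leb]_(s in `]x, z]) (h s)%:E)%E = (H z - H x)%:E.
Proof.
move=> xz; have [_ [C hC] ->//] := lagr_H L.
rewrite /Rintegral fineK//; apply: integrable_fin_num => //.
exact: (oc_integrable _ _ h_meas hC).
Qed.

(** By the Galois property the preimage of []x, z]] is exactly []flow t x, flow t z]], so the change
    of variables asks for no regularity of the inverse, which jumps where the flow is flat. *)
Lemma unflow_push t (A : set T) : measurable A ->
  leb (unflow t @^-1` A) = (\int[leb]_(xi in A) (flow_jac t xi)%:E)%E.
Proof.
move=> mA.
have mi : measurable_fun [set: T] (id : T -> T) by [].
rewrite -[RHS]/(lmeas mi (jac_meas t) (flow_jac_ge0 t) A).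
pose mXm := isMeasurableFun.Build _ _ _ _ _ (unflow_meas t).
pose Xm : {mfun _ >-> _} := HB.pack (unflow t : T -> T) mXm.
have pre x z : unflow t @^-1` `]x, z] = `]flow t x, flow t z]%classic.
  by apply/seteqP; split => xi /=; rewrite !in_itv/= unflowE unflow_lt.
have ab_E (x z : R) : x <= z -> leb (unflow t @^-1` `]x, z]) = lmeas mi (jac_meas t) (flow_jac_ge0 t) `]x, z]%classic.
  by move=> xz; rewrite pre leb_oc ?flow_nd// /lmeas jac_int.
apply: (@measure_eq_oc _ (pushforward leb Xm) (lmeas mi (jac_meas t) (flow_jac_ge0 t)) _ _ A mA) => //.
move=> x z; have [xz|zx] := leP x z; first by rewrite [X in (X < _)%E]ab_E// /lmeas jac_int// ltry.
by rewrite set_itv_ge ?measure0 ?ltry// bnd_simp -leNgt ltW.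
Qed.

Lemma unflow_int t (K : R -> \bar R) : measurable_fun setT K ->
  (\int[leb]_x K (unflow t x) = \int[leb]_xi (K xi * (flow_jac t xi)%:E))%E.
Proof.
move=> mK.
apply: (@integral_density _ _ _ _ _ leb leb (unflow t) (flow_jac t) setT K) => //.
- exact: unflow_meas.
- exact: jac_meas.
- by move=> x; exact: flow_jac_ge0.
- by move=> A mA _; exact: unflow_push.
- by move=> x /(_ I).
Qed.

Definition mut_ (t : R) := flmeas (flow_meas t) h_meas (lagr_h0 L)
  (eq_ind_r (fun x => (x < +oo)%E) (ltry M) (lagr_hT L)).
Definition mut (t : R) : {finite_measure set T -> \bar R} := mut_ t.

Lemma mutE t (A : set T) : mut t A = (\int[leb]_(xi in flow t @^-1` A) (h xi)%:E)%E.
Proof. by []. Qed.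

Definition ut (t x : R) : R := flowU t (unflow t x).

(** [flow_jac2] integrated between two labels: the Hoelder 1/2 estimate of the velocity, with the
    energy in between as its constant. *)
Lemma CauchySchwarz_flow t x z : x <= z ->
  (flowU t z - flowU t x) ^+ 2 <= (flow t z - flow t x) * (H z - H x).
Proof.
move=> xz.
have [mU [CU hU] ->//] := flowU_bprim t; have [mf [Cf hf] ->//] := flow_bprim t.
have [mh [Ch hh] ->//] := lagr_H L.
apply: CauchySchwarz_Rint => //; [exact: oc_integrable hU|exact: oc_integrable hf|exact: oc_integrable hh|].
by move=> s _; split; [exact: flow_jac_ge0|exact: (lagr_h0 L)|rewrite flow_jac2].
Qed.

Lemma lagr_H_nd : {homo H : x z / x <= z}.
Proof.
move=> x z xz; rewrite -subr_ge0; have [_ _ ->//] := lagr_H L.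
by apply: Rintegral_ge0 => s _; exact: (lagr_h0 L).
Qed.

(** This makes [ut] well defined: labels that share a position share their velocity. *)
Lemma flowU_flat t x z : flow t x = flow t z -> flowU t x = flowU t z.
Proof.
move=> E; have K s s' : s <= s' -> flow t s = flow t s' -> flowU t s = flowU t s'.
  move=> ss /eqP; rewrite eq_sym -subr_eq0 => /eqP E'.
  have := CauchySchwarz_flow t ss; rewrite E' mul0r => D.
  apply/eqP; rewrite eq_sym -subr_eq0 -sqrf_eq0 eq_le D; exact: sqr_ge0.
by have [/K->//|/ltW/K] := leP x z => /(_ (esym E)).
Qed.

Lemma ut_flow t xi : ut t (flow t xi) = flowU t xi.
Proof. by apply: flowU_flat; rewrite flowK. Qed.

Lemma mut_lt t x : mut t `]-oo, x[%classic = (H (unflow t x))%:E.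
Proof.
rewrite mutE -(lagr_Hoc L).
have -> : flow t @^-1` `]-oo, x[ = `]-oo, unflow t x[%classic.
  by apply/seteqP; split => xi /=; rewrite !in_itv/= unflow_lt.
rewrite integral_itv_bndo_bndc//; apply/measurable_EFinP; apply: measurable_funTS; exact: h_meas.
Qed.

Lemma mutT t : mut t setT = M%:E.
Proof. by rewrite mutE preimage_setT (lagr_hT L). Qed.

(** Where [flow_jac] vanishes the quotient is 0 by convention. This is harmless: [flowU_jac]
    vanishes there too, and these positions form a null set. *)
Definition vt (t x : R) : R := flowU_jac t (unflow t x) / flow_jac t (unflow t x).

Let kap t xi := flowU_jac t xi / flow_jac t xi.

Lemma kap_meas t : measurable_fun [set: T] (kap t : T -> T).
Proof.
apply: measurable_funM; first exact: Ujac_meas.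
have -> : (fun x => (flow_jac t x)^-1) = (fun x => x `^ (-1)) \o flow_jac t.
  by apply/funext => x /=; rewrite powR_inv1// flow_jac_ge0.
by apply: measurableT_comp => //; exact: jac_meas.
Qed.

Lemma kap_jac t xi : kap t xi * flow_jac t xi = flowU_jac t xi.
Proof.
rewrite /kap; have [r0|rN] := eqVneq (flow_jac t xi) 0; last by rewrite divfK.
by have /eqP := flow_jac2 t xi; rewrite r0 mul0r sqrf_eq0 => /eqP ->; rewrite !mul0r.
Qed.

Lemma kap2_jac t xi : flow_jac t xi != 0 -> kap t xi ^+ 2 * flow_jac t xi = h xi.
Proof. by move=> r0; rewrite /kap exprMn flow_jac2; field. Qed.

Lemma vt_meas t : measurable_fun [set: T] (vt t : T -> T).
Proof. by apply: (measurableT_comp (kap_meas t)); exact: unflow_meas. Qed.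

Lemma kap_ocE t (K : R -> R) x z : measurable_fun setT K -> x <= z ->
  (\int[leb]_(s in `]x, z]) (K (unflow t s))%:E =
   \int[leb]_(xi in `]unflow t x, unflow t z]) (K xi * flow_jac t xi)%:E)%E.
Proof.
move=> mK xz; rewrite integral_mkcond [RHS]integral_mkcond.
transitivity (\int[leb]_s ((K \_ `]unflow t x, unflow t z]) (unflow t s))%:E)%E.
  apply: eq_integral => s _; rewrite !patchE.
  have -> : (s \in `]x, z]%classic) = (unflow t s \in `]unflow t x, unflow t z]%classic).
    by apply/idP/idP; rewrite !inE/= !in_itv/= unflow_ltW unflow_leW.
  by case: ifPn.
rewrite (@unflow_int t (fun xi => ((K \_ `]unflow t x, unflow t z]) xi)%:E)).
  by apply: eq_integral => s _; rewrite !patchE; case: ifPn => _; rewrite ?mul0e// EFinM.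
by apply/measurable_EFinP; apply/(measurable_restrictT _ _).1 => //; exact: measurable_funTS.
Qed.

(** Substituting [unflow t] multiplies the slope by [flow_jac], which restores [flowU_jac]; its
    integral between the leftmost labels of [x] and [z] is the velocity increment. *)
Lemma ut_weak_deriv t : has_weak_deriv (ut t) (vt t).
Proof.
split; first exact: vt_meas.
move=> x z xz.
have mv : measurable_fun setT (EFin \o vt t) by apply/measurable_EFinP; exact: vt_meas.
have [_ [C hC] UE] := flowU_bprim t.
have iU c d : leb.-integrable `]c, d] (EFin \o flowU_jac t) by exact: (oc_integrable _ _ (Ujac_meas t) hC).
split.
  apply/integrableP; split; first exact: measurable_funTS.
  rewrite -integral_itv_obnd_cbnd; last by apply: measurable_funTS; exact: measurableT_comp.
  rewrite [X in (X < _)%E](_ : _ = \int[leb]_(s in `]x, z]) (`|kap t (unflow t s)|)%:E)%E//.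
  rewrite (@kap_ocE t (fun xi => `|kap t xi|))//; last by apply: measurableT_comp => //; exact: kap_meas.
  rewrite [X in (X < _)%E](_ : _ = \int[leb]_(s in `]unflow t x, unflow t z]) (`|(EFin \o flowU_jac t) s|)%E)%E.
    by have /integrableP[] := iU (unflow t x) (unflow t z).
  apply: eq_integral => s _; rewrite -[RHS]/((`|flowU_jac t s|)%:E).
  by rewrite -(kap_jac t s) [in RHS](normrM (kap t s)) (ger0_norm (flow_jac_ge0 _ _)).
rewrite -integral_itv_obnd_cbnd; last exact: measurable_funTS.
rewrite (kap_ocE _ (kap_meas t))//.
under eq_integral do rewrite kap_jac.
rewrite UE ?unflow_nd// /Rintegral fineK//.
by apply: integrable_fin_num => //; exact: iU.
Qed.

Lemma vt2_int t (A : set T) : measurable A ->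
  (\int[leb]_(x in A) (vt t x ^+ 2)%:E =
   \int[leb]_(xi in flow t @^-1` A) (kap t xi ^+ 2 * flow_jac t xi)%:E)%E.
Proof.
move=> mA; have mfA : measurable (flow t @^-1` A).
  by rewrite -[X in measurable X]setTI; exact: flow_meas.
have mk2 : measurable_fun [set: T] (fun xi => kap t xi ^+ 2 : T).
  by apply: measurable_funX; exact: kap_meas.
rewrite integral_mkcond [RHS]integral_mkcond.
transitivity (\int[leb]_s (((fun xi => kap t xi ^+ 2) \_ (flow t @^-1` A)) (unflow t s))%:E)%E.
  apply: eq_integral => s _; rewrite !patchE.
  have -> : (s \in A) = (unflow t s \in flow t @^-1` A).
    by apply/idP/idP; rewrite !inE/= flowK.
  by case: ifPn.
rewrite (@unflow_int t (fun xi => (((fun xi => kap t xi ^+ 2) \_ (flow t @^-1` A)) xi)%:E)).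
  by apply: eq_integral => s _; rewrite !patchE; case: ifPn => _; rewrite ?mul0e// EFinM.
by apply/measurable_EFinP; apply/(measurable_restrictT _ _).1 => //; exact: measurable_funTS.
Qed.

End Evolution.

(** * The absolutely continuous part along the flow *)

Section Decomposition.
Context {R : realType}.
Local Notation leb := (@lebesgue_measure R).
Local Notation T := (measurableTypeR R).
Variables (M C0 : R) (y0 U0 H a w h : R -> R).
Hypothesis L : lagrangian M y0 U0 H a w h.
Hypothesis UC : forall xi, `|U0 xi| <= C0.
Local Notation Fl := (flow M y0 U0 H).
Local Notation FlU := (flowU M U0 H).
Local Notation Jac := (flow_jac a w h).
Local Notation UJac := (flowU_jac w h).
Local Notation Yf := (unflow L UC).
Local Notation uf := (ut L UC).
Local Notation vf := (vt L UC).
Local Notation muf := (mut L).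

Let mh : measurable_fun setT (EFin \o h).
Proof. by apply/measurable_EFinP; exact: h_meas L. Qed.

Lemma measurable_pre_flow t (A : set T) : measurable A -> measurable (Fl t @^-1` A : set T).
Proof. by move=> mA; rewrite -[X in measurable X]setTI; exact: (flow_meas L). Qed.

(** The labels compressed at time [t]. The energy they carry is the singular part of [muf t]. *)
Definition jac0 (t : R) : set T := [set xi | Jac t xi = 0].

Lemma jac0_meas t : measurable (jac0 t).
Proof.
have -> : jac0 t = setT `&` (Jac t : T -> T) @^-1` [set 0] by rewrite setTI.
exact: (jac_meas L).
Qed.

Lemma mut_split t (A : set T) : measurable A ->
  muf t A = (\int[leb]_(x in A) (vf t x ^+ 2)%:E +
             \int[leb]_(xi in Fl t @^-1` A `&` jac0 t) (h xi)%:E)%E.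
Proof.
move=> mA; rewrite mutE vt2_int//.
have mP := measurable_pre_flow t mA; have mZ := jac0_meas t.
rewrite -{1}(setUIDK (Fl t @^-1` A) (jac0 t)) ge0_integral_setU//; last 5 first.
- exact: measurableI.
- exact: measurableD.
- exact: measurable_funTS.
- by move=> xi _; rewrite lee_fin (lagr_h0 L).
- by apply/disj_setPS => x [[_ ?] [_ ?]].
rewrite addeC; congr (_ + _)%E.
rewrite integral_mkcond [RHS]integral_mkcond; apply: eq_integral => xi _.
rewrite !patchE in_setD; case: (xi \in _) => //=.
have [r0|rN] := eqVneq (Jac t xi) 0.
  by rewrite mem_set//= r0 mulr0.
rewrite memNset//=; last exact/eqP.
by rewrite (kap2_jac L).
Qed.

Lemma ut_ac t : ac_part_is_sq (muf t) (uf t).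
Proof.
exists (vf t); split; first exact: ut_weak_deriv.
(* A compressed label that is not leftmost at its position shares that position with a whole
   interval of labels, hence with a rational one. The countable set [Q] collects such positions. *)
pose Q : set T := range (fun q : rat => Fl t (ratr q)).
have cQ : countable Q by apply: card_le_trans (card_image_le _ _) _; exact: countableP.
have mQ : measurable Q by apply: countable_measurable => // x; exact: measurable_set1.
have mY : measurable (Yf t @^-1` jac0 t : set T).
  by rewrite -[X in measurable X]setTI; apply: unflow_meas => //; exact: jac0_meas.
exists (Yf t @^-1` jac0 t `|` Q).
have mN : measurable (Yf t @^-1` jac0 t `|` Q : set T) by exact: measurableU.
have N0 : leb (Yf t @^-1` jac0 t `|` Q) = 0%E.
  apply/eqP; rewrite eq_le measure_ge0 andbT.
  apply: (le_trans (measureU2 _ mY mQ)).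
  rewrite [X in (_ + X)%E]countable_lebesgue_measure0// adde0.
  rewrite [leLHS]unflow_push; last exact: jac0_meas.
  by rewrite integral0_eq// => xi ->.
split=> // A mA; rewrite (mut_split _ mA); congr (_ + _)%E.
rewrite mut_split; last exact: measurableI.
have -> : (\int[leb]_(x in A `&` (Yf t @^-1` jac0 t `|` Q)) (vf t x ^+ 2)%:E = 0)%E.
  apply: null_set_integral.
  - exact: measurableI.
  - apply/measurable_EFinP; apply: measurable_funTS; apply: measurable_funX; exact: vt_meas.
  - apply/eqP; rewrite eq_le measure_ge0 andbT -N0.
    by apply: le_measure; rewrite ?inE//; exact: measurableI.
rewrite add0e.
congr integral; apply/seteqP; split => xi /= [Axi Zxi]; last by case: Axi.
split => //; split => //.
have [E|E] := eqVneq (Yf t (Fl t xi)) xi; first by left; rewrite /= E.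
right; have : Yf t (Fl t xi) < xi by rewrite lt_neqAle E unflowE lexx.
move=> /rat_in_itvoo[q]; rewrite in_itv/= => /andP[Yq qxi].
exists q => //; apply/eqP; rewrite eq_le; apply/andP; split; first exact: (flow_nd L _ (ltW qxi)).
by rewrite -(unflowE L UC) ltW.
Qed.

(* [jac0 t] only meets [h > 0] where [t = - 2 w / h]: these sets are disjoint
   for distinct times, so by Tonelli almost all of them have zero energy. *)
Lemma mut_ae_ac : {ae leb, forall t, forall A : set T, measurable A ->
  muf t A = (\int[leb]_(x in A) (vf t x ^+ 2)%:E)%E}.
Proof.
(* If [h] is zero the quotient is a default value, but then the factor [h] makes [k] zero as
   well. *)
pose k (p : T * T) : \bar R := ((p.1 == - 2 * w p.2 / h p.2)%:R * h p.2)%:E.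
have hinv : measurable_fun [set: T] (fun xi => (h xi)^-1 : T).
  have -> : (fun x => (h x)^-1) = (fun x => x `^ (-1)) \o h.
    by apply/funext => x /=; rewrite powR_inv1// (lagr_h0 L).
  by apply: measurableT_comp => //; exact: h_meas L.
have mw : measurable_fun [set: T] (w : T -> T) by case: (lagr_U L).
have mh2 : measurable_fun [set: T * T] (fun p : T * T => h p.2 : T).
  by apply: measurableT_comp => //; exact: h_meas L.
have mk : measurable_fun setT k.
  apply/measurable_EFinP; apply: measurable_funM => //.
  apply: (measurableT_comp (f := fun b : bool => b%:R : T)) => //.
  apply: measurable_fun_eqr => //.
  apply: measurable_funM; last exact: (measurableT_comp hinv).
  by apply: measurable_funM => //; exact: (measurableT_comp mw).
have k0 p : (0 <= k p)%E by rewrite lee_fin mulr_ge0// (lagr_h0 L).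
have F0 : (\int[leb]_t \int[leb]_xi k (t, xi) = 0)%E.
  rewrite fubini_tonelli//; apply: integral0_eq => xi _ /=.
  rewrite (_ : (\int[leb]_t k (t, xi))%E = (\int[leb]_(t in [set (- 2 * w xi / h xi)%R]) (h xi)%:E)%E).
    by rewrite integral_set1.
  rewrite [RHS]integral_mkcond; apply: eq_integral => t _; rewrite patchE /k/=.
  have [->|tN] := eqVneq t (- 2 * w xi / h xi).
    by rewrite mul1r mem_set.
  by rewrite mul0r memNset//=; exact/eqP.
have mF : measurable_fun setT (fun t => \int[leb]_xi k (t, xi))%E.
  exact: (@measurable_fun_fubini_tonelli_F _ _ _ _ R leb k).
have : (\int[leb]_t `|\int[leb]_xi k (t, xi)| = 0)%E.
  by rewrite -[RHS]F0; apply: eq_integral => t _; rewrite gee0_abs// integral_ge0.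
move/(ae_eq_integral_abs leb measurableT mF).
apply: filterS => t /(_ I) /= Ft A mA.
rewrite (mut_split _ mA) [X in (_ + X)%E](_ : _ = 0%E) ?adde0//.
apply/eqP; rewrite eq_le; apply/andP; split; last first.
  by apply: integral_ge0 => xi _; rewrite lee_fin (lagr_h0 L).
rewrite -Ft integral_mkcond.
apply: ge0_le_integral => //.
- move=> xi _; rewrite patchE; case: ifPn => // _; rewrite lee_fin (lagr_h0 L) //.
- apply/(measurable_restrictT _ _).1 => //; last exact: measurable_funTS.
  by apply: measurableI; [exact: measurable_pre_flow|exact: jac0_meas].
- by apply: measurableT_comp => //; exact: measurable_pair1.
move=> xi _; rewrite patchE; case: ifPn => //; rewrite inE/= => -[_ Z].
rewrite lee_fin /=; have [h0|hN] := eqVneq (h xi) 0; first by rewrite h0 mulr0.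
have := flow_jac2 L t xi; rewrite Z mul0r => /eqP; rewrite sqrf_eq0 /flowU_jac => /eqP E.
have -> : t == - 2 * w xi / h xi.
  by apply/eqP; apply: (mulIf hN); rewrite divfK//; lra.
by rewrite mul1r.
Qed.

End Decomposition.

(** * Square-integrable functions and the partition of unity *)

Section SquareIntegrable.
Context {R : realType}.
Local Notation leb := (@lebesgue_measure R).
Local Notation T := (measurableTypeR R).

Let msq (f : R -> R) : measurable_fun [set: T] (f : T -> T) -> measurable_fun setT (fun x => ((f x) ^+ 2)%R%:E).
Proof. by move=> mf; apply/measurable_EFinP; exact: measurable_funX. Qed.

Lemma L2norm2_ge0 (f : R -> R) : (0 <= L2norm2 f)%E.
Proof. by apply: integral_ge0 => x _; rewrite lee_fin sqr_ge0. Qed.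

Lemma L2norm2_add (f g : R -> R) : measurable_fun [set: T] (f : T -> T) ->
  measurable_fun [set: T] (g : T -> T) ->
  (L2norm2 (fun x => (f x + g x)%R) <= 2%:E * L2norm2 f + 2%:E * L2norm2 g)%E.
Proof.
move=> mf mg; rewrite /L2norm2 -!ge0_integralZl_EFin//; try exact: msq; try by move=> x _; rewrite lee_fin sqr_ge0.
rewrite -ge0_integralD//; last 4 first.
- by move=> x _; rewrite mule_ge0// lee_fin sqr_ge0.
- by apply: emeasurable_funM => //; exact: msq.
- by move=> x _; rewrite mule_ge0// lee_fin sqr_ge0.
- by apply: emeasurable_funM => //; exact: msq.
apply: ge0_le_integral => //.
- by move=> x _; rewrite lee_fin sqr_ge0.
- by apply: msq; exact: measurable_funD.
- by apply: emeasurable_funD; apply: emeasurable_funM => //; exact: msq.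
- move=> x _; rewrite -!EFinM -EFinD lee_fin; have := sqr_ge0 (f x - g x); nra.
Qed.

Lemma L2norm2_scale c (f : R -> R) : measurable_fun [set: T] (f : T -> T) ->
  L2norm2 (fun x => c * f x) = ((c ^+ 2)%:E * L2norm2 f)%E.
Proof.
move=> mf; rewrite /L2norm2 -ge0_integralZl_EFin ?sqr_ge0//; last 2 first.
- by move=> x _; rewrite lee_fin sqr_ge0.
- exact: msq.
by apply: eq_integral => x _; rewrite exprMn.
Qed.

Lemma L2_fin (f : R -> R) : L2 f -> (fine (L2norm2 f))%:E = L2norm2 f.
Proof. by move=> [_ f1]; rewrite fineK// ge0_fin_numE// L2norm2_ge0. Qed.

Lemma L2_le (f : R -> R) c : measurable_fun [set: T] (f : T -> T) ->
  (L2norm2 f <= c%:E)%E -> L2 f.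
Proof. by move=> mf fc; split => //; apply: le_lt_trans fc _; rewrite ltry. Qed.

Lemma L2_add (f g : R -> R) : L2 f -> L2 g -> L2 (fun x => f x + g x).
Proof.
move=> [mf f2] [mg g2]; split; first exact: measurable_funD.
apply: le_lt_trans (L2norm2_add mf mg) _.
by rewrite lte_add_pinfty// lte_mul_pinfty.
Qed.

Lemma L2_scale c (f : R -> R) : L2 f -> L2 (fun x => c * f x).
Proof.
move=> [mf f2]; split; first exact: measurable_funM.
by rewrite L2norm2_scale// lte_mul_pinfty// lee_fin sqr_ge0.
Qed.

Lemma has_weak_deriv_add (f g f' g' : R -> R) : has_weak_deriv f f' -> has_weak_deriv g g' ->
  has_weak_deriv (fun x => f x + g x) (fun x => f' x + g' x).
Proof.
move=> [mf Hf] [mg Hg]; split; first exact: measurable_funD.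
move=> x y xy; have [if' Ef] := Hf _ _ xy; have [ig' Eg] := Hg _ _ xy; split.
  exact: integrableD_EFin.
rewrite -[RHS]/(\int[leb]_(z in `[x, y]) ((EFin \o f') z + (EFin \o g') z))%E.
rewrite integralD// -Ef -Eg -EFinD; congr EFin; ring.
Qed.

Lemma has_weak_deriv_scale c (f f' : R -> R) : has_weak_deriv f f' ->
  has_weak_deriv (fun x => c * f x) (fun x => c * f' x).
Proof.
move=> [mf Hf]; split; first exact: measurable_funM.
move=> x y xy; have [if' Ef] := Hf _ _ xy; split.
  exact: integrableZ_EFin.
rewrite -[RHS]/(\int[leb]_(z in `[x, y]) (c%:E * (EFin \o f') z))%E.
by rewrite integralZl// -Ef -EFinM mulrBr.
Qed.

Lemma smooth_derivable (f : R -> R) x : smooth f -> derivable f x 1.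
Proof. by move=> /(_ 0 x). Qed.

Lemma derivable_cont (f : R -> R) : (forall x, derivable f x 1) -> continuous f.
Proof.
by move=> df x; apply: differentiable_continuous; apply/derivable1_diffP.
Qed.

Lemma smooth_continuous (f : R -> R) : smooth f -> continuous f.
Proof. by move=> sf; apply: derivable_cont => x; exact: smooth_derivable. Qed.

Lemma smooth_deriv (f : R -> R) : smooth f -> smooth (derive1 f).
Proof.
move=> sf n x; have := sf n.+1 x.
by rewrite /iter_deriv iterSr.
Qed.

Lemma smooth_weak_deriv (f : R -> R) : smooth f -> has_weak_deriv f (derive1 f).
Proof.
move=> sf; have cf' := smooth_continuous (smooth_deriv sf).
split; first exact: continuous_measurable_fun.
move=> x y; rewrite le_eqVlt => /predU1P[->|xy].
  by rewrite set_itv1 integral_set1 subrr; split => //; apply/integrableP; split;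
    [apply/measurable_EFinP; apply: measurable_funTS; exact: continuous_measurable_fun|rewrite integral_set1 ltry].
split.
  by apply: continuous_compact_integrable; [exact: segment_compact|exact: continuous_subspaceT].
rewrite (@continuous_FTC2 _ (derive1 f) f)//.
- exact: continuous_subspaceT.
- split => [z _| |]; first exact: smooth_derivable.
  + by apply: cvg_at_right_filter; exact: smooth_continuous.
  + by apply: cvg_at_left_filter; exact: smooth_continuous.
Qed.

Lemma L2_compact (f : R -> R) a b : continuous f -> a <= b -> (forall x, x < a -> f x = 0) ->
  (forall x, b < x -> f x = 0) -> L2 f.
Proof.
move=> cf ab fa fb; split; first exact: continuous_measurable_fun.
rewrite /L2norm2 (_ : (\int[leb]_x _)%E = (\int[leb]_(x in `[a, b]) ((f x) ^+ 2)%:E)%E).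
  have : leb.-integrable `[a, b] (EFin \o (fun x => f x ^+ 2)).
    apply: continuous_compact_integrable; first exact: segment_compact.
    apply: continuous_subspaceT => x.
    by apply: (@continuous_comp _ _ _ f (fun z => z ^+ 2)); [exact: cf|exact: exprn_continuous].
  by move=> /integrable_lty; apply.
rewrite [RHS]integral_mkcond; apply: eq_integral => x _; rewrite patchE.
case: ifPn => // /negP; rewrite inE/= in_itv/= => /negP; rewrite negb_and -!ltNge => /orP[/fa|/fb] ->;
by rewrite expr0n.
Qed.

End SquareIntegrable.

Section PartitionOfUnity.
Context {R : realType}.
Variables pp pm : R -> R.
Hypothesis PU : partition_of_unity pp pm.

Lemma PU_pp : smooth pp. Proof. by case: PU. Qed.
Lemma PU_pm : smooth pm. Proof. by case: PU. Qed.
Lemma PU_sum x : pp x + pm x = 1. Proof. by case: PU. Qed.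
Lemma PU_pp01 x : 0 <= pp x <= 1. Proof. by case: PU => _ _ _ [+ _] _; exact. Qed.
Lemma PU_pm01 x : 0 <= pm x <= 1. Proof. by case: PU => _ _ _ [_ +] _; exact. Qed.

Lemma PU_pp0 x : x <= -1 -> pp x = 0.
Proof.
move=> x1; apply/eqP; apply/negPn/negP => px.
have [_ _ _ _ [_ /(_ x)]] := PU; rewrite /= in_itv/= andbT => H.
by have := le_lt_trans x1 (H (@subset_closure _ [set x | pp x != 0] x px)); rewrite ltxx.
Qed.

Lemma PU_pm0 x : 1 <= x -> pm x = 0.
Proof.
move=> x1; apply/eqP; apply/negPn/negP => px.
have [_ _ _ _ [/(_ x) + _]] := PU; rewrite /= in_itv/= => H.
by have := lt_le_trans (H (@subset_closure _ [set x | pm x != 0] x px)) x1; rewrite ltxx.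
Qed.

Lemma PU_pp1 x : 1 <= x -> pp x = 1.
Proof. by move=> x1; have := PU_sum x; rewrite PU_pm0// addr0. Qed.

Lemma PU_pm1 x : x <= -1 -> pm x = 1.
Proof. by move=> x1; have := PU_sum x; rewrite PU_pp0// add0r. Qed.

Lemma derive1_near_cst (f : R -> R) (x c : R) : (\forall z \near x, f z = c) -> derive1 f x = 0.
Proof.
move=> fc; rewrite derive1E.
have -> : 0 = 'D_1 (cst c : R -> R) x by rewrite derive_cst.
apply: near_eq_derive.
by apply: filterS fc => z ->.
Qed.

Lemma PU_dpp0 x : x < -1 \/ 1 < x -> derive1 pp x = 0.
Proof.
move=> [x1|x1].
  apply: (@derive1_near_cst _ _ 0); near=> z; apply: PU_pp0; apply: ltW.
  by near: z; exact: lt_nbhsl.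
apply: (@derive1_near_cst _ _ 1); near=> z; apply: PU_pp1; apply: ltW.
by near: z; exact: lt_nbhsr.
Unshelve. all: by end_near. Qed.

Lemma PU_dpm0 x : x < -1 \/ 1 < x -> derive1 pm x = 0.
Proof.
move=> [x1|x1].
  apply: (@derive1_near_cst _ _ 1); near=> z; apply: PU_pm1; apply: ltW.
  by near: z; exact: lt_nbhsl.
apply: (@derive1_near_cst _ _ 0); near=> z; apply: PU_pm0; apply: ltW.
by near: z; exact: lt_nbhsr.
Unshelve. all: by end_near. Qed.

Let dec11 : (-1 : R) <= 1. Proof. lra. Qed.

Lemma PU_dpp_L2 : L2 (derive1 pp).
Proof.
apply: (@L2_compact _ _ (-1) 1) => //.
- exact: smooth_continuous (smooth_deriv PU_pp).
- by move=> x ?; apply: PU_dpp0; left.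
- by move=> x ?; apply: PU_dpp0; right.
Qed.

Lemma PU_dpm_L2 : L2 (derive1 pm).
Proof.
apply: (@L2_compact _ _ (-1) 1) => //.
- exact: smooth_continuous (smooth_deriv PU_pm).
- by move=> x ?; apply: PU_dpm0; left.
- by move=> x ?; apply: PU_dpm0; right.
Qed.

End PartitionOfUnity.

(** * Regularity of the constructed solution *)

Section Regularity.
Context {R : realType}.
Local Notation leb := (@lebesgue_measure R).
Local Notation T := (measurableTypeR R).
Variables (M C0 : R) (y0 U0 H a w h : R -> R).
Hypothesis L : lagrangian M y0 U0 H a w h.
Hypothesis UC : forall xi, `|U0 xi| <= C0.
Local Notation Fl := (flow M y0 U0 H).
Local Notation FlU := (flowU M U0 H).
Local Notation Jac := (flow_jac a w h).
Local Notation UJac := (flowU_jac w h).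
Local Notation Yf := (unflow L UC).
Local Notation uf := (ut L UC).
Local Notation vf := (vt L UC).
Local Notation muf := (mut L).

(** Bounds the velocity up to time [T0], and therefore how fast a label moves. *)
Definition speed (T0 : R) : R := C0 + T0 * M / 4.

Lemma speed_ge0 T0 : 0 <= T0 -> 0 <= speed T0.
Proof. by move=> T00; rewrite /speed addr_ge0 ?(C0_ge0 UC)// divr_ge0// mulr_ge0// (lagr_M0 L). Qed.

Let mh : measurable_fun [set: T] (h : T -> T). Proof. exact: h_meas L. Qed.

(** The energy density restricted to labels that are within [D] of [x] at time [t]. A label seen on
    different sides of [x] at two times must be this close, with [D] the distance it can travel. *)
Let near_lab (t D : R) (x xi : R) : R := (`|Fl t xi - x| <= D)%R%:R * h xi.

Lemma near_lab_meas t D : measurable_fun [set: T * T] (fun p : T * T => (near_lab t D p.1 p.2)%:E).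
Proof.
apply/measurable_EFinP; apply: measurable_funM; last exact: measurableT_comp.
apply: (measurableT_comp (f := fun b : bool => b%:R : T)) => //.
apply: measurable_fun_ler => //; apply: measurableT_comp => //.
by apply: measurable_funB => //; apply: measurableT_comp => //; exact: (flow_meas L).
Qed.

Lemma near_lab_ge0 t D x xi : 0 <= near_lab t D x xi.
Proof. by rewrite /near_lab mulr_ge0// (lagr_h0 L). Qed.

(** After exchanging integrals, each label is near [x] exactly for [x] in an interval of length
    [2 * D], and the labels carry total energy [M]. *)
Lemma near_lab_int t D : 0 <= D ->
  (\int[leb]_x \int[leb]_xi (near_lab t D x xi)%:E = (2 * D * M)%:E)%E.
Proof.
move=> D0.
have := @fubini_tonelli _ _ _ _ R leb leb (fun p : T * T => (near_lab t D p.1 p.2)%:E) (near_lab_meas t D).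
move=> ->; last by move=> p; rewrite lee_fin near_lab_ge0.
transitivity (\int[leb]_xi ((2 * D)%:E * (h xi)%:E))%E.
  apply: eq_integral => xi _ /=.
  transitivity (\int[leb]_(x in `[(Fl t xi - D)%R, (Fl t xi + D)%R]) (h xi)%:E)%E.
    rewrite [RHS]integral_mkcond; apply: eq_integral => x _; rewrite patchE /near_lab.
    have -> : (x \in `[(Fl t xi - D)%R, (Fl t xi + D)%R]%classic) = (`|Fl t xi - x| <= D).
      apply/idP/idP; rewrite inE/= in_itv/= ler_norml => /andP[? ?]; apply/andP; split; lra.
    by case: (_ <= _); rewrite ?mul1r ?mul0r.
  rewrite (@integral_cst _ _ _ leb)// muleC; congr (_ * _)%E.
  apply: eq_trans; first exact: lebesgue_measure_itv.
  rewrite /= lte_fin; case: ltP => DD.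
    by rewrite -EFinB; congr EFin; lra.
  by congr EFin; lra.
rewrite ge0_integralZl_EFin//.
- by rewrite (lagr_hT L) -EFinM.
- by move=> xi _; rewrite lee_fin (lagr_h0 L).
- exact/measurable_EFinP.
- by rewrite mulr_ge0.
Qed.

Let dH t s x : R := H (Yf t x) - H (Yf s x).

Lemma H_meas : measurable_fun [set: T] (H : T -> T).
Proof. apply: continuous_measurable_fun; exact: bprim_continuous (lagr_H L). Qed.

Lemma dH_meas t s : measurable_fun [set: T] (dH t s : T -> T).
Proof.
apply: measurable_funB; apply: (measurableT_comp H_meas); exact: unflow_meas.
Qed.

(** The labels between the two leftmost preimages of [x] lie on opposite sides of [x] at times [t]
    and [s], so at time [t] they are at most one displacement away from [x]. *)
Lemma dH_le T0 t s x : 0 <= t <= T0 -> 0 <= s <= T0 ->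
  ((`|dH t s x|)%:E <= \int[leb]_xi (near_lab t (speed T0 * `|t - s|) x xi)%:E)%E.
Proof.
move=> tT sT; set D := speed T0 * _.
have fl xi : `|Fl t xi - Fl s xi| <= D by rewrite /D /speed; exact: (flow_dist L UC).
have key p q : p <= q -> (forall xi, p < xi <= q -> `|Fl t xi - x| <= D) ->
    ((H q - H p)%:E <= \int[leb]_xi (near_lab t D x xi)%:E)%E.
  move=> pq Hx; rewrite -(h_int L pq) integral_mkcond.
  apply: ge0_le_integral => //.
  - by move=> xi _; rewrite patchE; case: ifPn => // _; rewrite lee_fin (lagr_h0 L).
  - by apply/(measurable_restrictT _ _).1 => //; apply: measurable_funTS; exact/measurable_EFinP.
  - exact: (measurableT_comp (near_lab_meas t D) (pair1_measurable x)).
  - move=> xi _; rewrite patchE; case: ifPn => [|_]; last by rewrite lee_fin near_lab_ge0.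
    by rewrite inE/= in_itv/= => /Hx xD; rewrite /near_lab xD mul1r.
rewrite /dH; have [ts|/ltW st] := leP (Yf t x) (Yf s x).
  rewrite ler0_norm ?subr_le0 ?(lagr_H_nd L)// opprB; apply: key => // xi /andP[xi1 xi2].
  have h1 : x <= Fl t xi by rewrite -(unflowE L UC) ltW.
  have h2 : Fl s xi <= x by rewrite -[leRHS](flowK L UC s); exact: (flow_nd L).
  by have := fl xi; rewrite !ler_norml => /andP[? ?]; apply/andP; split; lra.
rewrite ger0_norm ?subr_ge0 ?(lagr_H_nd L)//; apply: key => // xi /andP[xi1 xi2].
have h1 : x <= Fl s xi by rewrite -(unflowE L UC) ltW.
have h2 : Fl t xi <= x by rewrite -[leRHS](flowK L UC t); exact: (flow_nd L).
by have := fl xi; rewrite !ler_norml => /andP[? ?]; apply/andP; split; lra.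
Qed.

Lemma dH_int T0 t s : 0 <= t <= T0 -> 0 <= s <= T0 ->
  (\int[leb]_x (`|dH t s x|)%:E <= (2 * (speed T0 * `|t - s|) * M)%:E)%E.
Proof.
move=> tT sT; have T00 : 0 <= T0 by case/andP: tT => t0 tT; exact: le_trans t0 tT.
have D0 : 0 <= speed T0 * `|t - s| by rewrite mulr_ge0// speed_ge0.
rewrite -(near_lab_int t D0); apply: ge0_le_integral => //.
- by apply/measurable_EFinP; apply: measurableT_comp => //; exact: dH_meas.
- apply: (@measurable_fun_fubini_tonelli_F _ _ _ _ R leb (fun p : T * T => (near_lab t (speed T0 * `|t - s|) p.1 p.2)%:E)).
  + exact: near_lab_meas.
  + by move=> p; rewrite lee_fin near_lab_ge0.
- by move=> x _; exact: (dH_le _ tT sT).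
Qed.

Lemma dH_bound t s x : `|dH t s x| <= M.
Proof.
have := lagr_H0 L (Yf t x); have := lagr_HM L (Yf t x).
have := lagr_H0 L (Yf s x); have := lagr_HM L (Yf s x).
by rewrite /dH ler_norml => ? ? ? ?; apply/andP; split; lra.
Qed.

Let sq_le_int (f g : R -> R) c K : measurable_fun [set: T] (f : T -> T) -> measurable_fun [set: T] (g : T -> T) ->
  0 <= c -> (forall x, f x ^+ 2 <= c * `|g x|) -> (\int[leb]_x (`|g x|)%:E <= K%:E)%E ->
  (L2norm2 f <= (c * K)%:E)%E.
Proof.
move=> mf mg c0 fg gK.
apply: (@le_trans _ _ (\int[leb]_x (c%:E * (`|g x|)%:E))%E).
  apply: ge0_le_integral => //.
  - by move=> x _; rewrite lee_fin sqr_ge0.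
  - by apply/measurable_EFinP; exact: measurable_funX.
  - apply/measurable_EFinP; apply: measurable_funM => //; exact: measurableT_comp.
  - by move=> x _; rewrite -EFinM lee_fin.
rewrite ge0_integralZl_EFin//; first by rewrite EFinM lee_wpmul2l.
apply/measurable_EFinP; exact: measurableT_comp.
Qed.

Lemma dH_L2 T0 t s : 0 <= t <= T0 -> 0 <= s <= T0 ->
  (L2norm2 (dH t s) <= (M * (2 * (speed T0 * `|t - s|) * M))%:E)%E.
Proof.
move=> tT sT; apply: (sq_le_int (g := dH t s)); [exact: dH_meas|exact: dH_meas|exact: lagr_M0 L| |exact: dH_int].
by move=> x; rewrite -(real_normK (num_real _)) expr2 ler_wpM2r// dH_bound.
Qed.

Let er t s x : R := FlU s (Yf t x) - FlU s (Yf s x).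

Lemma er_meas t s : measurable_fun [set: T] (er t s : T -> T).
Proof.
have mU : measurable_fun [set: T] (FlU s : T -> T).
  by apply: continuous_measurable_fun; exact: (flowU_continuous L).
apply: measurable_funB; apply: (measurableT_comp mU); exact: unflow_meas.
Qed.

Lemma CauchySchwarz_abs s p q : (FlU s p - FlU s q) ^+ 2 <= `|Fl s p - Fl s q| * `|H p - H q|.
Proof.
have K x z : x <= z -> (FlU s z - FlU s x) ^+ 2 <= `|Fl s z - Fl s x| * `|H z - H x|.
  move=> xz; have := CauchySchwarz_flow L s xz.
  by rewrite !ger0_norm ?subr_ge0// ?(lagr_H_nd L)// (flow_nd L).
have [/K|/ltW/K//] := leP p q.
by rewrite -(sqrrN (_ - _)) opprB distrC (distrC (H _)).
Qed.

Lemma er_sq T0 t s x : 0 <= t <= T0 -> 0 <= s <= T0 ->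
  er t s x ^+ 2 <= speed T0 * `|t - s| * `|dH t s x|.
Proof.
move=> tT sT; apply: (le_trans (CauchySchwarz_abs _ _ _)); rewrite ler_wpM2r//.
rewrite (flowK L UC s) -[X in _ - X](flowK L UC t) distrC.
exact: (flow_dist L UC).
Qed.

(** One factor [|t - s|] comes from the pointwise Cauchy-Schwarz bound and a second one from the
    integral of [dH]. The square of the norm is thus quadratic in [|t - s|], as Lipschitz continuity
    needs, although [dH] itself only has a bound of first order. *)
Lemma er_L2 T0 t s : 0 <= t <= T0 -> 0 <= s <= T0 ->
  (L2norm2 (er t s) <= (speed T0 * `|t - s| * (2 * (speed T0 * `|t - s|) * M))%:E)%E.
Proof.
move=> tT sT; apply: (sq_le_int (g := dH t s)); [exact: er_meas|exact: dH_meas| | |exact: dH_int].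
- by rewrite mulr_ge0// speed_ge0//; case/andP: tT => t0 tT; exact: le_trans t0 tT.
- by move=> x; exact: er_sq.
Qed.

(** Splits the change at a fixed position into the change along one label, which is explicit, and
    the effect at time [s] of switching labels. *)
Lemma ut_diff t s x : uf t x - uf s x = (t - s) / 4 * (2 * H (Yf t x) - M) + er t s x.
Proof. by rewrite /ut /er /flowU; ring. Qed.

Lemma ut_holder_on T0 : 0 < T0 -> holder_on T0 uf.
Proof.
move=> T00; have B0 := speed_ge0 (ltW T00); have M0 := lagr_M0 L.
(* The first term absorbs the Lipschitz increment along a label through
   [|t - s| <= sqrt T0 * sqrt d]. The second is Cauchy-Schwarz with energy at most [M] and positions
   at most [(1 + speed T0) * d] apart. *)
exists 2^-1, (Num.sqrt T0 * (M / 4) + Num.sqrt (M * (1 + speed T0))).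
split; first lra.
  by rewrite addr_ge0 ?mulr_ge0 ?sqrtr_ge0// divr_ge0.
move=> t s x z tT sT; set d := `|t - s| + `|x - z|.
have d0 : 0 <= d by rewrite addr_ge0.
rewrite powR12_sqrt// mulrDl.
have -> : uf t x - uf s z = (FlU t (Yf t x) - FlU s (Yf t x)) + (FlU s (Yf t x) - FlU s (Yf s z)).
  by rewrite /ut; ring.
rewrite (le_trans (ler_normD _ _))// lerD//.
  have -> : FlU t (Yf t x) - FlU s (Yf t x) = (t - s) / 4 * (2 * H (Yf t x) - M).
    by rewrite /flowU; ring.
  rewrite normrM normrM (ger0_norm (_ : 0 <= 4^-1)) ?invr_ge0//.
  rewrite -[_ * (M / 4) * _]mulrAC -mulrA [X in _ <= X](_ : _ = (Num.sqrt T0 * Num.sqrt d) * (M / 4)); last by ring.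
  rewrite [X in X <= _](_ : _ = `|t - s| * (`|2 * H (Yf t x) - M| / 4)); last by ring.
  apply: ler_pM => //; last by rewrite ler_wpM2r ?invr_ge0// (lagr_HMb L).
  rewrite -[leLHS]sqr_sqrtr// expr2 ler_pM ?sqrtr_ge0// ler_wsqrtr//.
    by rewrite ler_norml; lra.
  by rewrite lerDl.
rewrite -sqrtrM; last by rewrite mulr_ge0// addr_ge0.
rewrite -[leLHS]ger0_norm// -sqrtr_sqr ler_wsqrtr// real_normK ?num_real//.
apply: (le_trans (CauchySchwarz_abs _ _ _)).
rewrite mulrC -mulrA ler_pM//.
  by have := lagr_H0 L (Yf t x); have := lagr_HM L (Yf t x);
     have := lagr_H0 L (Yf s z); have := lagr_HM L (Yf s z); rewrite ler_norml => *; apply/andP; split; lra.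
rewrite (flowK L UC s) -(subrKA x) (le_trans (ler_normD _ _))//.
rewrite mulrDl mul1r /d mulrDr [X in _ <= X](_ : _ = speed T0 * `|t - s| + `|x - z| + (`|t - s| + speed T0 * `|x - z|)); last by ring.
rewrite ler_wpDr ?addr_ge0 ?mulr_ge0// lerD//.
rewrite -[X in _ - X](flowK L UC t) distrC.
by have := flow_dist L UC (Yf t x) tT sT; rewrite /speed.
Qed.

Lemma mut_int t (k : R -> \bar R) : measurable_fun setT k ->
  (\int[muf t]_x k x = \int[leb]_xi (k (Fl t xi) * (h xi)%:E))%E.
Proof.
move=> mk.
pose mi : measurable_fun [set: T] (id : T -> T) := @measurable_id _ T setT.
pose nu := lmeas mi mh (lagr_h0 L).
rewrite -(@integral_density _ _ _ _ _ nu leb (id : T -> T) h setT (k \o Fl t) mi) //; last 3 first.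
- exact: lagr_h0 L.
- by apply: (measurableT_comp mk); exact: (flow_meas L t).
- by move=> x /(_ I).
rewrite (@integral_density _ _ _ _ _ nu (muf t) (Fl t : T -> T) (fun=> 1) setT k).
- by apply: eq_integral => x _; rewrite mule1.
- exact: (flow_meas L t).
- by [].
- by move=> x; exact: ler01.
- move=> A mA _; rewrite integral_cst// mul1e; by [].
- exact: mk.
- by move=> x /(_ I).
Qed.

Lemma mut_Rint t (f : R -> R) : continuous f ->
  (\int[muf t]_x (f x)%:E = \int[leb]_xi (f (Fl t xi) * h xi)%:E)%E.
Proof.
move=> cf; rewrite (@mut_int t (EFin \o f)).
  by apply: eq_integral => x _; rewrite EFinM.
by apply/measurable_EFinP; exact: continuous_measurable_fun.
Qed.

Lemma h_integrable : leb.-integrable setT (EFin \o h).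
Proof.
apply/integrableP; split; first exact/measurable_EFinP.
rewrite [X in (X < _)%E](_ : _ = \int[leb]_x (h x)%:E)%E; first by rewrite (lagr_hT L) ltry.
by apply: eq_integral => x _ /=; rewrite ger0_norm// (lagr_h0 L).
Qed.

Lemma flow_t_continuous xi : continuous (fun t => Fl t xi).
Proof.
move=> t; apply: differentiable_continuous; apply/derivable1_diffP.
by have [] := flow_derive M y0 U0 H xi t.
Qed.

(** All [muf t] are images of the fixed finite measure with density [h] under maps continuous in
    [t]; dominated convergence with bound [Mf * h] suffices. *)
Lemma mut_weak_cont : weak_cont muf.
Proof.
move=> f cf [Mf hf]; apply: continuous_subspaceT => t.
have mfF s : measurable_fun [set: T] (fun xi => f (Fl s xi) : T).
  apply: (measurableT_comp (f := f : T -> T)); first exact: continuous_measurable_fun.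
  exact: (flow_meas L s).
have M0 : 0 <= Mf by exact: le_trans (normr_ge0 _) (hf 0).
have bd s xi : `|f (Fl s xi) * h xi| <= Mf * h xi.
  by rewrite normrM (ger0_norm (lagr_h0 L xi)) ler_wpM2r// (lagr_h0 L).
have iMh : leb.-integrable setT (EFin \o (fun xi => Mf * h xi)).
  by apply: integrableZ_EFin => //; exact: h_integrable.
have ifh s : leb.-integrable setT (EFin \o (fun xi => f (Fl s xi) * h xi)).
  apply: le_integrable iMh => //.
  - by apply/measurable_EFinP; apply: measurable_funM => //; exact: mfF.
  - move=> xi _; rewrite lee_fin (le_trans (bd _ _))// ler_norm//.
have := @continuity_under_integral R _ _ leb (fun s xi => f (Fl s xi) * h xi) setT measurableT (t - 1) (t + 1).
move=> /(_ (fun s _ => ifh s)).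
have cont_ : {ae leb, forall y, [set: T] y -> {in `]t - 1, t + 1[%classic, continuous (fun s => f (Fl s y) * h y)}}.
  apply: aeW => xi _ s _; apply: cvgM; last exact: cvg_cst.
  by apply: (@continuous_comp _ _ _ (fun s => Fl s xi) f); [exact: flow_t_continuous|exact: cf].
move=> /(_ cont_ (fun xi => Mf * h xi) iMh).
have bd_ : forall s, `]t - 1, t + 1[%classic s -> {ae leb, forall y, [set: T] y -> `|f (Fl s y) * h y| <= Mf * h y}.
  by move=> s _; apply: aeW => xi _.
move=> /(_ bd_ t) Ht.
have {}Ht : {for t, continuous (fun l => \int[leb]_x (f (Fl l x) * h x))}.
  by apply: Ht; rewrite inE/= in_itv/=; apply/andP; split; lra.
rewrite /continuous_at mut_Rint//.
rewrite (_ : (fun t0 => (\int[muf t0]_x (f x)%:E)%E) = EFin \o (fun l => \int[leb]_x (f (Fl l x) * h x))).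
  rewrite -[X in _ --> X]fineK; last exact: integrable_fin_num (ifh t).
  by apply: cvg_EFin => //; apply: nearW.
apply/funext => s /=; rewrite mut_Rint// /Rintegral fineK//.
exact: integrable_fin_num (ifh s).
Qed.

End Regularity.

(** * Membership of the constructed pair in the state space *)

Section Membership.
Context {R : realType}.
Local Notation leb := (@lebesgue_measure R).
Local Notation T := (measurableTypeR R).
Variables (M C0 : R) (y0 U0 H a w h : R -> R).
Hypothesis L : lagrangian M y0 U0 H a w h.
Hypothesis UC : forall xi, `|U0 xi| <= C0.
Local Notation Fl := (flow M y0 U0 H).
Local Notation FlU := (flowU M U0 H).
Local Notation Jac := (flow_jac a w h).
Local Notation UJac := (flowU_jac w h).
Local Notation Yf := (unflow L UC).
Local Notation uf := (ut L UC).
Local Notation vf := (vt L UC).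
Local Notation muf := (mut L).
Variables pp pm : R -> R.
Hypothesis PU : partition_of_unity pp pm.
Hypothesis hE1 : E1_0 pp (fun x => H (Yf 0 x)).
Hypothesis hE2 : E2 pp pm (uf 0).

Let dH t s x : R := H (Yf t x) - H (Yf s x).
Let er t s x : R := FlU s (Yf t x) - FlU s (Yf s x).

Lemma dH_inL2 T0 t s : 0 <= t <= T0 -> 0 <= s <= T0 -> L2 (dH t s).
Proof. by move=> tT sT; apply: L2_le; [exact: dH_meas|exact: (dH_L2 L UC tT sT)]. Qed.

Lemma er_inL2 T0 t s : 0 <= t <= T0 -> 0 <= s <= T0 -> L2 (er t s).
Proof. by move=> tT sT; apply: L2_le; [exact: er_meas|exact: (er_L2 L UC tT sT)]. Qed.

Lemma mut_E1_0 t : 0 <= t -> E1_0 pp (fun x => fine (muf t `]-oo, x[%classic)).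
Proof.
move=> t0; have [f [c [Lf E]]] := hE1.
exists (fun x => f x + dH t 0 x), c; split.
  by apply: L2_add => //; apply: (@dH_inL2 t); rewrite ?lexx ?t0.
apply/funext => x; rewrite (mut_lt L UC t x) /= /dH.
have := congr1 (fun F => F x) E; rewrite /= => ->; ring.
Qed.

(** One decomposition serves twice: its quadratic bound is the Lipschitz estimate in time, and with
    [s = 0] it moves the initial decomposition of the velocity to time [t]. *)
Lemma ut_increment T0 : 0 <= T0 -> exists K A B : R, 0 <= K /\ forall t s, 0 <= t <= T0 -> 0 <= s <= T0 ->
  exists F, [/\ L2 F, (L2norm2 F <= (K * (t - s) ^+ 2)%:E)%E &
   forall x, uf t x - uf s x = F x + (A * (t - s)) * pp x + (B * (t - s)) * pm x].
Proof.
move=> T00; have [f [c [Lf E]]] := hE1.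
pose B0 := speed M C0 T0.
have B00 : 0 <= B0 by exact: (speed_ge0 L UC T00).
have M0 := lagr_M0 L.
pose K0 := fine (L2norm2 f).
have K00 : 0 <= K0 by rewrite /K0 fine_ge0// L2norm2_ge0.
pose K1 := 2 * K0 + 2 * (M * (2 * (B0 * T0) * M)).
have K10 : 0 <= K1 by rewrite /K1; apply: addr_ge0; rewrite !mulr_ge0//.
(* In the source [(2 * H - M) / 4] put [H = f + c * pp + dH] and [M = M * (pp + pm)]: this gives the
   coefficients of [pp] and [pm]. In the norm, [K1] bounds [f + dH], the other term comes from
   [er_L2], and the outer factors 2 from [L2norm2_add]. *)
exists (2 * (K1 / 4) + 2 * (B0 * (2 * B0 * M))), ((2 * c - M) / 4), (- M / 4); split.
  by apply: addr_ge0; rewrite ?mulr_ge0 ?invr_ge0//.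
move=> t s tT sT.
have mf : measurable_fun [set: T] (f : T -> T) by case: Lf.
have z0 : 0 <= (0 : R) <= T0 by rewrite lexx.
pose F1 x := f x + dH t 0 x.
have LF1 : L2 F1 by apply: L2_add => //; exact: dH_inL2 tT z0.
have nF1 : (L2norm2 F1 <= K1%:E)%E.
  apply: (le_trans (L2norm2_add mf (dH_meas L UC t 0))).
  rewrite [X in (_ <= X)%E](_ : _ = (2%:E * K0%:E + 2%:E * (M * (2 * (B0 * T0) * M))%:E)%E); last by rewrite -!EFinM -EFinD.
  apply: leeD; apply: lee_pmul => //; rewrite ?L2norm2_ge0//.
    by rewrite L2_fin.
  apply: (le_trans (dH_L2 L UC tT z0)); rewrite lee_fin subr0.
  apply: ler_wpM2l => //; apply: ler_wpM2r => //; apply: ler_wpM2l => //; apply: ler_wpM2l => //.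
  by case/andP: tT => t0 tT; rewrite ger0_norm.
pose F x := (t - s) / 2 * F1 x + er t s x.
have mF1 : measurable_fun [set: T] (F1 : T -> T) by case: LF1.
have LF : L2 F by apply: L2_add; [exact: L2_scale|exact: er_inL2 tT sT].
exists F; split => //.
- have ms : measurable_fun [set: T] ((fun x => (t - s) / 2 * F1 x) : T -> T) by exact: measurable_funM.
  apply: (le_trans (L2norm2_add ms (er_meas L UC t s))).
  rewrite L2norm2_scale//.
  rewrite [X in (_ <= X)%E](_ : _ = (2%:E * (K1 / 4 * (t - s) ^+ 2)%R%:E +
     2%:E * (B0 * (2 * B0 * M) * (t - s) ^+ 2)%R%:E)%E); last by rewrite -!EFinM -EFinD; congr EFin; ring.
  apply: leeD.
    apply: lee_wpmul2l => //.
    apply: (@le_trans _ _ ((((t - s) / 2) ^+ 2)%:E * K1%:E)%E).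
      by apply: lee_wpmul2l => //; rewrite lee_fin sqr_ge0.
    by rewrite -EFinM lee_fin exprMn [X in X <= _](_ : _ = K1 / 4 * (t - s) ^+ 2)//; field.
  apply: lee_wpmul2l => //.
  apply: (le_trans (er_L2 L UC tT sT)); rewrite lee_fin.
  rewrite -[(t - s) ^+ 2](real_normK (num_real _)) -/B0.
  by rewrite [X in X <= _](_ : _ = B0 * (2 * B0 * M) * `|t - s| ^+ 2)//; ring.
- move=> x; rewrite (ut_diff L UC) /F /F1 /dH -/(er t s x).
  have := congr1 (fun F => F x) E; rewrite /= => Ex.
  have := PU_sum PU x => PUx.
  have -> : pm x = 1 - pp x by rewrite -PUx addrC addKr.
  by rewrite -/(er t s x) Ex; field.
Qed.

Lemma ut_lipschitz T0 : 0 < T0 -> lipschitz_E2_0 pp pm T0 uf.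
Proof.
move=> /ltW T00; have [K [A [B [K0 HK]]]] := ut_increment T00.
have Q0 : 0 <= K + A ^+ 2 + B ^+ 2 by rewrite !addr_ge0// sqr_ge0.
exists (K + A ^+ 2 + B ^+ 2 + 1); split; first by rewrite addr_ge0.
move=> t s tT sT; have [F [LF nF EF]] := HK t s tT sT.
exists F, (A * (t - s)), (B * (t - s)); split => //; first by apply/funext => x; exact: EF.
have nF' : fine (L2norm2 F) <= K * (t - s) ^+ 2 by rewrite -lee_fin L2_fin.
apply: (@le_trans _ _ ((K + A ^+ 2 + B ^+ 2) * (t - s) ^+ 2)).
  by rewrite !exprMn !mulrDl !lerD.
rewrite exprMn real_normK ?num_real// ler_wpM2r ?sqr_ge0//.
by set Q := K + _ + _ in Q0 *; nra.
Qed.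

Lemma vt_L2 t : L2 (vf t).
Proof.
split; first exact: vt_meas.
have := mut_split L UC t measurableT; rewrite mutT => E.
apply: (@le_lt_trans _ _ M%:E); last by rewrite ltry.
rewrite E /L2norm2 leeDl// integral_ge0// => x _; by rewrite lee_fin (lagr_h0 L).
Qed.

(** The square-integrable part equals [uf t] minus multiples of [pp] and [pm], and has the
    corresponding weak derivative; that is square-integrable because [vf t] has squared norm at most
    [M] and the derivatives of [pp] and [pm] have compact support. *)
Lemma ut_E2 t : 0 <= t -> E2 pp pm (uf t).
Proof.
move=> t0; have [f [a0 [b0 [[Lf [g [Lg gf]]] E]]]] := hE2.
have [K [A [B [_ HK]]]] := ut_increment t0.
have [||F [LF _ EF]] := HK t 0; [by rewrite t0 lexx|by rewrite lexx|].
rewrite subr0 in EF.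
set a1 := a0 + A * t; set b1 := b0 + B * t.
have Ef x : uf t x = (f x + F x) + a1 * pp x + b1 * pm x.
  have := EF x; have := congr1 (fun F => F x) E; rewrite /= => -> E'.
  by rewrite /a1 /b1; lra.
exists (fun x => f x + F x), a1, b1; split; last by apply/funext.
split; first exact: L2_add.
exists (fun x => (vf t x + (- a1) * derive1 pp x) + (- b1) * derive1 pm x); split.
  apply: L2_add; last by apply: L2_scale; exact: PU_dpm_L2 PU.
  by apply: L2_add; [exact: vt_L2|apply: L2_scale; exact: PU_dpp_L2 PU].
have -> : (fun x => f x + F x) = (fun x => (uf t x + (- a1) * pp x) + (- b1) * pm x).
  by apply/funext => x; rewrite Ef; ring.
apply: has_weak_deriv_add.
  apply: has_weak_deriv_add; first exact: ut_weak_deriv.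
  by apply: has_weak_deriv_scale; apply: smooth_weak_deriv; exact: PU_pp PU.
by apply: has_weak_deriv_scale; apply: smooth_weak_deriv; exact: PU_pm PU.
Qed.

Lemma ut_in_D t : 0 <= t -> in_D pp pm (uf t) (muf t).
Proof. by move=> t0; split; [exact: ut_E2|exact: mut_E1_0|exact: ut_ac]. Qed.

End Membership.

(** * Calculus of test functions *)

Section Caratheodory.
Context {R : realType}.
Local Notation T := (measurableTypeR R).

Let stepn (n : nat) (t : R) : R := (Num.floor (t * n.+1%:R))%:~R / n.+1%:R.

Let stepn_cvg t : stepn n t @[n --> \oo] --> t.
Proof.
apply/cvgrPdist_le => e e0; near=> n.
have n0 : 0 < n.+1%:R :> R by [].
have /andP[f1 f2] := real_floor_itv (num_real (t * n.+1%:R)).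
apply: (@le_trans _ _ n.+1%:R^-1).
  rewrite /stepn ger0_norm.
    rewrite lerBlDr (_ : _ + _ = (1 + (Num.floor (t * n.+1%:R))%:~R) / n.+1%:R); last by rewrite mulrDl mul1r.
    rewrite ler_pdivlMr//.
    by move: f2; rewrite intrD => /ltW; rewrite addrC.
  by rewrite subr_ge0 ler_pdivrMr.
apply: ltW; near: n.
exact: (near_infty_natSinv_lt (PosNum e0)).
Unshelve. all: by end_near. Qed.

(* Approximate in the first variable by step functions. *)
Lemma measurable_caratheodory d (X : measurableType d) (f : R -> X -> R) :
  (forall t, measurable_fun [set: X] (f t : X -> T)) ->
  (forall x, continuous (fun t => f t x)) ->
  measurable_fun [set: T * X] (fun p : T * X => f p.1 p.2 : T).
Proof.
move=> mf cf.
apply: (@measurable_fun_cvg _ _ _ setT (fun n (p : T * X) => f (stepn n p.1) p.2)).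
  move=> n _ B mB; rewrite setTI.
  have -> : (fun p : T * X => f (stepn n p.1) p.2) @^-1` B =
     \bigcup_(z : int) ([set t : T | Num.floor (t * n.+1%:R) = z] `*` (f (z%:~R / n.+1%:R) @^-1` B)).
    apply/seteqP; split => [[t x] /= Bf|[t x] [z _ [/= <-]]//].
    by exists (Num.floor (t * n.+1%:R)).
  apply: countable_bigcupT_measurable => [|z]; first exact: countableP.
  apply: measurableX.
    have n0 : 0 < n.+1%:R :> R by [].
    have -> : [set t : T | Num.floor (t * n.+1%:R) = z] = `[z%:~R / n.+1%:R, (z + 1)%:~R / n.+1%:R[%classic.
      apply/seteqP; split => t /=; rewrite in_itv/= ler_pdivrMr// ltr_pdivlMr//.
        by move=> <-; apply: real_floor_itv; exact: num_real.
      exact: floor_def.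
    exact: measurable_itv.
  by rewrite -[X in measurable X]setTI; exact: mf.
move=> [t x] _ /=; apply: (@cvg_comp _ _ _ (fun n => stepn n t) (fun s => f s x) _ (nbhs t)).
  exact: stepn_cvg.
exact: cf.
Qed.

End Caratheodory.

Section Calculus.
Context {R : realType}.
Local Notation leb := (@lebesgue_measure R).
Local Notation T := (measurableTypeR R).

Lemma is_derive_cont (f : R -> R) (x d : R) : is_derive x 1 f d -> {for x, continuous f}.
Proof.
by move=> [df _]; apply: differentiable_continuous; apply/derivable1_diffP.
Qed.

Lemma is_derive_quot (f : R -> R) (x d : R) :
  ((fun k => k^-1 * (f (k + x) - f x)) @ 0^' --> d) -> is_derive x 1 f d.
Proof.
move=> H; have {}H : (fun k => k^-1 *: ((f \o shift x) (k *: 1) - f x)) @ 0^' --> (d : R^o).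
  by apply: cvg_trans H; apply: near_eq_cvg; near=> k; rewrite /= scaler1.
split; first by apply/cvg_ex; exists d.
exact: cvg_lim H.
Unshelve. all: by end_near. Qed.

Lemma quot_is_derive (f : R -> R) (x d : R) : is_derive x 1 f d ->
  ((fun k => k^-1 * (f (k + x) - f x)) @ 0^' --> d).
Proof.
move=> [/cvg_ex[l Hl] <-]; rewrite /derive.
have -> : lim ((fun k : R => k^-1 *: ((f \o shift x) (k *: 1) - f x)) @ 0^') = l by exact: cvg_lim Hl.
by apply: cvg_trans Hl; apply: near_eq_cvg; near=> k; rewrite /= scaler1.
Unshelve. all: by end_near. Qed.

Lemma MVT_is_derive (f f' : R -> R) (a b : R) :
  (forall x : R, Num.min a b <= x <= Num.max a b -> is_derive x 1 f (f' x)) ->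
  exists2 c, Num.min a b <= c <= Num.max a b & f b - f a = f' c * (b - a).
Proof.
move=> df.
have [ab|/ltW ba] := leP a b.
  have H x : a <= x <= b -> is_derive x 1 f (f' x) by rewrite (min_l ab) (max_r ab) in df; exact: df.
  have d1 x : x \in `]a, b[ -> is_derive x 1 f (f' x).
    by rewrite in_itv/= => /andP[/ltW ? /ltW ?]; apply: H; apply/andP.
  have c1 : {within `[a, b], continuous f}.
    by apply: derivable_within_continuous => x; rewrite in_itv/= => /H[].
  by have [c cab E] := MVT_segment ab d1 c1; exists c => //; move: cab; rewrite in_itv.
have H x : b <= x <= a -> is_derive x 1 f (f' x) by rewrite (min_r ba) (max_l ba) in df; exact: df.
have d1 x : x \in `]b, a[ -> is_derive x 1 f (f' x).
  by rewrite in_itv/= => /andP[/ltW ? /ltW ?]; apply: H; apply/andP.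
have c1 : {within `[b, a], continuous f}.
  by apply: derivable_within_continuous => x; rewrite in_itv/= => /H[].
have [c cab E] := MVT_segment ba d1 c1; exists c; first by move: cab; rewrite in_itv.
by rewrite -opprB E; ring.
Qed.

(** The time variation [F t (gam t) - F t0 (gam t)] is handled by the mean value theorem and joint
    continuity of [F1], the rest by the one-variable chain rule. In space, differentiability at a
    single point is enough. *)
Lemma chain2 (F F1 : R -> R -> R) (gam : R -> R) (t0 F2 v : R) :
  (\forall t \near t0, forall x : R, is_derive (t : R) 1 (fun s => F s x) (F1 t x)) ->
  is_derive (gam t0) 1 (F t0) F2 ->
  {for (t0, gam t0), continuous (fun p : R * R => F1 p.1 p.2)} ->
  is_derive t0 1 gam v ->
  is_derive t0 1 (fun t => F t (gam t)) (F1 t0 (gam t0) + F2 * v).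
Proof.
move=> dF1 dF2 cF1 dg.
have D2 := is_derive1_comp dF2 dg.
suff D1 : is_derive t0 1 (fun t => F t (gam t) - F t0 (gam t)) (F1 t0 (gam t0)).
  have := is_deriveD D1 D2.
  by congr (is_derive _ _ _ _); apply/funext => t /=; rewrite /= subrK.
apply: is_derive_quot; rewrite subrr.
have cg := is_derive_cont dg.
apply/cvgrPdist_le => e e0.
have /cvgrPdist_le/(_ _ e0) := cF1.
rewrite near_nbhs => /nbhs_ballP[d /= d0 Hd].
move/nbhs_ballP : dF1 => [d1 /= d10 Hd1].
have /cvgrPdist_lt/(_ _ d0) := cg.
rewrite near_nbhs => /nbhs_ballP[d2 /= d20 Hd2].
near=> k.
have k0 : k != 0 by near: k; exact: nbhs_dnbhs_neq.
have kd : `|k| < d by near: k; exact: dnbhs0_lt.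
have kd1 : `|k| < d1 by near: k; exact: dnbhs0_lt.
have kd2 : `|k| < d2 by near: k; exact: dnbhs0_lt.
have bt s : Num.min t0 (k + t0) <= s <= Num.max t0 (k + t0) -> `|t0 - s| <= `|k|.
  have [k1|k1] := leP t0 (k + t0) => /andP[h1 h2].
    by rewrite distrC ger0_norm ?subr_ge0// lerBlDr (le_trans h2)// lerD2r ler_norm.
  rewrite ger0_norm ?subr_ge0// lerBlDr -lerBlDl (le_trans _ h1)// addrC lerD2r.
  by rewrite lerNl -normrN ler_norm.
have [c cb E] : exists2 c, Num.min t0 (k + t0) <= c <= Num.max t0 (k + t0) &
    F (k + t0) (gam (k + t0)) - F t0 (gam (k + t0)) = F1 c (gam (k + t0)) * (k + t0 - t0).
  apply: (@MVT_is_derive (fun s => F s (gam (k + t0))) (fun s => F1 s (gam (k + t0)))) => s sb.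
  apply: Hd1; rewrite /ball/=; exact: le_lt_trans (bt _ sb) kd1.
rewrite subr0 E addrK [k^-1 * _]mulrC mulfK//.
have := Hd (c, gam (k + t0)); rewrite /ball/= => -> //; split => /=.
  exact: le_lt_trans (bt _ cb) kd.
by apply: Hd2; rewrite /ball/= opprD addrCA subrr addr0 normrN.
Unshelve. all: by end_near. Qed.

Lemma halfline_FTC (G G' : R -> R) (K : R) : (forall t : R, is_derive t 1 G (G' t)) ->
  continuous G' -> (forall t, K < t -> G t = 0) -> (forall t, K < t -> G' t = 0) ->
  (\int[leb]_(t in [set t : R | (0 <= t)%R]) (G' t)%:E = (- G 0)%:E)%E.
Proof.
move=> dG cG' GK G'K.
pose K' := Num.max K 0 + 1.
have K'0 : 0 < K' by rewrite /K' ltr_pwDr// le_max lexx orbT.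
have KK' : K < K' by rewrite /K' ltr_pwDr// le_max lexx.
transitivity (\int[leb]_(t in `[0%R, K']) (G' t)%:E)%E.
  rewrite integral_mkcond [RHS]integral_mkcond; apply: eq_integral => t _.
  rewrite !patchE; case: ifPn => [|]; rewrite ?inE/= => t0.
    case: ifPn => //; rewrite notin_setE/= in_itv/= => /negP; rewrite negb_and t0/= -ltNge => K't.
    by rewrite G'K// (lt_trans KK').
  rewrite memNset//= in_itv/= => /andP[t1 _].
  by move/negP : t0; apply; rewrite inE.
have cG : continuous G by move=> t; exact: is_derive_cont (dG t).
rewrite (@continuous_FTC2 _ G' G)//.
- by rewrite GK// -EFinB sub0r.
- exact: continuous_subspaceT.
- split => [t _| |]; first by have [] := dG t.
  + by apply: cvg_at_right_filter; exact: cG.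
  + by apply: cvg_at_left_filter; exact: cG.
- by move=> t _; rewrite derive1E; have [_ ->] := dG t.
Qed.

(** On the half-plane [f] is dominated by [C * k x] up to time [K] and vanishes afterwards, which is
    integrable on the product. The half-line enters as an indicator, so that Fubini is applied on
    the whole plane. *)
Lemma bounded_Fubini (f : R -> R -> R) (C K : R) (k : R -> R) : 0 <= C ->
  measurable_fun [set: T * T] (fun p : T * T => f p.1 p.2 : T) ->
  leb.-integrable setT (EFin \o k) ->
  (forall t x, 0 <= t -> `|f t x| <= C * k x) -> (forall t x, K < t -> f t x = 0) ->
  (\int[leb]_(t in [set t : R | (0 <= t)%R]) \int[leb]_x (f t x)%:E =
   \int[leb]_x \int[leb]_(t in [set t : R | (0 <= t)%R]) (f t x)%:E)%E.
Proof.
move=> C0 mf ik fk fK.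
have mpos : measurable ([set t : R | (0 <= t)%R] : set T).
  have -> : [set t : R | (0 <= t)%R] = `[0, +oo[%classic.
    by apply/seteqP; split => t /=; rewrite in_itv/= andbT.
  exact: measurable_itv.
pose g (p : T * T) : \bar R := ((\1_[set t : R | (0 <= t)%R] p.1 * f p.1 p.2)%R)%:E.
have mg : measurable_fun setT g.
  apply/measurable_EFinP; apply: measurable_funM => //.
  apply: (measurableT_comp (f := \1_[set t : R | (0 <= t)%R] : T -> T)) => //.
have /integrableP[ik1 ik2] := ik.
have k0 x : 0 <= C * k x by apply: le_trans (fk 0 x (lexx 0)).
pose K' := Num.max K 0.
have K'0 : 0 <= K' by rewrite le_max lexx orbT.
have ig : (leb \x leb)%E.-integrable setT g.
  apply/integrable12ltyP => //.
  apply: (@le_lt_trans _ _ (\int[leb]_t ((\1_(`[0, K']) t)%:E * \int[leb]_x (C * k x)%:E))%E).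
    apply: ge0_le_integral => //.
    - by move=> t _; exact: integral_ge0.
    - by apply: (@measurable_fun_fubini_tonelli_F _ _ _ _ R leb (abse \o g)); [exact: (measurableT_comp _ mg)|by move=> p; exact: abse_ge0].
    - apply: emeasurable_funM => //; apply/measurable_EFinP; exact: measurable_indic.
    - move=> t _; rewrite indicE; have [|/negP] := boolP (t \in _); rewrite inE/= in_itv/= => t0.
        rewrite mul1e; apply: ge0_le_integral => //.
        + apply/measurable_EFinP; apply: measurableT_comp => //; apply: measurable_funM => //.
          exact: (measurableT_comp mf (pair1_measurable t)).
        + by apply/measurable_EFinP; apply: measurable_funM => //; exact/measurable_EFinP.
        + move=> x _; rewrite /g/= lee_fin indicE mem_set/=; last by case/andP: t0.
          by rewrite mul1r fk//; case/andP: t0.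
      rewrite mul0e [leLHS]integral0_eq// => x _; rewrite /g/= indicE.
      have [t1|t1] := leP 0 t; last by rewrite memNset/= ?mul0r ?normr0// => /le_lt_trans /(_ t1); rewrite ltxx.
      rewrite fK ?mulr0 ?normr0//; move/negP : t0; rewrite t1/= -ltNge; apply: le_lt_trans.
      by rewrite /K' le_max lexx.
  have J0 : (0 <= \int[leb]_x (C * k x)%:E)%E by apply: integral_ge0 => x _; rewrite lee_fin.
  rewrite ge0_integralZr//; try by [apply/measurable_EFinP; exact: measurable_indic|move=> t _; rewrite lee_fin].
  rewrite integral_indic ?setIT//= [X in (X * _)%E](leb_cc K'0).
  have : (\int[leb]_x (C * k x)%:E < +oo)%E.
    have /integrableP[_] := integrableZ_EFin C measurableT ik; apply: le_lt_trans.
    apply: ge0_le_integral => //.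
    - by move=> x _; rewrite lee_fin.
    - by apply/measurable_EFinP; apply: measurable_funM => //; exact/measurable_EFinP.
    - apply: measurableT_comp => //.
      by apply/measurable_EFinP; apply: measurable_funM => //; exact/measurable_EFinP.
    - by move=> x _; rewrite /= lee_fin ler_norm.
  by move=> J; rewrite lte_mul_pinfty// lee_fin subr0.
have := Fubini ig; rewrite /g/= => FF.
rewrite integral_mkcond.
transitivity (\int[leb]_t \int[leb]_x ((\1_[set t : R | (0 <= t)%R] t * f t x)%R)%:E)%E.
  apply: eq_integral => t _; rewrite patchE indicE; case: ifPn => t0.
    by apply: eq_integral => x _; rewrite mul1r.
  by rewrite integral0_eq// => x _; rewrite mul0r.
rewrite FF; apply: eq_integral => x _; rewrite [RHS]integral_mkcond.
apply: eq_integral => t _; rewrite patchE indicE; case: ifPn => t0; by rewrite ?mul1r ?mul0r.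
Qed.

End Calculus.

Section TestFunctions.
Context {R : realType}.
Local Notation leb := (@lebesgue_measure R).
Local Notation T := (measurableTypeR R).

Lemma compact_support_bounded (f : R -> R -> R) (K : R) : continuous (fun p : R * R => f p.1 p.2) ->
  (forall t x, K < `|t| \/ K < `|x| -> f t x = 0) -> exists2 C, 0 <= C & forall t x, `|f t x| <= C.
Proof.
move=> cf fK.
have cpt : compact (`[- K, K] `*` `[- K, K] : set (R * R)).
  by apply: compact_setX; exact: segment_compact.
have /compact_bounded[M [_ HM]] := continuous_compact (continuous_subspaceT (A := `[- K, K] `*` `[- K, K]) cf) cpt.
exists (`|M| + 1) => [|t x]; first by rewrite addr_ge0.
have [tK|tK] := leP `|t| K; last by rewrite fK ?normr0 ?addr_ge0//; left.
have [xK|xK] := leP `|x| K; last by rewrite fK ?normr0 ?addr_ge0//; right.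
apply: (HM (`|M| + 1)); first by rewrite ltr_pwDr// ler_norm.
exists (t, x) => //=; split; by rewrite in_itv/= -ler_norml.
Qed.

Variable phi : R -> R -> R.
Hypothesis tphi : test_fun phi.

Lemma test_dt (t x : R) : is_derive t 1 (fun s => phi s x) (dt phi t x).
Proof.
have [/(_ [::])/= [/(_ t x)[d1 _] _] _] := tphi.
by rewrite /dt derive1E; exact: derivableP.
Qed.

Lemma test_dx (t x : R) : is_derive x 1 (phi t) (dx phi t x).
Proof.
have [/(_ [::])/= [/(_ t x)[_ d2] _] _] := tphi.
by rewrite /dx derive1E; exact: derivableP.
Qed.

Lemma test_cont : continuous (fun p : R * R => phi p.1 p.2).
Proof. by have [/(_ [::])/= []] := tphi. Qed.

Lemma test_dt_cont : continuous (fun p : R * R => dt phi p.1 p.2).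
Proof. by have [/(_ [:: true])/= []] := tphi. Qed.

Lemma test_dx_cont : continuous (fun p : R * R => dx phi p.1 p.2).
Proof. by have [/(_ [:: false])/= []] := tphi. Qed.

Lemma test_support : exists K, [/\ 0 <= K,
  (forall t x, K < `|t| \/ K < `|x| -> phi t x = 0),
  (forall t x, K < `|t| \/ K < `|x| -> dt phi t x = 0) &
  (forall t x, K < `|t| \/ K < `|x| -> dx phi t x = 0)].
Proof.
have [_ [K0 HK]] := tphi; exists (Num.max K0 0).
have HK' t x : Num.max K0 0 < `|t| \/ Num.max K0 0 < `|x| -> phi t x = 0.
  by rewrite !gt_max => -[/andP[? _]|/andP[? _]]; apply: HK; [left|right].
split => //; first by rewrite le_max lexx orbT.
- move=> t x [H|H].
    apply: (@derive1_near_cst _ _ _ 0); near=> s; apply: HK'; left; near: s.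
    have cn : continuous (fun s : R => `|s|) by exact: norm_continuous.
    exact: (cvgr_gt (f := fun s : R => `|s|) _ (cn t) _ H).
  by apply: (@derive1_near_cst _ _ _ 0); near=> s; apply: HK'; right.
- move=> t x [H|H].
    by apply: (@derive1_near_cst _ _ _ 0); near=> s; apply: HK'; left.
  apply: (@derive1_near_cst _ _ _ 0); near=> s; apply: HK'; right; near: s.
  have cn : continuous (fun s : R => `|s|) by exact: norm_continuous.
  exact: (cvgr_gt (f := fun s : R => `|s|) _ (cn x) _ H).
Unshelve. all: by end_near. Qed.

Lemma pair_curve_continuous2 (f g : R -> R) (t : R) : {for t, continuous f} -> {for t, continuous g} ->
  {for t, continuous (fun s => (f s, g s))}.
Proof.
move=> cf cg; apply/cvg_ballP => e e0.
have /cvg_ballP/(_ e e0) := cf; have /cvg_ballP/(_ e e0) := cg.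
by apply: filterS2 => s ? ?; split.
Qed.

Lemma curve_continuous (f : R -> R -> R) (t : R) (gam : R -> R) : continuous (fun p : R * R => f p.1 p.2) ->
  {for t, continuous gam} -> {for t, continuous (fun s => f s (gam s))}.
Proof.
move=> cf cg; apply: (@continuous_comp _ _ _ (fun s => (s, gam s)) (fun p : R * R => f p.1 p.2)).
  by apply: pair_curve_continuous2 => //; exact: cvg_id.
exact: cf.
Qed.

Lemma slice_continuous (f : R -> R -> R) (t : R) : continuous (fun p : R * R => f p.1 p.2) ->
  continuous (f t).
Proof.
move=> cf x; apply: (@continuous_comp _ _ _ (fun s => (t, s)) (fun p : R * R => f p.1 p.2)).
  by apply: pair_curve_continuous2; [exact: cvg_cst|exact: cvg_id].
exact: cf.
Qed.

End TestFunctions.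

(** * Weak equations for the constructed solution *)

Section OutsideInterval.
Context {R : realType}.
Local Notation leb := (@lebesgue_measure R).
Local Notation T := (measurableTypeR R).

Lemma integral_outside (f : R -> R) r : 0 <= r -> (forall x, r < `|x| -> f x = 0) ->
  measurable_fun [set: T] (f : T -> T) ->
  (\int[leb]_x (f x)%:E = \int[leb]_(x in `](- (r + 1))%R, (r + 1)%R]) (f x)%:E)%E.
Proof.
move=> r0 fr mf; rewrite [RHS]integral_mkcond; apply: eq_integral => x _; rewrite patchE.
have [//|/negP] := boolP (x \in _); rewrite inE/= in_itv/= => /negP xr.
rewrite fr// ltNge; apply: contra xr; rewrite ler_norml => /andP[? ?].
by apply/andP; split; lra.
Qed.

Lemma compact_bounded_integrable (f : R -> R) C r : 0 <= r -> measurable_fun [set: T] (f : T -> T) ->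
  (forall x, `|f x| <= C) -> (forall x, r < `|x| -> f x = 0) -> leb.-integrable setT (EFin \o f).
Proof.
move=> r0 mf fC fr.
have -> : EFin \o f = (EFin \o f) \_ (`](- (r + 1))%R, (r + 1)%R]).
  apply/funext => x; rewrite patchE /=.
  have [//|/negP] := boolP (x \in _); rewrite inE/= in_itv/= => /negP xr.
  rewrite fr// ltNge; apply: contra xr; rewrite ler_norml => /andP[? ?].
  by apply/andP; split; lra.
apply/integrable_restrict => //; rewrite setTI.
exact: oc_integrable fC.
Qed.

Lemma integral_opp (f : R -> R) : leb.-integrable setT (EFin \o f) ->
  (\int[leb]_x (- f x)%:E = - \int[leb]_x (f x)%:E)%E.
Proof.
move=> intf; rewrite -[RHS]mulN1e -(integralZl measurableT intf).
by apply: eq_integral => x _; rewrite /= mulN1e.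
Qed.

End OutsideInterval.

Section WeakEquations.
Context {R : realType}.
Local Notation leb := (@lebesgue_measure R).
Local Notation T := (measurableTypeR R).
Variables (M C0 : R) (y0 U0 H a w h : R -> R).
Hypothesis L : lagrangian M y0 U0 H a w h.
Hypothesis UC : forall xi, `|U0 xi| <= C0.
Local Notation Fl := (flow M y0 U0 H).
Local Notation FlU := (flowU M U0 H).
Local Notation Jac := (flow_jac a w h).
Local Notation UJac := (flowU_jac w h).
Local Notation Yf := (unflow L UC).
Local Notation uf := (ut L UC).
Local Notation vf := (vt L UC).
Local Notation muf := (mut L).

Variable phi : R -> R -> R.
Hypothesis tphi : test_fun phi.

Let psi t xi : R := phi t (Fl t xi).
Let dpsi t xi : R := dt phi t (Fl t xi) + dx phi t (Fl t xi) * FlU t xi.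

Lemma psi_derive (xi t : R) : is_derive t 1 (fun s => psi s xi) (dpsi t xi).
Proof.
apply: (@chain2 _ phi (dt phi) (fun s => Fl s xi) t).
- by near=> s; move=> x; exact: test_dt.
- exact: test_dx.
- exact: test_dt_cont.
- exact: flow_derive.
Unshelve. all: by end_near. Qed.

Lemma FlU_t_cont xi : continuous (fun t => FlU t xi).
Proof.
move=> t; apply: cvgD; first exact: cvg_cst.
apply: cvgM; last exact: cvg_cst.
by apply: cvgM; [exact: cvg_id|exact: cvg_cst].
Qed.

Lemma dpsi_t_cont xi : continuous (fun t => dpsi t xi).
Proof.
move=> t; apply: cvgD.
  apply: (curve_continuous (f := dt phi)); first exact: test_dt_cont.
  exact: flow_t_continuous.
apply: cvgM; last exact: FlU_t_cont.
apply: (curve_continuous (f := dx phi)); first exact: test_dx_cont.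
exact: flow_t_continuous.
Qed.

Lemma slice_flow_meas (f : R -> R -> R) t : continuous (fun p : R * R => f p.1 p.2) ->
  measurable_fun [set: T] ((fun xi => f t (Fl t xi)) : T -> T).
Proof.
move=> cf; apply: (measurableT_comp (f := f t : T -> T)); last exact: (flow_meas L t).
by apply: continuous_measurable_fun; exact: slice_continuous.
Qed.

Lemma FlU_meas t : measurable_fun [set: T] (FlU t : T -> T).
Proof. by apply: continuous_measurable_fun; exact: (flowU_continuous L). Qed.

Lemma dpsi_meas t : measurable_fun [set: T] (dpsi t : T -> T).
Proof.
apply: measurable_funD; first by apply: slice_flow_meas; exact: test_dt_cont.
apply: measurable_funM; last exact: FlU_meas.
by apply: slice_flow_meas; exact: test_dx_cont.
Qed.

Lemma psi_meas t : measurable_fun [set: T] (psi t : T -> T).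
Proof. by apply: slice_flow_meas; exact: test_cont. Qed.

Lemma test_constants : exists K C, [/\ 0 <= K, 0 <= C,
  (forall t x, K < `|t| \/ K < `|x| -> [/\ phi t x = 0, dt phi t x = 0 & dx phi t x = 0]) &
  (forall t x, [/\ `|phi t x| <= C, `|dt phi t x| <= C & `|dx phi t x| <= C])].
Proof.
have [K [K0 K1 K2 K3]] := test_support tphi.
have [C1 C10 H1] := compact_support_bounded (test_cont tphi) K1.
have [C2 C20 H2] := compact_support_bounded (test_dt_cont tphi) K2.
have [C3 C30 H3] := compact_support_bounded (test_dx_cont tphi) K3.
exists K, (C1 + C2 + C3); split => //; first by rewrite !addr_ge0.
  by move=> t x tx; split; [exact: K1|exact: K2|exact: K3].
move=> t x; split; [apply: le_trans (H1 t x) _|apply: le_trans (H2 t x) _|apply: le_trans (H3 t x) _]; lra.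
Qed.

Lemma dpsi_bound K C t xi : 0 <= C -> 0 <= t <= K ->
  (forall t x, [/\ `|phi t x| <= C, `|dt phi t x| <= C & `|dx phi t x| <= C]) ->
  `|dpsi t xi| <= C + C * (C0 + K * M / 4).
Proof.
move=> C00 tK HC; have [_ H2 H3] := HC t (Fl t xi).
rewrite (le_trans (ler_normD _ _))// lerD// normrM ler_pM//.
exact: (flowU_bound L UC).
Qed.

(** In labels the energy density [h] does not depend on time, so the integrand is the exact time
    derivative of [psi * h]; integrating in time first leaves only the initial value. *)
Lemma mut_weak_transport :
  (\int[leb]_(t in [set t : R | (0 <= t)%R]) \int[muf t]_x
           (dt phi t x + uf t x * dx phi t x)%R%:E
         = - \int[muf 0%R]_x (phi 0%R x)%:E)%E.
Proof.
have [K [C [K0 C00 HK HC]]] := test_constants.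
have mh : measurable_fun [set: T] (h : T -> T) by exact: (h_meas L).
have inner t : (\int[muf t]_x (dt phi t x + uf t x * dx phi t x)%R%:E = \int[leb]_xi (dpsi t xi * h xi)%:E)%E.
  rewrite (mut_int L t (k := fun x => (dt phi t x + uf t x * dx phi t x)%R%:E)).
    apply: eq_integral => xi _; rewrite -EFinM; congr (_ * _)%:E.
    by rewrite (ut_flow L UC) /dpsi mulrC.
  apply/measurable_EFinP; apply: measurable_funD.
    by apply: continuous_measurable_fun; apply: slice_continuous; exact: test_dt_cont.
  apply: measurable_funM; last by apply: continuous_measurable_fun; apply: slice_continuous; exact: test_dx_cont.
  apply: (measurableT_comp (f := FlU t : T -> T)); first exact: FlU_meas.
  exact: unflow_meas.
under eq_integral do rewrite inner.
pose B := C + C * (C0 + K * M / 4).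
have B0 : 0 <= B.
  rewrite addr_ge0// mulr_ge0// addr_ge0 ?(C0_ge0 UC)// divr_ge0// mulr_ge0// (lagr_M0 L)//.
rewrite (@bounded_Fubini _ (fun t xi => dpsi t xi * h xi) B K h B0).
- transitivity (\int[leb]_xi (- (psi 0 xi * h xi))%:E)%E.
    apply: eq_integral => xi _.
    apply: (@halfline_FTC _ (fun t => psi t xi * h xi) (fun t => dpsi t xi * h xi) K).
    + move=> t; have D1 := psi_derive xi t.
      have D := is_deriveM D1 (is_derive_cst (h xi) t 1).
      by apply: (is_derive_eq D); rewrite scaler0 add0r /GRing.scale/= mulrC.
    + by move=> t; apply: cvgM; [exact: dpsi_t_cont|exact: cvg_cst].
    + move=> t Kt; rewrite /psi; have [|-> _ _] := HK t (Fl t xi); last by rewrite mul0r.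
      by left; rewrite (lt_le_trans Kt)// ler_norm.
    + move=> t Kt; rewrite /dpsi; have [|_ -> ->] := HK t (Fl t xi); last by rewrite !mul0r addr0 mul0r.
      by left; rewrite (lt_le_trans Kt)// ler_norm.
  rewrite (@integral_opp _ (fun xi => psi 0 xi * h xi)).
    rewrite (mut_int L 0 (k := fun x => (phi 0 x)%:E)).
      by congr (- _)%E; apply: eq_integral => xi _; rewrite EFinM.
    by apply/measurable_EFinP; apply: continuous_measurable_fun; apply: slice_continuous; exact: test_cont.
  apply: (le_integrable measurableT _ _ (integrableZ_EFin C measurableT (h_integrable L))).
    by apply/measurable_EFinP; apply: measurable_funM => //; exact: psi_meas.
  move=> xi _ /=; rewrite lee_fin !normrM ler_wpM2r//.
  by have [H1 _ _] := HC 0 (Fl 0 xi); rewrite (le_trans H1)// ler_norm.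
- apply: (@measurable_caratheodory _ _ _ (fun t xi => dpsi t xi * h xi)).
    by move=> t; apply: measurable_funM => //; exact: dpsi_meas.
  by move=> xi t; apply: cvgM; [exact: dpsi_t_cont|exact: cvg_cst].
- exact: (h_integrable L).
- move=> t xi t0; rewrite normrM (ger0_norm (lagr_h0 L xi)) ler_wpM2r ?(lagr_h0 L)//.
  have [tK|tK] := leP t K; first by apply: dpsi_bound => //; rewrite t0.
  rewrite /dpsi; have [|_ -> ->] := HK t (Fl t xi); last by rewrite mul0r addr0 normr0.
  by left; rewrite (lt_le_trans tK)// ler_norm.
- move=> t xi Kt; rewrite /dpsi; have [|_ -> ->] := HK t (Fl t xi); last by rewrite !mul0r addr0 mul0r.
  by left; rewrite (lt_le_trans Kt)// ler_norm.
Qed.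

(** [kk] is the integrand of the momentum equation read in labels. [gg] is the time derivative of
    [FlU * psi * Jac], and [ee] is the label derivative of [2^-1 * FlU ^+ 2 * psi], which integrates
    to zero. So [kk * Jac] and [gg] have the same integral. *)
Let kk t xi : R := FlU t xi * dt phi t (Fl t xi) + 2^-1 * FlU t xi ^+ 2 * dx phi t (Fl t xi)
  + (H xi / 2 - M / 4) * psi t xi.
Let gg t xi : R := ((H xi / 2 - M / 4) * psi t xi + FlU t xi * dpsi t xi) * Jac t xi
  + FlU t xi * psi t xi * UJac t xi.
Let ee t xi : R := 2^-1 * (FlU t xi ^+ 2 * (dx phi t (Fl t xi) * Jac t xi))
   + FlU t xi * UJac t xi * psi t xi.

Lemma gg_split t xi : gg t xi = kk t xi * Jac t xi + ee t xi.
Proof. by rewrite /gg /kk /ee /dpsi; field. Qed.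

Lemma Jac_derive (xi t : R) : is_derive t 1 (fun s => Jac s xi) (UJac t xi).
Proof.
rewrite /flow_jac /flowU_jac; apply: is_derive_eq.
by rewrite /= !scaler0 !scaler1 /GRing.scale/=; field.
Qed.

Lemma FlU_derive (xi t : R) : is_derive t 1 (fun s => FlU s xi) (H xi / 2 - M / 4).
Proof.
rewrite /flowU; apply: is_derive_eq.
by rewrite /= !scaler0 !scaler1 /GRing.scale/=; field.
Qed.

Lemma gg_derive (xi t : R) : is_derive t 1 (fun s => FlU s xi * psi s xi * Jac s xi) (gg t xi).
Proof.
have D := is_deriveM (is_deriveM (FlU_derive xi t) (psi_derive xi t)) (Jac_derive xi t).
apply: (is_derive_eq D); rewrite /gg /GRing.scale/=.
by rewrite -[(_ * _) t]/(FlU t xi * psi t xi); ring.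
Qed.

Lemma psi_t_cont xi : continuous (fun t => psi t xi).
Proof. by move=> t; exact: is_derive_cont (psi_derive xi t). Qed.

Lemma Jac_t_cont xi : continuous (fun t => Jac t xi).
Proof. by move=> t; exact: is_derive_cont (Jac_derive xi t). Qed.

Lemma UJac_t_cont xi : continuous (fun t => UJac t xi).
Proof.
move=> t; apply: cvgD; first exact: cvg_cst.
apply: cvgM; last exact: cvg_cst.
by apply: cvgM; [exact: cvg_id|exact: cvg_cst].
Qed.

Lemma gg_t_cont xi : continuous (fun t => gg t xi).
Proof.
move=> t; apply: cvgD.
  apply: cvgM; last exact: Jac_t_cont.
  apply: cvgD; first by apply: cvgM; [exact: cvg_cst|exact: psi_t_cont].
  by apply: cvgM; [exact: FlU_t_cont|exact: dpsi_t_cont].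
apply: cvgM; last exact: UJac_t_cont.
by apply: cvgM; [exact: FlU_t_cont|exact: psi_t_cont].
Qed.

Lemma psi_out K t xi : (forall t x, K < `|t| \/ K < `|x| -> [/\ phi t x = 0, dt phi t x = 0 & dx phi t x = 0]) ->
  0 <= t -> K < t \/ K + (M + t * C0 + t ^+ 2 / 8 * M) < `|xi| ->
  [/\ psi t xi = 0, dt phi t (Fl t xi) = 0 & dx phi t (Fl t xi) = 0].
Proof.
move=> HK t0 [tK|xiK]; apply: HK.
  by left; rewrite (lt_le_trans tK)// ler_norm.
right; have := flow_label L UC t xi; rewrite (ger0_norm t0) => fl.
have : `|xi| <= `|Fl t xi| + `|Fl t xi - xi|.
  by rewrite -[in leLHS](subKr (Fl t xi) xi) (le_trans (ler_normB _ _)).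
by lra.
Qed.

Lemma gg_out K t xi : (forall t x, K < `|t| \/ K < `|x| -> [/\ phi t x = 0, dt phi t x = 0 & dx phi t x = 0]) ->
  0 <= t -> K < t \/ K + (M + t * C0 + t ^+ 2 / 8 * M) < `|xi| ->
  [/\ gg t xi = 0, kk t xi = 0 & ee t xi = 0].
Proof.
move=> HK t0 tx; have [p0 d0 x0] := psi_out HK t0 tx.
by rewrite /gg /kk /ee /dpsi p0 d0 x0; split; rewrite !(mulr0, mul0r, addr0).
Qed.

Lemma ee_integral t : 0 <= t -> (\int[leb]_xi (ee t xi)%:E = 0)%E.
Proof.
move=> t0; have [K [C [K0 C00 HK HC]]] := test_constants.
pose r := K + (M + t * C0 + t ^+ 2 / 8 * M).
have M0 := lagr_M0 L; have C00' := C0_ge0 UC.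
have r0 : 0 <= r by rewrite /r !addr_ge0 ?mulr_ge0 ?divr_ge0 ?sqr_ge0.
have Ub xi : `|FlU t xi| <= C0 + t * M / 4 by apply: (flowU_bound L UC); rewrite t0 lexx.
have pb xi : `|psi t xi| <= C by have [] := HC t (Fl t xi).
have B1 := bprimM (flowU_bprim L t) (flowU_bprim L t) Ub Ub.
have cdx : continuous (dx phi t) by apply: slice_continuous; exact: test_dx_cont.
have dxb x : `|dx phi t x| <= C by have [] := HC t x.
have B2 := bprim_comp (flow_bprim L t) (test_dx tphi t) cdx dxb.
have U2b xi : `|FlU t xi * FlU t xi| <= (C0 + t * M / 4) * (C0 + t * M / 4) by rewrite normrM ler_pM.
have B3 := bprimM B1 B2 U2b pb.
have B4 := bprimZ 2^-1 B3.
have [mB [CB hB] BE] : bprim (ee t) (fun xi => 2^-1 * (FlU t xi * FlU t xi * psi t xi)).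
  by apply: (bprim_ext B4) => xi //; rewrite /ee /psi /=; field.
have me : measurable_fun [set: T] (ee t : T -> T) by [].
rewrite (@integral_outside _ _ r)//; last by move=> xi rxi; have [] := gg_out HK t0 (or_intror rxi).
have rr : - (r + 1) <= r + 1 by lra.
have := BE _ _ rr; rewrite /Rintegral.
have [|-> _ _] := psi_out (xi := r + 1) HK t0; first by right; rewrite -/r ger0_norm; lra.
have [|-> _ _] := psi_out (xi := - (r + 1)) HK t0; first by right; rewrite -/r normrN ger0_norm; lra.
rewrite !mulr0 subrr => /esym E; rewrite -[RHS]/(0%:E) -E fineK//.
by apply: integrable_fin_num => //; exact: (oc_integrable _ _ mB hB).
Qed.

Lemma inner_eq t : 0 <= t ->
  (\int[leb]_x (uf t x * dt phi t x + 2^-1 * (uf t x) ^+ 2 * dx phi t x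
            + 4^-1 * (fine (muf t `]-oo, x[%classic) - fine (muf t `]x, +oo[%classic))
                   * phi t x)%R%:E = \int[leb]_xi (gg t xi)%:E)%E.
Proof.
move=> t0; have [K [C [K0 C00 HK HC]]] := test_constants.
have mphi : measurable_fun [set: T] (phi t : T -> T) by apply: continuous_measurable_fun; apply: slice_continuous; exact: test_cont.
have mdt : measurable_fun [set: T] (dt phi t : T -> T) by apply: continuous_measurable_fun; apply: slice_continuous; exact: test_dt_cont.
have mdx : measurable_fun [set: T] (dx phi t : T -> T) by apply: continuous_measurable_fun; apply: slice_continuous; exact: test_dx_cont.
have mU := FlU_meas t; have mY := unflow_meas L UC t.
have mH : measurable_fun [set: T] (H : T -> T) by exact: (H_meas L).
have mdtF : measurable_fun [set: T] ((fun xi => dt phi t (Fl t xi)) : T -> T) by apply: slice_flow_meas; exact: test_dt_cont.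
have mdxF : measurable_fun [set: T] ((fun xi => dx phi t (Fl t xi)) : T -> T) by apply: slice_flow_meas; exact: test_dx_cont.
have mpsi := psi_meas t.
have mk : measurable_fun [set: T] (kk t : T -> T).
  apply: measurable_funD; first apply: measurable_funD.
  - exact: measurable_funM.
  - by apply: measurable_funM => //; apply: measurable_funM => //; exact: measurable_funX.
  - apply: measurable_funM => //; apply: measurable_funB => //; exact: measurable_funM.
have mku : measurable_fun [set: T] (uf t : T -> T) by exact: (measurableT_comp mU mY).
have mF1 : measurable_fun [set: T] ((fun x => fine (muf t `]-oo, x[%classic)) : T -> T).
  under eq_fun do rewrite (mut_lt L UC).
  exact: (measurableT_comp mH mY).
have mF2 : measurable_fun [set: T] ((fun x => fine (muf t `]x, +oo[%classic)) : T -> T).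
  under eq_fun do rewrite cdfm_y.
  apply: measurable_funB => //; apply: nondecreasing_measurable => //; exact: cdfm_nd.
transitivity (\int[leb]_x (kk t (Yf t x))%:E)%E.
  (* Off the countable set [Q] a position has a single label, hence carries no atom, and the open
     right half-line has energy [M - H]. At the other positions the integrands may differ, on a null
     set. *)
  pose Q : set T := range (fun q : rat => Fl t (ratr q)).
  have cQ : countable Q by apply: card_le_trans (card_image_le _ _) _; exact: countableP.
  have mQ : measurable Q by apply: countable_measurable => // x; exact: measurable_set1.
  apply: ae_eq_integral => //.
  - apply/measurable_EFinP; apply: measurable_funD; first apply: measurable_funD.
    + exact: measurable_funM.
    + by apply: measurable_funM => //; apply: measurable_funM => //; exact: measurable_funX.
    + apply: measurable_funM => //; apply: measurable_funM => //; exact: measurable_funB.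
  - by apply/measurable_EFinP; exact: (measurableT_comp mk mY).
  exists Q; split => //; first exact: countable_lebesgue_measure0.
  move=> x /= nx; apply: contrapT => xQ; apply: nx => _; congr EFin.
  have E0 : fine (muf t `]x, +oo[%classic) = M - H (Yf t x).
    rewrite cdfm_y mutT /=; congr (_ - _).
    have -> : cdfm (muf t) x = fine (muf t (`]-oo, x[ `|` [set x])).
      rewrite /cdfm; congr (fine (muf t _)); apply/seteqP; split => z /=; rewrite !in_itv/= le_eqVlt.
        by case/predU1P; [right|left].
      by case=> [->|->]; rewrite ?orbT ?eqxx.
    rewrite fine_fmU//; last first.
      by apply/seteqP; split => // z /= []; rewrite in_itv/= => zx E; rewrite E ltxx in zx.
    rewrite (mut_lt L UC) /= [X in _ + X](_ : _ = 0) ?addr0//.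
    rewrite mutE.
    have -> : Fl t @^-1` [set x] = [set Yf t x].
      apply/seteqP; split => xi /= => [E|->]; last exact: flowK.
      apply/eqP; rewrite eq_le andbC unflowE E lexx/= leNgt; apply/negP => /rat_in_itvoo[q].
      rewrite in_itv/= => /andP[Yq qx]; apply: xQ; exists q => //.
      apply/eqP; rewrite eq_le -{1}E (flow_nd L _ (ltW qx))/=.
      by rewrite -(unflowE L UC) ltW.
    by rewrite integral_set1.
  by rewrite (mut_lt L UC) E0 /kk /psi (flowK L UC) /ut /=; field.
transitivity (\int[leb]_xi ((kk t xi)%:E * (Jac t xi)%:E))%E.
  by apply: (unflow_int L UC t (K := fun xi => (kk t xi)%:E)); exact/measurable_EFinP.
pose r := K + (M + t * C0 + t ^+ 2 / 8 * M).
have M0 := lagr_M0 L; have C00' := C0_ge0 UC.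
have r0 : 0 <= r by rewrite /r !addr_ge0 ?mulr_ge0 ?divr_ge0 ?sqr_ge0.
have mJ := jac_meas L t; have mUJ := Ujac_meas L t.
have [_ [CJ hJ] _] := flow_bprim L t.
have [_ [CUJ hUJ] _] := flowU_bprim L t.
have Ub xi : `|FlU t xi| <= C0 + t * M / 4 by apply: (flowU_bound L UC); rewrite t0 lexx.
have pb xi : `|psi t xi| <= C by have [] := HC t (Fl t xi).
have db xi : `|dt phi t (Fl t xi)| <= C by have [] := HC t (Fl t xi).
have xb xi : `|dx phi t (Fl t xi)| <= C by have [] := HC t (Fl t xi).
have Hb xi : `|H xi / 2 - M / 4| <= M.
  by have := lagr_H0 L xi; have := lagr_HM L xi => ? ?; rewrite ler_norml; apply/andP; split; lra.
set B := C0 + t * M / 4 in Ub.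
have ik : leb.-integrable setT (EFin \o (fun xi => kk t xi * Jac t xi)).
  apply: (@compact_bounded_integrable _ _ ((B * C + 2^-1 * B ^+ 2 * C + M * C) * CJ) r) => //.
  - exact: measurable_funM.
  - move=> xi; rewrite normrM ler_pM// (le_trans (ler_normD _ _))// lerD//.
      rewrite (le_trans (ler_normD _ _))// lerD//; first by rewrite normrM ler_pM.
      rewrite normrM ler_pM// normrM ler_pM//; first by rewrite ger0_norm// invr_ge0.
      by rewrite normrX ler_pXn2r// ?nnegrE// (le_trans _ (Ub xi)).
    by rewrite normrM ler_pM.
  - by move=> xi rxi; have [_ -> _] := gg_out HK t0 (or_intror rxi); rewrite mul0r.
have ie : leb.-integrable setT (EFin \o ee t).
  apply: (@compact_bounded_integrable _ _ (2^-1 * (B ^+ 2 * (C * CJ)) + B * CUJ * C) r) => //.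
  - apply: measurable_funD; apply: measurable_funM => //; last exact: measurable_funM.
    by apply: measurable_funM => //; [exact: measurable_funX|exact: measurable_funM].
  - move=> xi; rewrite (le_trans (ler_normD _ _))// lerD//; last by rewrite !normrM !ler_pM.
    rewrite !normrM !ler_pM//; first by rewrite ger0_norm// invr_ge0.
  - by move=> xi rxi; have [_ _ ->] := gg_out HK t0 (or_intror rxi).
transitivity (\int[leb]_xi ((EFin \o (fun xi => kk t xi * Jac t xi)%R) xi + (EFin \o ee t) xi))%E.
  rewrite integralD// [X in (_ + X)%E](ee_integral t0) adde0.
  by apply: eq_integral => xi _; rewrite /= EFinM.
by apply: eq_integral => xi _; rewrite /= -EFinD -gg_split.
Qed.

Lemma ut_weak_momentum :
  (\int[leb]_(t in [set t : R | (0 <= t)%R]) \int[leb]_x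
           (uf t x * dt phi t x + 2^-1 * (uf t x) ^+ 2 * dx phi t x
            + 4^-1 * (fine (muf t `]-oo, x[%classic) - fine (muf t `]x, +oo[%classic))
                   * phi t x)%R%:E
         = - \int[leb]_x (uf 0%R x * phi 0%R x)%R%:E)%E.
Proof.
have [K [C [K0 C00 HK HC]]] := test_constants.
have M0 := lagr_M0 L; have C00' := C0_ge0 UC.
transitivity (\int[leb]_(t in [set t : R | (0 <= t)%R]) \int[leb]_xi (gg t xi)%:E)%E.
  by apply: eq_integral => t; rewrite inE/= => t0; exact: inner_eq.
(* The radius of the support in labels: that of the test function plus the largest gap between label
   and position up to time [K]. *)
pose r := K + (M + K * C0 + K ^+ 2 / 8 * M).
have r0 : 0 <= r by rewrite /r !addr_ge0 ?mulr_ge0 ?divr_ge0 ?sqr_ge0.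
pose B := C0 + K * M / 4.
have B0 : 0 <= B by rewrite /B addr_ge0// divr_ge0// mulr_ge0.
pose J := 1 + K + K ^+ 2 / 4.
have J0 : 0 <= J by rewrite /J !addr_ge0// divr_ge0// sqr_ge0.
(* A term by term bound of [gg], with [B] for the velocity, [C] for the test function and its
   derivatives, and [J] for both Jacobians up to time [K]. *)
pose CC := (M * C + B * (C + C * B)) * J + B * C * J.
have CC0 : 0 <= CC by rewrite /CC; apply: addr_ge0; rewrite !mulr_ge0//; apply: addr_ge0; rewrite !mulr_ge0// addr_ge0// mulr_ge0.
rewrite (@bounded_Fubini _ gg CC K (\1_(`[- r, r]%classic)) CC0).
- transitivity (\int[leb]_xi (- (FlU 0 xi * psi 0 xi * Jac 0 xi))%:E)%E.
    apply: eq_integral => xi _.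
    apply: (@halfline_FTC _ (fun t => FlU t xi * psi t xi * Jac t xi) (fun t => gg t xi) K).
    + by move=> t; exact: gg_derive.
    + exact: gg_t_cont.
    + move=> t Kt; have t0 : 0 <= t by rewrite (le_trans K0)// ltW.
      by have [-> _ _] := psi_out (xi := xi) HK t0 (or_introl Kt); rewrite mulr0 mul0r.
    + move=> t Kt; have t0 : 0 <= t by rewrite (le_trans K0)// ltW.
      by have [-> _ _] := gg_out (xi := xi) HK t0 (or_introl Kt).
  have Ub xi : `|FlU 0 xi| <= B by apply: (flowU_bound L UC); rewrite lexx.
  have mUp : measurable_fun [set: T] ((fun xi => FlU 0 xi * psi 0 xi) : T -> T).
    by apply: measurable_funM; [exact: FlU_meas|exact: psi_meas].
  have [_ [CJ hJ] _] := flow_bprim L 0.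
  rewrite (@integral_opp _ (fun xi => FlU 0 xi * psi 0 xi * Jac 0 xi)).
    congr (- _)%E.
    transitivity (\int[leb]_x (FlU 0 (Yf 0 x) * psi 0 (Yf 0 x))%:E)%E.
      rewrite (unflow_int L UC 0 (K := fun xi => (FlU 0 xi * psi 0 xi)%:E)); last exact/measurable_EFinP.
      by apply: eq_integral => xi _; rewrite EFinM.
    by apply: eq_integral => x _; rewrite /psi (flowK L UC).
  apply: (@compact_bounded_integrable _ _ (B * C * CJ) r) => //.
  - by apply: measurable_funM => //; exact: (jac_meas L).
  - move=> xi; rewrite normrM ler_pM// normrM ler_pM//.
    by have [] := HC 0 (Fl 0 xi).
  - move=> xi rxi.
    have [|-> _ _] := psi_out (xi := xi) HK (lexx 0); last by rewrite mulr0 mul0r.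
    right; apply: le_lt_trans rxi; rewrite /r mul0r expr0n/= !mul0r !addr0.
    by rewrite lerD2l -addrA lerDl addr_ge0 ?mulr_ge0 ?divr_ge0 ?sqr_ge0.
- apply: (@measurable_caratheodory _ _ _ gg); last exact: gg_t_cont.
  move=> t; have mU := FlU_meas t; have mJ := jac_meas L t; have mUJ := Ujac_meas L t.
  have mpsi := psi_meas t; have mdpsi := dpsi_meas t.
  have mH : measurable_fun [set: T] (H : T -> T) by exact: (H_meas L).
  apply: measurable_funD; last by apply: measurable_funM => //; exact: measurable_funM.
  apply: measurable_funM => //; apply: measurable_funD; apply: measurable_funM => //.
  by apply: measurable_funB => //; exact: measurable_funM.
- apply: (@compact_bounded_integrable _ _ 1 r) => //.
    by move=> x; rewrite indicE; case: (_ \in _); rewrite ?normr1 ?normr0.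
  by move=> x rx; rewrite indicE memNset//= in_itv/= -ler_norml => /(lt_le_trans rx); rewrite ltxx.
- move=> t xi t0; rewrite indicE.
  have [tK|tK] := leP t K; last first.
    have [-> _ _] := gg_out (xi := xi) HK t0 (or_introl tK); by rewrite normr0 mulr_ge0.
  have [xr|xr] := leP `|xi| r; last first.
    have [|-> _ _] := gg_out (xi := xi) HK t0; last by rewrite normr0 mulr_ge0.
    right; apply: le_lt_trans xr; rewrite /r lerD2l; apply: lerD.
      by rewrite lerD2l ler_wpM2r.
    by rewrite ler_wpM2r// ler_wpM2r// ler_pXn2r// nnegrE.
  rewrite mem_set/=; last by rewrite in_itv/= -ler_norml.
  rewrite mulr1.
  have tK' : 0 <= t <= K by rewrite t0.
  have Ub : `|FlU t xi| <= B by exact: (flowU_bound L UC).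
  have pb : `|psi t xi| <= C by have [] := HC t (Fl t xi).
  have dpb : `|dpsi t xi| <= C + C * B by exact: dpsi_bound.
  have Hb : `|H xi / 2 - M / 4| <= M.
    by have := lagr_H0 L xi; have := lagr_HM L xi => ? ?; rewrite ler_norml; apply/andP; split; lra.
  have /andP[aa0 aa1] := lagr_a01 L xi; have /andP[hh0 hh1] := lagr_h01 L xi; have ww := lagr_w1 L xi.
  have t2 : t ^+ 2 <= K ^+ 2 by rewrite ler_pXn2r// nnegrE.
  have Jb : `|Jac t xi| <= J.
    rewrite /flow_jac /J (le_trans (ler_normD _ _))// lerD//.
      rewrite (le_trans (ler_normD _ _))// lerD//; first by rewrite ger0_norm.
      by rewrite normrM -[leRHS]mulr1 ler_pM// ger0_norm.
    rewrite normrM -[leRHS]mulr1 ler_pM//; last by rewrite ger0_norm.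
    by rewrite ger0_norm ?divr_ge0 ?sqr_ge0// ler_wpM2r ?invr_ge0.
  have UJb : `|UJac t xi| <= J.
    rewrite /flowU_jac /J (le_trans (ler_normD _ _))//.
    have h2 : `|t / 2 * h xi| <= K.
      rewrite normrM -[leRHS]mulr1 ler_pM//; last by rewrite ger0_norm.
      rewrite ger0_norm; lra.
    have K2 : 0 <= K ^+ 2 / 4 by rewrite divr_ge0// sqr_ge0.
    lra.
  rewrite /gg /CC (le_trans (ler_normD _ _))// lerD//.
    rewrite normrM ler_pM// (le_trans (ler_normD _ _))// lerD// normrM ler_pM//.
  by rewrite normrM ler_pM// normrM ler_pM.
- move=> t xi Kt; have t0 : 0 <= t by rewrite (le_trans K0)// ltW.
  by have [-> _ _] := gg_out (xi := xi) HK t0 (or_introl Kt).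
Qed.

End WeakEquations.

(** * Existence *)

Section WeakDerivatives.
Context {R : realType}.
Local Notation leb := (@lebesgue_measure R).
Local Notation T := (measurableTypeR R).

(** Cauchy-Schwarz against the constant 1. Integrating over the open interval lets the bound [K] be
    an energy that leaves out atoms at the two ends. *)
Lemma weak_deriv_holder (f g : R -> R) (x z K : R) : x <= z -> has_weak_deriv f g ->
  (\int[leb]_(s in `]x, z[) ((g s) ^+ 2)%:E <= K%:E)%E ->
  (f z - f x) ^+ 2 <= (z - x) * K.
Proof.
move=> xz [mg Hg] gK; have [ig Eg] := Hg _ _ xz.
have mg2 : measurable_fun [set: T] ((fun s => g s ^+ 2) : T -> T) by exact: measurable_funX.
have E1 : (\int[leb]_(s in `[x, z]) ((g s) ^+ 2)%:E = \int[leb]_(s in `]x, z[) ((g s) ^+ 2)%:E)%E.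
  rewrite -integral_itv_bndo_bndc; last by apply/measurable_EFinP; exact: measurable_funTS.
  by rewrite -integral_itv_obnd_cbnd//; apply/measurable_EFinP; exact: measurable_funTS.
have i2 : leb.-integrable `[x, z] (EFin \o (fun s => g s ^+ 2)).
  apply/integrableP; split; first by apply/measurable_EFinP; exact: measurable_funTS.
  rewrite [X in (X < _)%E](_ : _ = \int[leb]_(s in `[x, z]) ((g s) ^+ 2)%:E)%E.
    by rewrite E1; apply: le_lt_trans gK _; rewrite ltry.
  by apply: eq_integral => s _ /=; rewrite ger0_norm ?sqr_ge0.
have i1 : leb.-integrable `[x, z] (EFin \o (fun=> 1)).
  apply: (@bounded_integrable _ _ _ leb _ _ 1) => //; last by move=> s _; rewrite normr1.
  by rewrite [X in (X < _)%E]leb_cc// ltry.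
have fE : f z - f x = \int[leb]_(s in `[x, z]) g s by rewrite /Rintegral -Eg.
have := @CauchySchwarz_Rint _ _ _ leb `[x, z]%classic g (fun=> 1) (fun s => g s ^+ 2) (measurable_itv _) ig i1 i2.
rewrite -fE => /(_ _)/le_trans; apply.
  by move=> s _; rewrite mul1r sqr_ge0 ler01.
rewrite Rintegral_cst// mul1r [X in fine X]leb_cc//=.
apply: ler_wpM2l; first by rewrite subr_ge0.
rewrite -lee_fin /Rintegral fineK; first by rewrite E1.
exact: integrable_fin_num i2.
Qed.

Lemma integral_setT_ge (f : R -> R) (A : set T) : measurable A -> measurable_fun [set: T] (f : T -> T) ->
  (forall x, 0 <= f x) -> (\int[leb]_(x in A) (f x)%:E <= \int[leb]_x (f x)%:E)%E.
Proof.
move=> mA mf f0; apply: ge0_subset_integral => //; first exact/measurable_EFinP.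
by move=> x _; rewrite lee_fin.
Qed.

(** On an interval of length 1 the function varies by at most the square root of [K], so
    [f x ^+ 2 <= 2 * f z ^+ 2 + 2 * K]; averaging over [z] in [[x, x + 1]] bounds the left side by
    the norms. *)
Lemma H1_bounded (f : R -> R) : H1 f -> exists C, forall x, `|f x| <= C.
Proof.
move=> [Lf [g [Lg fg]]].
have [mf _] := Lf; have [mg _] := Lg.
pose K := fine (L2norm2 g).
have m2 (k : R -> R) : measurable_fun [set: T] (k : T -> T) -> measurable_fun [set: T] ((fun s => k s ^+ 2) : T -> T).
  by move=> mk; exact: measurable_funX.
have K0 : 0 <= K by rewrite /K fine_ge0// L2norm2_ge0.
pose F := fine (L2norm2 f).
have F0 : 0 <= F by rewrite /F fine_ge0// L2norm2_ge0.
have bd x z : x <= z <= x + 1 -> (f z - f x) ^+ 2 <= K.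
  move=> /andP[xz zx]; apply: (@le_trans _ _ ((z - x) * K)); last by rewrite ler_piMl//; lra.
  apply: weak_deriv_holder => //; first exact: fg.
  rewrite L2_fin//; apply: integral_setT_ge => //; first exact: m2.
  by move=> s; rewrite sqr_ge0.
have sq x : f x ^+ 2 <= 2 * F + 2 * K.
  have xx1 : x <= x + 1 by lra.
  rewrite -lee_fin.
  have -> : (f x ^+ 2)%:E = (\int[leb]_(z in `[x, (x + 1)%R]) (f x ^+ 2)%:E)%E.
    by rewrite (@integral_cst _ _ _ leb)// [X in (_ * X)%E]leb_cc// -EFinM; congr EFin; ring.
  apply: (@le_trans _ _ (\int[leb]_(z in `[x, (x + 1)%R]) (2%:E * (f z ^+ 2)%:E + (2 * K)%:E))%E).
    apply: ge0_le_integral => //.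
    - by move=> z _; rewrite lee_fin sqr_ge0.
    - by apply: emeasurable_funD => //; apply: emeasurable_funM => //; apply/measurable_EFinP; apply: measurable_funTS; exact: m2.
    - move=> z /=; rewrite in_itv/= => /bd H; rewrite -EFinM -EFinD lee_fin.
      (* [2 * f z ^+ 2 + 2 * (f z - f x) ^+ 2 - f x ^+ 2] is exactly this square. *)
      by have := sqr_ge0 (2 * f z - f x); nra.
  rewrite ge0_integralD//; last 3 first.
  - by move=> z _; rewrite mule_ge0// lee_fin sqr_ge0.
  - by apply: emeasurable_funM => //; apply/measurable_EFinP; apply: measurable_funTS; exact: m2.
  - by move=> z _; rewrite lee_fin mulr_ge0.
  rewrite [X in (_ <= X)%E](_ : _ = ((2 * F)%:E + (2 * K)%:E)%E); last by rewrite -EFinD.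
  apply: leeD.
    rewrite ge0_integralZl_EFin//; last 2 first.
    - by move=> z _; rewrite lee_fin sqr_ge0.
    - by apply/measurable_EFinP; apply: measurable_funTS; exact: m2.
    rewrite EFinM lee_wpmul2l// L2_fin//; apply: integral_setT_ge => //; first exact: m2.
    by move=> s; rewrite sqr_ge0.
  by rewrite (@integral_cst _ _ _ leb)// [X in (_ * X)%E]leb_cc// -EFinM lee_fin; lra.
exists (2 * F + 2 * K + 1) => x.
have Q0 : 0 <= 2 * F + 2 * K by rewrite addr_ge0 ?mulr_ge0.
have := sq x; rewrite -(real_normK (num_real (f x))); have := normr_ge0 (f x).
by set Q := 2 * F + 2 * K in Q0 *; nra.
Qed.

Lemma E2_bounded (pp pm u : R -> R) : partition_of_unity pp pm -> E2 pp pm u ->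
  exists C, forall x, `|u x| <= C.
Proof.
move=> PU [f [a [b [Hf ->]]]]; have [C HC] := H1_bounded Hf.
exists (C + `|a| + `|b|) => x.
have /andP[p0 p1] := PU_pp01 PU x; have /andP[m0 m1] := PU_pm01 PU x.
rewrite (le_trans (ler_normD _ _))// lerD//.
  rewrite (le_trans (ler_normD _ _))// lerD// normrM -[leRHS]mulr1 ler_pM// ger0_norm//.
by rewrite normrM -[leRHS]mulr1 ler_pM// ger0_norm.
Qed.

End WeakDerivatives.

Section Existence.
Context {R : realType}.
Local Notation leb := (@lebesgue_measure R).
Local Notation T := (measurableTypeR R).

Lemma conservative_solution_exists (pp pm u0 : R -> R)
  (mu0 : {finite_measure set T -> \bar R}) :
  partition_of_unity pp pm -> in_D pp pm u0 mu0 ->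
  exists (u : R -> R -> R) (mu : R -> {finite_measure set T -> \bar R}),
      weak_cons_sol pp pm u mu /\ has_init u mu u0 mu0.
Proof.
move=> PU [hE2 hE1 [g [hg [N [mN N0 hmu]]]]].
have [y0 hy] := label_exists mu0.
have [C0 hC0] := E2_bounded PU hE2.
have L := label_lagrangian hg mN N0 hmu hy.
have UC xi : `|(u0 \o y0) xi| <= C0 by exact: hC0.
have fl0 : flow (fine (mu0 setT)) y0 (u0 \o y0) (fun xi => xi - y0 xi) 0 = y0.
  by apply/funext => xi; rewrite /flow expr0n/= !mul0r !addr0.
have y0K x : y0 (unflow L UC 0 x) = x by rewrite -{1}fl0 flowK.
have u0E : ut L UC 0 = u0.
  by apply/funext => x; rewrite /ut /flowU !mul0r addr0 /= y0K.
have mu0E (A : set T) : measurable A -> mut L 0 A = mu0 A.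
  by move=> mA; rewrite mutE fl0; exact: (label_mu0 hg mN N0 hmu hy).
have hE2' : E2 pp pm (ut L UC 0) by rewrite u0E.
have hE1' : E1_0 pp (fun x => (fun xi => xi - y0 xi) (unflow L UC 0 x)).
  have -> : (fun x => (fun xi => xi - y0 xi) (unflow L UC 0 x)) = (fun x => fine (mu0 `]-oo, x[%classic)).
    by apply/funext => x; have := mut_lt L UC 0 x; rewrite mu0E// => ->.
  exact: hE1.
exists (ut L UC), (mut L); split; last by split.
split.
- by move=> t t0; exact: ut_in_D.
- by move=> phi tphi; split; [exact: ut_weak_momentum|exact: mut_weak_transport].
- by move=> T0 T00; split; [exact: ut_holder_on|exact: ut_lipschitz].
- have [B [mB B0 HB]] := mut_ae_ac L UC.
  exists B; split => // t t0 nB; exists (vt L UC t); split; first exact: ut_weak_deriv.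
  by apply: contrapT => H; apply: nB; exact: HB.
- exact: mut_weak_cont.
Qed.

End Existence.

(** * Smooth steps *)

Section SmoothFunctions.
Context {R : realType}.
Local Notation leb := (@lebesgue_measure R).
Local Notation T := (measurableTypeR R).

Lemma derive1_is (f : R -> R) (x d : R) : is_derive x 1 f d -> derive1 f x = d.
Proof. by move=> [_ <-]; rewrite derive1E. Qed.

Lemma derivable_is (f : R -> R) (x : R) : derivable f x 1 -> is_derive x 1 f (derive1 f x).
Proof. by move=> df; rewrite derive1E; exact: derivableP. Qed.

(** Smoothness of sums and products without a Leibniz formula for higher derivatives: the class
    contains the smooth functions and is stable under derivation, so every iterated derivative
    exists. *)
Inductive smooth_alg : (R -> R) -> Prop :=
| SA_base f : smooth f -> smooth_alg f
| SA_add f g : smooth_alg f -> smooth_alg g -> smooth_alg (fun x => f x + g x)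
| SA_mul f g : smooth_alg f -> smooth_alg g -> smooth_alg (fun x => f x * g x).

Lemma smooth_alg_derive f : smooth_alg f -> (forall x, derivable f x 1) /\ smooth_alg (derive1 f).
Proof.
elim=> {f} [f sf|f g _ [df sf] _ [dg sg]|f g saf [df sf] sag [dg sg]].
- by split; [move=> x; exact: smooth_derivable|apply: SA_base; exact: smooth_deriv].
- have D (x : R) : is_derive x 1 (fun x => f x + g x) (derive1 f x + derive1 g x).
    exact: (is_deriveD (derivable_is (df x)) (derivable_is (dg x))).
  split; first by move=> x; have [] := D x.
  have -> : derive1 (fun x => f x + g x) = (fun x => derive1 f x + derive1 g x).
    by apply/funext => x; exact: derive1_is.
  exact: SA_add.
- have D (x : R) : is_derive x 1 (fun x => f x * g x) (f x * derive1 g x + g x * derive1 f x).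
    exact: (is_deriveM (derivable_is (df x)) (derivable_is (dg x))).
  split; first by move=> x; have [] := D x.
  have -> : derive1 (fun x => f x * g x) = (fun x => f x * derive1 g x + g x * derive1 f x).
    by apply/funext => x; exact: derive1_is.
  by apply: SA_add; exact: SA_mul.
Qed.

Lemma smooth_algP f : smooth_alg f -> smooth f.
Proof.
move=> sf n; rewrite /iter_deriv; have : smooth_alg (iter n (fun g => derive1 g) f).
  by elim: n => //= n IH; have [] := smooth_alg_derive IH.
by move=> /smooth_alg_derive[].
Qed.

Lemma smoothM (f g : R -> R) : smooth f -> smooth g -> smooth (fun x => f x * g x).
Proof. by move=> sf sg; apply: smooth_algP; apply: SA_mul; exact: SA_base. Qed.

Lemma smoothD (f g : R -> R) : smooth f -> smooth g -> smooth (fun x => f x + g x).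
Proof. by move=> sf sg; apply: smooth_algP; apply: SA_add; exact: SA_base. Qed.

Lemma smooth_primitive (W w : R -> R) : (forall x : R, is_derive x 1 W (w x)) -> smooth w -> smooth W.
Proof.
move=> D sw [|n] x; first by have [] := D x.
have E : derive1 W = w by apply/funext => z; exact: derive1_is.
rewrite /iter_deriv iterSr E; exact: sw.
Qed.

Lemma smooth_cst (c : R) : smooth (fun _ : R => c).
Proof.
have D (k x : R) : is_derive x 1 (fun _ : R => k) 0 by exact: is_derive_cst.
move=> n; rewrite /iter_deriv; have [k ->] : exists k, iter n (fun g : R -> R => derive1 g) (fun _ => c) = (fun _ => k).
  elim: n => [|n [k IH]] /=; first by exists c.
  by exists 0; rewrite IH; apply/funext => x; exact: derive1_is.
by move=> x; have [] := D k x.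
Qed.

(** The two-variable analogue. Profiles of affine functions of [(t, x)] and their sums and products
    are all that the uniqueness argument tests with, and both partial derivatives stay in the
    class. *)
Inductive smooth2_alg : (R -> R -> R) -> Prop :=
| S2_affine p (al be ga : R) : smooth p -> smooth2_alg (fun t x => p (al * x + be * t + ga))
| S2_add f g : smooth2_alg f -> smooth2_alg g -> smooth2_alg (fun t x => f t x + g t x)
| S2_mul f g : smooth2_alg f -> smooth2_alg g -> smooth2_alg (fun t x => f t x * g t x).

Lemma S2_cst (c : R) : smooth2_alg (fun _ _ => c).
Proof. by have := @S2_affine (fun=> c) 0 0 0 (smooth_cst (c:=c)). Qed.

Lemma affine_dt (p : R -> R) (al be ga t x : R) : smooth p ->
  is_derive t 1 (fun s => p (al * x + be * s + ga)) (be * derive1 p (al * x + be * t + ga)).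
Proof.
move=> sp.
have D1 : is_derive t 1 (fun s => al * x + be * s + ga) be.
  by apply: is_derive_eq; rewrite /GRing.scale/=; ring.
have D := @is_derive1_comp _ p (fun s => al * x + be * s + ga) t _ _ (derivable_is (smooth_derivable (x:=al * x + be * t + ga) sp)) D1.
by apply: (is_derive_eq D); rewrite mulrC.
Qed.

Lemma affine_dx (p : R -> R) (al be ga t x : R) : smooth p ->
  is_derive x 1 (fun z => p (al * z + be * t + ga)) (al * derive1 p (al * x + be * t + ga)).
Proof.
move=> sp.
have D1 : is_derive x 1 (fun z => al * z + be * t + ga) al.
  by apply: is_derive_eq; rewrite /GRing.scale/=; ring.
have D := @is_derive1_comp _ p (fun z => al * z + be * t + ga) x _ _ (derivable_is (smooth_derivable (x:=al * x + be * t + ga) sp)) D1.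
by apply: (is_derive_eq D); rewrite mulrC.
Qed.

Lemma smooth2_alg_derive f : smooth2_alg f ->
  [/\ (forall t x, derivable (fun s => f s x) t 1 /\ derivable (f t) x 1),
      continuous (fun p : R * R => f p.1 p.2),
      smooth2_alg (dt f) & smooth2_alg (dx f)].
Proof.
elim=> {f} [p al be ga sp|f g sf [df cf dtf dxf] sg [dg cg dtg dxg]|f g sf [df cf dtf dxf] sg [dg cg dtg dxg]].
- split.
  + by move=> t x; split; [have [] := affine_dt al be ga t x sp|have [] := affine_dx al be ga t x sp].
  + move=> q; apply: (@continuous_comp _ _ _ (fun q : R * R => al * q.2 + be * q.1 + ga) p); last exact: smooth_continuous.
    apply: cvgD; last exact: cvg_cst.
    by apply: cvgD; apply: cvgM; [exact: cvg_cst|exact: cvg_snd|exact: cvg_cst|exact: cvg_fst].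
  + have -> : dt (fun t x => p (al * x + be * t + ga)) = (fun t x => be * derive1 p (al * x + be * t + ga)).
      by apply/funext => t; apply/funext => x; apply: derive1_is; exact: affine_dt.
    by apply: (S2_mul (S2_cst be)); apply: S2_affine; exact: smooth_deriv.
  + have -> : dx (fun t x => p (al * x + be * t + ga)) = (fun t x => al * derive1 p (al * x + be * t + ga)).
      by apply/funext => t; apply/funext => x; apply: derive1_is; exact: affine_dx.
    by apply: (S2_mul (S2_cst al)); apply: S2_affine; exact: smooth_deriv.
- have Dt (t x : R) : is_derive t 1 (fun s => f s x + g s x) (dt f t x + dt g t x).
    exact: (is_deriveD (derivable_is (df t x).1) (derivable_is (dg t x).1)).
  have Dx (t x : R) : is_derive x 1 (fun z => f t z + g t z) (dx f t x + dx g t x).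
    exact: (is_deriveD (derivable_is (df t x).2) (derivable_is (dg t x).2)).
  split.
  + by move=> t x; split; [have [] := Dt t x|have [] := Dx t x].
  + by move=> q; apply: cvgD; [exact: cf|exact: cg].
  + have -> : dt (fun t x => f t x + g t x) = (fun t x => dt f t x + dt g t x).
      by apply/funext => t; apply/funext => x; exact: derive1_is.
    exact: S2_add.
  + have -> : dx (fun t x => f t x + g t x) = (fun t x => dx f t x + dx g t x).
      by apply/funext => t; apply/funext => x; exact: derive1_is.
    exact: S2_add.
- have Dt (t x : R) : is_derive t 1 (fun s => f s x * g s x) (f t x * dt g t x + g t x * dt f t x).
    exact: (is_deriveM (derivable_is (df t x).1) (derivable_is (dg t x).1)).
  have Dx (t x : R) : is_derive x 1 (fun z => f t z * g t z) (f t x * dx g t x + g t x * dx f t x).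
    exact: (is_deriveM (derivable_is (df t x).2) (derivable_is (dg t x).2)).
  split.
  + by move=> t x; split; [have [] := Dt t x|have [] := Dx t x].
  + by move=> q; apply: cvgM; [exact: cf|exact: cg].
  + have -> : dt (fun t x => f t x * g t x) = (fun t x => f t x * dt g t x + g t x * dt f t x).
      by apply/funext => t; apply/funext => x; exact: derive1_is.
    by apply: S2_add; exact: S2_mul.
  + have -> : dx (fun t x => f t x * g t x) = (fun t x => f t x * dx g t x + g t x * dx f t x).
      by apply/funext => t; apply/funext => x; exact: derive1_is.
    by apply: S2_add; exact: S2_mul.
Qed.

Lemma smooth2_algP f : smooth2_alg f -> smooth2 f.
Proof.
move=> sf s; have : smooth2_alg (foldr pderiv f s).
  by elim: s => //= -[] s IH; have [] := smooth2_alg_derive IH.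
by move=> /smooth2_alg_derive[].
Qed.

Lemma bprim_derive (w W : R -> R) : bprim w W -> continuous w -> forall x : R, is_derive x 1 W (w x).
Proof.
move=> [mw [C hC] WE] cw x.
have iw a b : leb.-integrable `]a, b] (EFin \o w) by exact: oc_integrable hC.
apply: is_derive_quot; apply/cvgrPdist_le => e e0.
have /cvgrPdist_le/(_ _ e0) := cw x.
rewrite near_nbhs => /nbhs_ballP[d /= d0 Hd].
near=> k.
have k0 : k != 0 by near: k; exact: nbhs_dnbhs_neq.
have kd : `|k| < d by near: k; exact: dnbhs0_lt.
have key a b : a <= b -> (forall z, a < z <= b -> `|x - z| < d) -> `|w x * (b - a) - (W b - W a)| <= e * (b - a).
  move=> ab Hz; rewrite WE// -(Rint_oc_cst (w x) ab) -RintegralB//; last first.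
    by apply: (@oc_integrable _ _ `|w x|) => // z.
  apply: (@Rint_oc_bound _ _ (`|w x| + C)) => //.
  - by apply: measurable_funB.
  - by move=> z; rewrite (le_trans (ler_normB _ _))// lerD.
  - by move=> z /Hz zd; apply: Hd; exact: zd.
rewrite -(@ler_pM2l _ `|k|) ?normr_gt0// -normrM mulrBr mulVKf//.
have [k1|k1] := leP 0 k.
  rewrite (ger0_norm k1) in kd *; have := key x (k + x); rewrite addrK mulrC [e * _]mulrC; apply.
    by rewrite lerDr.
  by move=> z /andP[z1 z2]; rewrite ltr_norml; apply/andP; split; lra.
rewrite (ltr0_norm k1) in kd *; have := key (k + x) x.
rewrite (_ : x - (k + x) = - k); last by ring.
have -> : k * w x - (W (k + x) - W x) = - (w x * - k - (W x - W (k + x))) by ring.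
rewrite normrN [e * _]mulrC; apply; first by rewrite gerDr ltW.
by move=> z /andP[z1 z2]; rewrite ltr_norml; apply/andP; split; lra.
Unshelve. all: by end_near. Qed.

Definition smooth_step (b : R -> R) := [/\ smooth b, (forall x, x <= -1 -> b x = 0),
  (forall x, 1 <= x -> b x = 1), (forall x, 0 <= derive1 b x) & {homo b : x y / x <= y}].

(** The given partition already supplies a bump: [pp * pm] is smooth, nonnegative and zero outside
    []-1, 1[]. Its normalised primitive is the step. *)
Lemma smooth_step_exists (pp pm : R -> R) : partition_of_unity pp pm -> exists b, smooth_step b.
Proof.
move=> PU; pose k x := pp x * pm x.
have sk : smooth k by apply: smoothM; [exact: PU_pp PU|exact: PU_pm PU].
have ck := smooth_continuous sk.
have k0 x : 0 <= k x.
  by have /andP[? _] := PU_pp01 PU x; have /andP[? _] := PU_pm01 PU x; exact: mulr_ge0.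
have k1 x : `|k x| <= 1.
  have /andP[? ?] := PU_pp01 PU x; have /andP[? ?] := PU_pm01 PU x.
  by rewrite ger0_norm// /k -[leRHS]mulr1 ler_pM.
have [W pW] : exists W, bprim k W.
  by apply: bprim_exists; [exact: continuous_measurable_fun|exists 1].
have DW := bprim_derive pW ck; have [mk _ WE] := pW.
have Wnd : {homo W : x y / x <= y}.
  by move=> x y xy; rewrite -subr_ge0 WE//; apply: Rintegral_ge0.
have W0 x : x <= -1 -> W x = W (-1).
  move=> x1; apply/eqP; rewrite eq_sym -subr_eq0 WE//; apply/eqP.
  rewrite (@eq_Rintegral _ _ _ _ _ (fun=> 0)) ?Rint_oc_cst ?mul0r// => z.
  by rewrite inE/= in_itv/= => /andP[_ z1]; rewrite /k (PU_pp0 PU z1) mul0r.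
have W1 x : 1 <= x -> W x = W 1.
  move=> x1; apply/eqP; rewrite -subr_eq0 WE//; apply/eqP.
  rewrite (@eq_Rintegral _ _ _ _ _ (fun=> 0)) ?Rint_oc_cst ?mul0r// => z.
  by rewrite inE/= in_itv/= => /andP[/ltW z1 _]; rewrite /k (PU_pm0 PU z1) mulr0.
have m11 : (-1 : R) <= 1 by lra.
(* The primitive really rises: [pp] takes the value 1/2 somewhere, where the product is 1/4, whereas
   equal end values would make [W] constant on the interval. *)
have Wlt : W (-1) < W 1.
  rewrite lt_neqAle Wnd// andbT; apply/negP => /eqP EW.
  have [x x11 xE] : exists2 x, x \in `[-1, 1] & pp x = 2^-1.
    apply: (@IVT R pp (-1) 1 2^-1 m11).
      by apply: continuous_subspaceT; apply: smooth_continuous; exact: PU_pp PU.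
    rewrite (PU_pp0 PU (lexx _)) (PU_pp1 PU (lexx _)) min_l// max_r//; lra.
  move: x11; rewrite in_itv/= => /andP[x1 x2].
  have xk : k x = 4^-1.
    have := PU_sum PU x; rewrite /k xE => E; have -> : pm x = 2^-1 by lra.
    by field.
  have x1' : -1 < x.
    rewrite lt_neqAle x1 andbT; apply/negP => /eqP E; move: xE; rewrite -E (PU_pp0 PU (lexx _)).
    by move=> /eqP; rewrite eq_sym invr_eq0; apply/negP.
  have x2' : x < 1.
    rewrite lt_neqAle x2 andbT; apply/negP => /eqP E; move: xE; rewrite E (PU_pp1 PU (lexx _)) => E1.
    have : (1 : R) = 2^-1 by []; lra.
  have : derive1 W x = 0.
    apply: (@derive1_near_cst _ _ _ (W 1)); near=> z.
    have z1 : -1 <= z by apply: ltW; near: z; exact: lt_nbhsr.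
    have z2 : z <= 1 by apply: ltW; near: z; exact: lt_nbhsl.
    by apply/eqP; rewrite eq_le Wnd//= -EW Wnd.
  rewrite (derive1_is (DW x)) xk => /eqP; rewrite invr_eq0; exact/negP.
pose c := W 1 - W (-1).
have c0 : 0 < c by rewrite subr_gt0.
pose b x := (W x - W (-1)) / c.
have Db (x : R) : is_derive x 1 b (k x / c).
  have D1 := is_deriveB (DW x) (is_derive_cst (W (-1)) x 1).
  have D := is_deriveM D1 (is_derive_cst c^-1 x 1).
  by apply: (is_derive_eq D); rewrite scaler0 add0r subr0 /GRing.scale/= mulrC.
exists b; split.
- by apply: (smooth_primitive Db); exact: (smoothM sk (smooth_cst (c := c^-1))).
- by move=> x /W0 Wx; rewrite /b Wx subrr mul0r.
- by move=> x /W1 Wx; rewrite /b Wx divff// gt_eqF.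
- by move=> x; rewrite (derive1_is (Db x)) divr_ge0// ltW.
- by move=> x y xy; rewrite /b ler_pM2r ?invr_gt0// lerB// Wnd.
Unshelve. all: by end_near. Qed.

End SmoothFunctions.

(** * Time localisation *)

Section Bump.
Context {R : realType}.
Local Notation leb := (@lebesgue_measure R).
Local Notation T := (measurableTypeR R).

Lemma bprim_of_derive (F f : R -> R) : (forall x : R, is_derive x 1 F (f x)) -> continuous f ->
  (exists C, forall x, `|f x| <= C) -> bprim f F.
Proof.
move=> DF cf bf; have mf := continuous_measurable_fun cf.
have [W pW] := bprim_exists mf bf.
have [_ _ WE] := pW; split => // x y xy; rewrite -WE//.
have E : W x - F x = W y - F y.
  apply: (@is_derive_0_is_cst _ (fun z => W z - F z)) => z.
  apply: (is_derive_eq (is_deriveB (bprim_derive pW cf z) (DF z))).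
  by rewrite subrr.
lra.
Qed.

Lemma cont_oc_integrable (f : R -> R) a b : continuous f -> leb.-integrable `]a, b] (EFin \o f).
Proof.
move=> cf; apply: (@integrableS _ _ _ leb `[a, b]%classic) => //.
- by move=> x /=; rewrite !in_itv/= => /andP[/ltW -> ->].
- apply: continuous_compact_integrable; first exact: segment_compact.
  exact: continuous_subspaceT.
Qed.

Lemma Rint_support (D : set R) (f : R -> R) : (forall x, ~ D x -> f x = 0) ->
  \int[leb]_(x in D) f x = \int[leb]_x f x.
Proof.
move=> Df; rewrite Rintegral_mkcond; apply: eq_Rintegral => x _; rewrite patchE.
by case: ifPn => // /negP; rewrite inE => /Df.
Qed.

Variable b : R -> R.
Hypothesis sb : smooth_step b.

(** A Heaviside function smoothed at scale [k], followed by its first derivative, an approximate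
    identity, and its second derivative, of size [k^-2]. *)
Definition ramp (k c x : R) := b (k^-1 * (x - c)).
Definition bump (k c x : R) := k^-1 * derive1 b (k^-1 * (x - c)).
Definition dbump (k c x : R) := k^-1 * (k^-1 * derive1 (derive1 b) (k^-1 * (x - c))).

Let b1 : smooth b. Proof. by case: sb. Qed.

Lemma step_derive1_supp x : 1 < `|x| -> derive1 b x = 0.
Proof.
have [_ bl br _ _] := sb; rewrite lter_normr => /orP[x1|x1].
  apply: (@derive1_near_cst _ _ _ 1); near=> z; apply: br; apply: ltW.
  by near: z; exact: lt_nbhsr.
apply: (@derive1_near_cst _ _ _ 0); near=> z; apply: bl; apply: ltW.
by near: z; apply: lt_nbhsl; lra.
Unshelve. all: by end_near. Qed.

Lemma step_derive2_supp x : 1 < `|x| -> derive1 (derive1 b) x = 0.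
Proof.
move=> x1; apply: (@derive1_near_cst _ _ _ 0); near=> z; apply: step_derive1_supp.
near: z; have : (fun z => `|z|) @ x --> `|x| by apply: cvg_norm.
by move=> /(_ [set y | 1 < y]); apply; exact: lt_nbhsr.
Unshelve. all: by end_near. Qed.

Lemma supp_bounded (f : R -> R) : continuous f -> (forall x, 1 < `|x| -> f x = 0) ->
  exists2 C, 0 <= C & forall x, `|f x| <= C.
Proof.
move=> cf f0; have m11 : (-1 : R) <= 1 by lra.
have cn : {within `[-1, 1], continuous (fun x => `|f x|)}.
  by apply: continuous_subspaceT => x; apply: cvg_norm; exact: cf.
have [c c1 Hc] := EVT_max m11 cn.
exists `|f c| => // x; have [x1|x1] := leP `|x| 1.
  by apply: Hc; rewrite in_itv/= -ler_norml.
by rewrite f0// normr0.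
Qed.

Lemma step_derive1_bounded : exists2 C, 0 <= C & forall x, `|derive1 b x| <= C.
Proof.
apply: supp_bounded; last exact: step_derive1_supp.
exact: smooth_continuous (smooth_deriv b1).
Qed.

Lemma step_derive2_bounded : exists2 C, 0 <= C & forall x, `|derive1 (derive1 b) x| <= C.
Proof.
apply: supp_bounded; last exact: step_derive2_supp.
exact: smooth_continuous (smooth_deriv (smooth_deriv b1)).
Qed.

Lemma step01 x : 0 <= b x <= 1.
Proof.
have [_ bl br _ bnd] := sb; have [x1|x1] := leP x (-1); first by rewrite bl// lexx ler01.
have [x2|x2] := leP 1 x; first by rewrite br// lexx ler01.
apply/andP; split; [rewrite -(bl (-1))//|rewrite -(br 1)//]; apply: bnd; exact: ltW.
Qed.

Lemma step_lip : exists2 C, 0 <= C & forall x y, `|b y - b x| <= C * `|y - x|.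
Proof.
have [C C0 HC] := step_derive1_bounded; exists C => // x y.
have p : bprim (derive1 b) b.
  apply: bprim_of_derive; last by exists C.
  - by move=> z; apply: derivable_is; exact: smooth_derivable.
  - exact: smooth_continuous (smooth_deriv b1).
exact: bprim_lip p HC x y.
Qed.

Section Width.
Variables (k : R) (k0 : 0 < k).

Lemma ramp01 c x : 0 <= ramp k c x <= 1. Proof. exact: step01. Qed.

Lemma ramp_lo c x : x <= c - k -> ramp k c x = 0.
Proof.
move=> xc; have [_ bl _ _ _] := sb; apply: bl.
by rewrite mulrC ler_pdivrMr// mulN1r; lra.
Qed.

Lemma ramp_hi c x : c + k <= x -> ramp k c x = 1.
Proof.
move=> xc; have [_ _ br _ _] := sb; apply: br.
by rewrite mulrC ler_pdivlMr// mul1r; lra.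
Qed.

Lemma bump_ge0 c x : 0 <= bump k c x.
Proof. by have [_ _ _ bp _] := sb; rewrite /bump mulr_ge0// invr_ge0 ltW. Qed.

Lemma bump_supp_arg c x : k < `|x - c| -> 1 < `|k^-1 * (x - c)|.
Proof.
by move=> xc; rewrite normrM gtr0_norm ?invr_gt0// mulrC ltr_pdivlMr// mul1r.
Qed.

Lemma bump_supp c x : k < `|x - c| -> bump k c x = 0.
Proof. by move=> /bump_supp_arg xc; rewrite /bump step_derive1_supp// mulr0. Qed.

Lemma dbump_supp c x : k < `|x - c| -> dbump k c x = 0.
Proof. by move=> /bump_supp_arg xc; rewrite /dbump step_derive2_supp// !mulr0. Qed.

Lemma ramp_derive c (x : R) : is_derive x 1 (ramp k c) (bump k c x).
Proof.
have D := @affine_dx _ b k^-1 0 (- (k^-1 * c)) 0 x b1.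
have -> : ramp k c = (fun z => b (k^-1 * z + 0 * 0 + - (k^-1 * c))).
  by apply/funext => z; rewrite /ramp; congr b; ring.
by apply: (is_derive_eq D); rewrite /bump; congr (_ * derive1 b _); ring.
Qed.

Lemma bump_derive c (x : R) : is_derive x 1 (bump k c) (dbump k c x).
Proof.
have D := @affine_dx _ (derive1 b) k^-1 0 (- (k^-1 * c)) 0 x (smooth_deriv b1).
have D2 := is_deriveM (is_derive_cst k^-1 x 1) D.
have -> : bump k c = (cst k^-1 \* (fun z => derive1 b (k^-1 * z + 0 * 0 + - (k^-1 * c))))%R.
  by apply/funext => z; rewrite /bump /=; congr (_ * derive1 b _); ring.
apply: (is_derive_eq D2); rewrite scaler0 addr0 /dbump /GRing.scale/=.
by congr (_ * (_ * derive1 (derive1 b) _)); ring.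
Qed.

Lemma ramp_cont2 (c : R -> R) : continuous c -> continuous (fun p : R * R => ramp k (c p.1) p.2).
Proof.
move=> cc p; apply: (@continuous_comp _ _ _ (fun p : R * R => k^-1 * (p.2 - c p.1)) b).
  apply: cvgM; first exact: cvg_cst.
  apply: cvgB; first exact: cvg_snd.
  by apply: (@continuous_comp _ _ _ (@fst R R) c); [exact: cvg_fst|exact: cc].
exact: smooth_continuous.
Qed.

Lemma bump_cont2 (c : R -> R) : continuous c -> continuous (fun p : R * R => bump k (c p.1) p.2).
Proof.
move=> cc p; apply: cvgM; first exact: cvg_cst.
apply: (@continuous_comp _ _ _ (fun p : R * R => k^-1 * (p.2 - c p.1)) (derive1 b)).
  apply: cvgM; first exact: cvg_cst.
  apply: cvgB; first exact: cvg_snd.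
  by apply: (@continuous_comp _ _ _ (@fst R R) c); [exact: cvg_fst|exact: cc].
exact: smooth_continuous (smooth_deriv b1) _.
Qed.

Lemma dbump_cont2 (c : R -> R) : continuous c -> continuous (fun p : R * R => dbump k (c p.1) p.2).
Proof.
move=> cc p; apply: cvgM; first exact: cvg_cst.
apply: cvgM; first exact: cvg_cst.
apply: (@continuous_comp _ _ _ (fun p : R * R => k^-1 * (p.2 - c p.1)) (derive1 (derive1 b))).
  apply: cvgM; first exact: cvg_cst.
  apply: cvgB; first exact: cvg_snd.
  by apply: (@continuous_comp _ _ _ (@fst R R) c); [exact: cvg_fst|exact: cc].
exact: smooth_continuous (smooth_deriv (smooth_deriv b1)) _.
Qed.

Lemma ramp_cont c : continuous (ramp k c).
Proof. exact: (@slice_continuous _ (fun t => ramp k c) 0 (@ramp_cont2 (fun=> c) (fun=> cvg_cst _))). Qed.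

Lemma bump_cont c : continuous (bump k c).
Proof. exact: (@slice_continuous _ (fun t => bump k c) 0 (@bump_cont2 (fun=> c) (fun=> cvg_cst _))). Qed.

Lemma dbump_cont c : continuous (dbump k c).
Proof. exact: (@slice_continuous _ (fun t => dbump k c) 0 (@dbump_cont2 (fun=> c) (fun=> cvg_cst _))). Qed.

Lemma bump_bounded : exists2 C, 0 <= C & forall c x, `|bump k c x| <= C.
Proof.
have [C C0 HC] := step_derive1_bounded; have ik : 0 <= k^-1 by rewrite invr_ge0 ltW.
exists (k^-1 * C); first exact: mulr_ge0.
by move=> c x; rewrite /bump normrM ger0_norm// ler_wpM2l.
Qed.

Lemma dbump_bounded : exists2 C, 0 <= C & forall c x, `|dbump k c x| <= C.
Proof.
have [C C0 HC] := step_derive2_bounded; have ik : 0 <= k^-1 by rewrite invr_ge0 ltW.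
exists (k^-1 * (k^-1 * C)); first by rewrite !mulr_ge0.
by move=> c x; rewrite /dbump !normrM (ger0_norm ik) !ler_wpM2l.
Qed.

Lemma bump_bprim c : bprim (bump k c) (ramp k c).
Proof.
apply: bprim_of_derive; [exact: ramp_derive|exact: bump_cont|].
by have [C _ HC] := bump_bounded; exists C.
Qed.

Lemma dbump_bprim c : bprim (dbump k c) (bump k c).
Proof.
apply: bprim_of_derive; [exact: bump_derive|exact: dbump_cont|].
by have [C _ HC] := dbump_bounded; exists C.
Qed.

Lemma bump_int c p q : p <= c - k -> c + k <= q -> \int[leb]_(x in `]p, q]) bump k c x = 1.
Proof.
move=> pc cq; have [_ _ WE] := bump_bprim c; have pq : p <= q by have := k0; lra.
by rewrite -(WE _ _ pq) (ramp_lo pc) (ramp_hi cq) subr0.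
Qed.

Lemma bump_avg (g : R -> R) c p q e : continuous g -> p <= c - k -> c + k <= q ->
  (forall x, `|x - c| <= k -> `|g x - g c| <= e) ->
  `|\int[leb]_(x in `]p, q]) (bump k c x * g x) - g c| <= e.
Proof.
move=> cg pc cq ge.
have cbg : continuous (fun x => bump k c x * g x).
  by move=> x; apply: cvgM; [exact: bump_cont|exact: cg].
have cbc (r : R) : continuous (fun x => bump k c x * r).
  by move=> x; apply: cvgM; [exact: bump_cont|exact: cvg_cst].
have cd : continuous (fun x => bump k c x * g x - bump k c x * g c).
  by move=> x; apply: cvgB; [exact: cbg|exact: cbc].
have E r : \int[leb]_(x in `]p, q]) (bump k c x * r) = r.
  rewrite RintegralZr//; last exact: cont_oc_integrable (@bump_cont c).
  by rewrite bump_int// mul1r.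
have -> : \int[leb]_(x in `]p, q]) (bump k c x * g x) - g c =
    \int[leb]_(x in `]p, q]) (bump k c x * g x - bump k c x * g c).
  by rewrite RintegralB ?E//; exact: cont_oc_integrable.
apply: le_trans (_ : \int[leb]_(x in `]p, q]) (bump k c x * e) <= _); last by rewrite E.
apply: le_trans.
  by apply: le_normr_Rintegral => //; exact: cont_oc_integrable.
apply: le_Rintegral => //.
- apply: cont_oc_integrable => x; apply: cvg_norm; exact: cd.
- exact: cont_oc_integrable.
move=> x _; rewrite -mulrBr normrM ger0_norm ?bump_ge0//.
have [xc|xc] := leP `|x - c| k; first by rewrite ler_wpM2l ?bump_ge0// ge.
by rewrite bump_supp// !mul0r.
Qed.

End Width.

Lemma halfline_Rint (f : R -> R) K : 0 <= K -> continuous f -> (forall t, K < t -> f t = 0) ->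
  (\int[leb]_(t in [set t : R | (0 <= t)%R]) (f t)%:E = (\int[leb]_(t in `]0%R, K]) f t)%:E)%E.
Proof.
move=> K0 cf fK.
have i1 := cont_oc_integrable 0 K cf.
have i2 : leb.-integrable `[0, K] (EFin \o f).
  apply: continuous_compact_integrable; first exact: segment_compact.
  exact: continuous_subspaceT.
rewrite Rintegral_itv_obnd_cbnd// /Rintegral fineK; last exact: integrable_fin_num.
rewrite [LHS]integral_mkcond [RHS]integral_mkcond; apply: eq_integral => x _.
rewrite !patchE.
have -> : (x \in `[0, K]%classic) = (0 <= x <= K) by rewrite mem_setE in_itv.
have -> : (x \in [set t : R | (0 <= t)%R]) = (0 <= x) by apply/idP/idP; rewrite inE.
by case: ifPn => //= x0; have [//|/fK ->] := leP x K.
Qed.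

(* A cutoff equal to 1 at time 0 and dropping to 0 near t2 turns the weak formulation
   into [avg (I - W) = I 0 - W 0] for a primitive W of J. *)
Lemma time_localise (I J : R -> R) : continuous I -> continuous J ->
  (forall a : R -> R, smooth a -> (exists K, forall t, K < `|t| -> a t = 0) -> a 0 = 1 ->
    (\int[leb]_(t in [set t : R | (0 <= t)%R]) (derive1 a t * I t + a t * J t)%:E = (- I 0)%:E)%E) ->
  forall t, 0 <= t -> I t - I 0 = \int[leb]_(s in `]0, t]) J s.
Proof.
move=> cI cJ H t2; rewrite le_eqVlt => /predU1P[<-|t20]; first by rewrite Rint_oc0 subrr.
(* Primitives are available for bounded functions, so [J] is clamped in time to [[0, t2 + 1]]; at
   positive times the cutoff vanishes before the clamp matters. *)
pose cl s := Num.min (Num.max s 0) (t2 + 1).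
have ccl : continuous cl.
  move=> s; apply: (@continuous_min _ _ (fun s : R => Num.max s 0) (fun=> t2 + 1)); last exact: cvg_cst.
  by apply: (@continuous_max _ _ id (fun=> 0)); [exact: cvg_id|exact: cvg_cst].
have clE s : 0 <= s -> s <= t2 + 1 -> cl s = s.
  by move=> s0 s1; rewrite /cl max_l// min_l.
have clI s : 0 <= cl s <= t2 + 1.
  by rewrite /cl le_min ge_min le_max lexx orbT/= lexx orbT andbT; lra.
pose J2 s := J (cl s).
have cJ2 : continuous J2 by move=> s; apply: (@continuous_comp _ _ _ cl J); [exact: ccl|exact: cJ].
have bJ2 : exists C, forall s, `|J2 s| <= C.
  have t21 : 0 <= t2 + 1 by lra.
  have cn : {within `[0, t2 + 1], continuous (fun x => `|J x|)}.
    by apply: continuous_subspaceT => x; apply: cvg_norm; exact: cJ.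
  have [c c1 Hc] := EVT_max t21 cn.
  by exists `|J c| => s; apply: Hc; rewrite in_itv/=; exact: clI.
have [W pW] := bprim_exists (continuous_measurable_fun cJ2) bJ2.
have DW := bprim_derive pW cJ2; have cW := bprim_continuous pW.
pose g s := I s - W s.
have cg : continuous g by move=> s; apply: cvgB; [exact: cI|exact: cW].
suff gE : g t2 = g 0.
  have [_ _ WE] := pW; move: gE; rewrite /g => gE.
  have -> : I t2 - I 0 = W t2 - W 0 by lra.
  rewrite WE; last exact: ltW.
  apply: eq_Rintegral => s; rewrite inE/= in_itv/= => /andP[s0 s1].
  by rewrite /J2 clE ?ltW//; lra.
apply/eqP; rewrite -subr_eq0 -normr_le0; apply/ler_addgt0Pl => e e0; rewrite addr0.
have /cvgrPdist_le/(_ _ e0) := cg t2.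
rewrite near_nbhs => /nbhs_ballP[d /= d0 Hd].
pose k := Num.min (d / 2) (Num.min (t2 / 2) 1).
have k0 : 0 < k by rewrite /k !lt_min ltr01 !divr_gt0.
have kd : k < d by rewrite /k gt_min; apply/orP; left; lra.
have kt : k < t2 by rewrite /k !gt_min; apply/orP; right; apply/orP; left; lra.
have k1 : k <= 1 by rewrite /k !ge_min lexx !orbT.
(* The first ramp has reached 1 before time 0 and only serves to make the support compact; the
   second switches the cutoff off between [t2 - k] and [t2 + k]. *)
pose a s := ramp 1 (-2) s - ramp k t2 s.
have Da (s : R) : is_derive s 1 a (bump 1 (-2) s - bump k t2 s).
  exact: is_deriveB (ramp_derive 1 (-2) s) (ramp_derive k t2 s).
have sa : smooth a.
  have aff (k' c : R) : smooth (ramp k' c).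
    have : smooth2 (fun t x : R => b (k'^-1 * x + 0 * t + - (k'^-1 * c))).
      by apply: smooth2_algP; exact: S2_affine.
    move=> s2 n x.
    have -> : iter_deriv n (ramp k' c) = foldr pderiv (fun t x : R => b (k'^-1 * x + 0 * t + - (k'^-1 * c))) (nseq n false) 0.
      rewrite /iter_deriv; elim: n {x} => [|n IH] /=.
        by apply/funext => x; rewrite /ramp; congr b; ring.
      by rewrite IH.
    by have [/(_ 0 x)[_ +] _] := s2 (nseq n false).
  have -> : a = (fun s => ramp 1 (-2) s + (-1) * ramp k t2 s).
    by apply/funext => s; rewrite /a mulN1r.
  apply: smoothD; first exact: aff.
  by apply: smoothM; [exact: smooth_cst|exact: aff].
have aK s : t2 + k < s -> a s = 0.
  by move=> s1; rewrite /a !ramp_hi ?subrr//; lra.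
have aS s : t2 + 3 < `|s| -> a s = 0.
  rewrite lter_normr => /orP[s1|s1]; first by apply: aK; lra.
  by rewrite /a !ramp_lo ?subrr//; lra.
have a0 : a 0 = 1 by rewrite /a ramp_hi ?ramp_lo ?subr0//; lra.
have H1 := H _ sa (ex_intro _ _ aS) a0.
have dE s : derive1 a s = bump 1 (-2) s - bump k t2 s by exact: derive1_is.
have cda : continuous (derive1 a) by exact: smooth_continuous (smooth_deriv sa).
have ca : continuous a by exact: smooth_continuous.
have daK s : t2 + k < s -> derive1 a s = 0.
  move=> s1; rewrite dE !bump_supp ?subrr//; [rewrite gtr0_norm|rewrite gtr0_norm]; lra.
have tk0 : 0 <= t2 + k by lra.
have H2 : (\int[leb]_(t in [set t : R | (0 <= t)%R]) (derive1 a t * W t + a t * J2 t)%:E = (- W 0)%:E)%E.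
  have -> : - W 0 = - (a 0 * W 0) by rewrite a0 mul1r.
  apply: (@halfline_FTC _ (fun t => a t * W t) _ (t2 + k)).
  - move=> t; apply: (is_derive_eq (is_deriveM (derivable_is (smooth_derivable (x:=t) sa)) (DW t))).
    by rewrite /GRing.scale/= addrC [W t * _]mulrC.
  - move=> t; apply: cvgD; apply: cvgM; [exact: cda|exact: cW|exact: ca|exact: cJ2].
  - by move=> t /aK ->; rewrite mul0r.
  - by move=> t tk; rewrite aK// daK// !mul0r addr0.
have c1 : continuous (fun t => derive1 a t * I t + a t * J t).
  by move=> t; apply: cvgD; apply: cvgM; [exact: cda|exact: cI|exact: ca|exact: cJ].
have c2 : continuous (fun t => derive1 a t * W t + a t * J2 t).
  by move=> t; apply: cvgD; apply: cvgM; [exact: cda|exact: cW|exact: ca|exact: cJ2].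
move: H1; rewrite (halfline_Rint tk0 c1); last by move=> t tk; rewrite aK// daK// !mul0r addr0.
move: H2; rewrite (halfline_Rint tk0 c2); last by move=> t tk; rewrite aK// daK// !mul0r addr0.
move=> [H2] [H1].
(* The exact identity for [W] minus the hypothesis for [I]: the terms in [J] cancel, and at positive
   times [derive1 a] is minus the bump at [t2]. *)
have H3 : \int[leb]_(t in `]0, (t2 + k)]) (bump k t2 t * g t) = g 0.
  have -> : g 0 = \int[leb]_(t in `]0, (t2 + k)]) (derive1 a t * W t + a t * J2 t) -
      \int[leb]_(t in `]0, (t2 + k)]) (derive1 a t * I t + a t * J t).
    by rewrite H2 H1 /g; ring.
  rewrite -RintegralB//; [|exact: cont_oc_integrable..].
  apply: eq_Rintegral => s; rewrite inE/= in_itv/= => /andP[s0 s1].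
  have -> : J2 s = J s by rewrite /J2 clE//; [exact: ltW|lra].
  rewrite dE (@bump_supp 1 ltr01 (-2) s); last by rewrite gtr0_norm; lra.
  by rewrite /g; ring.
rewrite distrC -{1}H3; apply: bump_avg => //; first lra.
move=> x xt; rewrite distrC; apply: Hd; rewrite /ball/= distrC; exact: le_lt_trans xt kd.
Qed.

End Bump.

(** * Integrals depending on time *)

Section ParametricIntegrals.
Context {R : realType}.
Local Notation leb := (@lebesgue_measure R).
Local Notation T := (measurableTypeR R).
Local Notation fmeasure := {finite_measure set T -> \bar R}.

Definition locally_supported (f : R -> R -> R) :=
  forall s0 : R, exists K : R, \forall s \near s0, forall x, K < `|x| -> f s x = 0.

Lemma cont_supp_bounded (f : R -> R) K : continuous f -> (forall x, K < `|x| -> f x = 0) ->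
  exists2 C, 0 <= C & forall x, `|f x| <= C.
Proof.
move=> cf f0; have m11 : - `|K| <= `|K| by have := normr_ge0 K; lra.
have cn : {within `[- `|K|, `|K|], continuous (fun x => `|f x|)}.
  by apply: continuous_subspaceT => x; apply: cvg_norm; exact: cf.
have [c c1 Hc] := EVT_max m11 cn.
exists `|f c| => // x; have [x1|x1] := leP `|x| `|K|.
  by apply: Hc; rewrite in_itv/= -ler_norml.
by rewrite f0 ?normr0// (le_lt_trans (ler_norm _) x1).
Qed.

Lemma cont_supp_integrable (f : R -> R) K : continuous f -> (forall x, K < `|x| -> f x = 0) ->
  leb.-integrable setT (EFin \o f).
Proof.
move=> cf f0; have [C _ HC] := cont_supp_bounded cf f0.
apply: (@compact_bounded_integrable _ f C `|K|) => //; first exact: continuous_measurable_fun.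
by move=> x xK; apply: f0; exact: le_lt_trans (ler_norm _) xK.
Qed.

Lemma Rint_symm (f : R -> R) K : 0 <= K -> (forall x, K < `|x| -> f x = 0) ->
  \int[leb]_x f x = \int[leb]_(x in `](- (K + 1)), (K + 1)]) f x.
Proof.
move=> K0 f0; rewrite -(@Rint_support _ `](- (K + 1)), (K + 1)]%classic f)// => x /=.
rewrite in_itv/= => /negP xK; apply: f0; rewrite ltNge; apply: contra xK.
by rewrite ler_norml => /andP[? ?]; apply/andP; split; lra.
Qed.

Lemma fm_integrable (m : fmeasure) (f : R -> R) C : measurable_fun setT f -> (forall x, `|f x| <= C) ->
  m.-integrable setT (EFin \o f).
Proof.
move=> mf fC; apply: (bounded_integrable (C := C)) => //.
by have := fin_num_measure m _ (measurableT : measurable [set: T]); rewrite ge0_fin_numE.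
Qed.

Lemma fm_Rint_bound (m : fmeasure) (f : R -> R) C : measurable_fun setT f -> (forall x, `|f x| <= C) ->
  `|\int[m]_x f x| <= C * fine (m setT).
Proof.
move=> mf fC.
have cC : m.-integrable setT (EFin \o (fun=> C)).
  by apply: (@fm_integrable _ _ `|C|).
have nf : m.-integrable setT (EFin \o (fun x => `|f x|)).
  apply: (@fm_integrable _ _ C); first exact: (measurableT_comp _ mf).
  by move=> x; rewrite normr_id.
apply: le_trans; first by apply: le_normr_Rintegral => //; exact: fm_integrable fC.
apply: le_trans; first by apply: (@le_Rintegral _ _ _ m setT (fun x => `|f x|) (fun=> C)).
by rewrite Rintegral_cst.
Qed.

Lemma compact_uniform (f : R -> R -> R) K s0 : continuous (fun p : R * R => f p.1 p.2) ->
  (\forall s \near s0, forall x, K < `|x| -> f s x = 0) ->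
  forall e, 0 < e -> \forall s \near s0, forall x, `|f s x - f s0 x| <= e.
Proof.
move=> cf f0 e e0.
have cpt : near_covering (`[- K, K] : set R) by apply/compact_near_coveringP; exact: segment_compact.
have H : \forall s \near s0, `[- K, K] `<=` [set x | `|f s x - f s0 x| <= e].
  apply: (cpt R (nbhs s0) (fun s x => `|f s x - f s0 x| <= e)) => x _.
  have e2 : 0 < e / 2 by rewrite divr_gt0.
  have /cvgrPdist_le/(_ _ e2) := cf (s0, x).
  move=> [[A B] /= [nA nB] AB].
  exists (B, A) => //= -[z s] /= [Bz As].
  have h1 := AB (s, z) (conj As Bz).
  have h2 := AB (s0, z) (conj (nbhs_singleton nA) Bz).
  move: h1 h2; rewrite /= => h1 h2.
  rewrite (_ : f s z - f s0 z = (f s0 x - f s0 z) - (f s0 x - f s z)); last by ring.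
  by apply: le_trans (ler_normB _ _) _; rewrite [e]splitr lerD.
have f00 := nbhs_singleton f0.
near=> s => x; have [x1|x1] := leP `|x| K.
  have Hs : `[- K, K] `<=` [set x | `|f s x - f s0 x| <= e] by near: s.
  by apply: Hs; rewrite /= in_itv/= -ler_norml.
have -> : f s x = 0 by move: x x1; near: s.
by rewrite f00// subrr normr0 ltW.
Unshelve. all: by end_near. Qed.

(** Integrand and measure vary together. The change of integrand is uniformly small against locally
    bounded mass; the change of measure is felt only by the fixed integrand [f s0]. *)
Lemma cvg_int_measures (m : R -> fmeasure) (f : R -> R -> R) s0 M1 :
  (forall s, continuous (f s)) -> (forall s, exists C, forall x, `|f s x| <= C) ->
  (forall e, 0 < e -> \forall s \near s0, forall x, `|f s x - f s0 x| <= e) ->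
  (\forall s \near s0, fine (m s setT) <= M1) ->
  {for s0, continuous (fun s => \int[m s]_x f s0 x)} ->
  {for s0, continuous (fun s => \int[m s]_x f s x)}.
Proof.
move=> cf bf uf mM cI; apply/cvgrPdist_le => e e0.
have M10 : 0 < `|M1| + 1 by rewrite ltr_pwDr.
have d0 : 0 < e / 2 / (`|M1| + 1) by rewrite !divr_gt0.
have e2 : 0 < e / 2 by rewrite divr_gt0.
have /cvgrPdist_le/(_ _ e2) cI2 := cI.
near=> s.
have u1 : forall x, `|f s x - f s0 x| <= e / 2 / (`|M1| + 1) by near: s; exact: uf.
have mf s' : measurable_fun setT (f s') by exact: continuous_measurable_fun.
have [C1 HC1] := bf s; have [C2 HC2] := bf s0.
have -> : \int[m s0]_x f s0 x - \int[m s]_x f s x =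
    (\int[m s0]_x f s0 x - \int[m s]_x f s0 x) - \int[m s]_x (f s x - f s0 x).
  rewrite RintegralB//; [by ring|exact: fm_integrable HC1|exact: fm_integrable HC2].
apply: le_trans (ler_normB _ _) _; rewrite [e]splitr lerD//; first by near: s.
apply: le_trans.
  apply: (fm_Rint_bound _ _ u1).
  by apply: measurable_funB.
rewrite -[leRHS](@divfK _ (`|M1| + 1)) ?gt_eqF// ler_wpM2l//; first exact: ltW.
have : fine (m s setT) <= M1 by near: s.
by move=> /le_trans; apply; rewrite (le_trans (ler_norm _))// lerDl.
Unshelve. all: by end_near. Qed.

Lemma cont_int_leb (f : R -> R -> R) : continuous (fun p : R * R => f p.1 p.2) ->
  locally_supported f -> continuous (fun s => \int[leb]_x f s x).
Proof.
move=> cf sf s0; have [K0 {}sf] := sf s0.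
pose K := `|K0|.
have {}sf : \forall s \near s0, forall x, K < `|x| -> f s x = 0.
  near=> s => x xK; have : K0 < `|x| by exact: le_lt_trans (ler_norm _) xK.
  by move: x {xK}; near: s.
have K_ge0 : 0 <= K by exact: normr_ge0.
apply/cvgrPdist_le => e e0.
have d0 : 0 < e / (2 * (K + 1)) by rewrite divr_gt0// mulr_gt0// ltr_wpDl.
have uf := compact_uniform cf sf d0.
have sf0 := nbhs_singleton sf.
near=> s.
have u1 : forall x, `|f s x - f s0 x| <= e / (2 * (K + 1)) by near: s.
have sfs : forall x, K < `|x| -> f s x = 0 by near: s.
have cfs s' : continuous (f s') by exact: slice_continuous.
rewrite distrC !(@Rint_symm _ K)// -RintegralB//; [|exact: cont_oc_integrable..].
apply: le_trans.
  apply: (@Rint_oc_bound _ _ (e / (2 * (K + 1))) (e / (2 * (K + 1)))) => //.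
  - by apply: measurable_funB; exact: continuous_measurable_fun.
  - lra.
rewrite (_ : K + 1 - - (K + 1) = 2 * (K + 1)); last by ring.
by rewrite divfK// gt_eqF// mulr_gt0// ltr_wpDl.
Unshelve. all: by end_near. Qed.

Lemma locally_supported_window (f : R -> R -> R) (c : R -> R) k : continuous c ->
  (forall s x, k < `|x - c s| -> f s x = 0) -> locally_supported f.
Proof.
move=> cc fk s0; exists (`|c s0| + 1 + k).
have /cvgrPdist_le/(_ _ ltr01) := cc s0; apply: filterS => s sc x xk; apply: fk.
have h1 := ler_normD (x - c s) (c s - c s0).
have h2 := ler_normD (x - c s + (c s - c s0)) (c s0).
have e1 : x - c s + (c s - c s0) + c s0 = x by ring.
rewrite e1 in h2; rewrite distrC in sc; lra.
Qed.

Variable b : R -> R.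
Hypothesis sb : smooth_step b.

(** Tonelli on [w < x] and on [x < w]: the bump integrates to [1 - ramp] to the right of [w] and to
    [ramp] to its left. The nonlocal source becomes the integral of a continuous function against
    the energy, which weak continuity in time controls. *)
Lemma ramp_int_Q (m : fmeasure) k c : 0 < k ->
  \int[leb]_x ((fine (m `]-oo, x[%classic) - fine (m `]x, +oo[%classic)) * bump b k c x) =
  \int[m]_x (1 - 2 * ramp b k c x).
Proof.
move=> k0.
have bmp0 := bump_ge0 sb k0 c.
have cb := @bump_cont _ _ sb k c.
have mb : measurable_fun [set: T] (bump b k c : T -> T) by exact: continuous_measurable_fun.
have cr := @ramp_cont _ _ sb k c.
have [_ _ WE] := bump_bprim sb k0 c.
have tail w : (\int[leb]_(x in `]w, +oo[) (bump b k c x)%:E = (1 - ramp b k c w)%:E)%E.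
  pose q := Num.max w (c + k).
  transitivity (\int[leb]_(x in `]w, q]) (bump b k c x)%:E)%E.
    rewrite [LHS]integral_mkcond [RHS]integral_mkcond; apply: eq_integral => x _.
    rewrite !patchE !mem_setE /= !in_itv/= andbT; case: ifPn => //= wx.
    have [//|xq] := leP x q; rewrite bump_supp//.
    move: xq; rewrite /q gt_max => /andP[_ xq]; rewrite gtr0_norm; lra.
  rewrite -(@fineK _ (\int[leb]_(x in _) _)%E); last first.
    by apply: integrable_fin_num => //; exact: cont_oc_integrable.
  congr EFin; transitivity (ramp b k c q - ramp b k c w).
    by rewrite WE// /q le_max lexx.
  by rewrite ramp_hi// /q le_max lexx orbT.
have head w : (\int[leb]_(x in `]-oo, w[) (bump b k c x)%:E = (ramp b k c w)%:E)%E.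
  pose q := Num.min w (c - k - 1).
  transitivity (\int[leb]_(x in `]q, w]) (bump b k c x)%:E)%E.
    have -> : (\int[leb]_(x in `]q, w]) (bump b k c x)%:E = \int[leb]_(x in `]q, w[) (bump b k c x)%:E)%E.
      rewrite integral_itv_bndo_bndc//; exact/measurable_EFinP/measurable_funTS.
    rewrite [LHS]integral_mkcond [RHS]integral_mkcond; apply: eq_integral => x _.
    rewrite !patchE !mem_setE /= !in_itv/=; case: ifPn => //= wx; rewrite ?andbF// andbT.
    have [//|xq] := ltP q x; rewrite bump_supp//.
    by move: xq; rewrite /q le_min => /andP[_ xq]; rewrite ltr0_norm; lra.
  rewrite -(@fineK _ (\int[leb]_(x in _) _)%E); last first.
    by apply: integrable_fin_num => //; exact: cont_oc_integrable.
  congr EFin; transitivity (ramp b k c w - ramp b k c q).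
    by rewrite WE// /q ge_min lexx.
  rewrite (@ramp_lo _ _ sb k k0 c q) ?subr0// /q ge_min; apply/orP; right; lra.
have mlt : measurable_fun [set: T * T] (fun p : T * T => ((p.2 : R) < p.1) : bool).
  by apply: measurable_fun_ltr; [exact: measurable_snd|exact: measurable_fst].
have mind (A : set (T * T)) : measurable A -> measurable_fun [set: T * T] (fun p : T * T => (\1_A p * bump b k c p.1)%:E).
  move=> mA; apply/measurable_EFinP; apply: measurable_funM; first exact: measurable_indic.
  exact: (measurableT_comp mb measurable_fst).
have key (A : set (T * T)) : measurable A ->
    (\int[leb]_x ((bump b k c x)%:E * m [set w | A (x, w)]) =
     \int[m]_w (\int[leb]_(x in [set x | A (x, w)]) (bump b k c x)%:E))%E.
  move=> mA.
  have := @fubini_tonelli _ _ T T R leb m (fun p => (\1_A p * bump b k c p.1)%:E) (mind _ mA).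
  move=> /(_ (fun p => _)) F; transitivity (\int[leb]_x \int[m]_y ((\1_A (x, y) * bump b k c x)%:E))%E.
    apply: eq_integral => x _.
    have mAx : measurable [set w : T | A (x, w)] by have := measurable_xsection x mA; rewrite /xsection /=; under eq_set do rewrite inE.
    under [RHS]eq_integral do rewrite EFinM muleC.
    rewrite ge0_integralZl//.
    - congr *%E; rewrite (_ : (fun y => _) = (fun y => (\1_[set w : T | A (x, w)] y)%:E)).
        by rewrite integral_indic// setIT.
      by apply/funext => y; rewrite !indicE; congr ((nat_of_bool _)%:R%:E); apply/idP/idP; rewrite !inE.
    - apply/measurable_EFinP; rewrite (_ : (fun y => _) = \1_[set w : T | A (x, w)]); first exact: measurable_indic.
      by apply/funext => y; rewrite !indicE; congr ((nat_of_bool _)%:R); apply/idP/idP; rewrite !inE.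
    - by rewrite lee_fin; exact: bmp0.
  rewrite F; last by move=> p; rewrite lee_fin mulr_ge0.
  apply: eq_integral => w _; rewrite [RHS]integral_mkcond; apply: eq_integral => x _.
  rewrite patchE indicE (_ : ((x, w) \in A) = (x \in [set x | A (x, w)])); last by apply/idP/idP; rewrite !inE.
  by case: ifPn => _; rewrite ?mul1r ?mul0r.
have mA1 : measurable [set p : T * T | (p.2 : R) < p.1].
  by have := mlt measurableT [set true] I; rewrite setTI /preimage /=; under eq_set do rewrite /=.
have mA2 : measurable [set p : T * T | (p.1 : R) < p.2].
  have : measurable_fun [set: T * T] (fun p : T * T => ((p.1 : R) < p.2) : bool).
    by apply: measurable_fun_ltr; [exact: measurable_fst|exact: measurable_snd].
  by move=> /(_ measurableT [set true] I); rewrite setTI /preimage /=; under eq_set do rewrite /=.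
have K1 := key _ mA1; have K2 := key _ mA2.
pose A x := fine (m `]-oo, x[%classic); pose B x := fine (m `]x, +oo[%classic).
have And : {homo A : x y / x <= y}.
  by move=> x y xy; apply: fine_fm_le => // z /=; rewrite !in_itv/= => /lt_le_trans; exact.
have Bnd : {homo (fun x => - B x) : x y / x <= y}.
  by move=> x y xy; rewrite lerN2; apply: fine_fm_le => // z /=; rewrite !in_itv/= !andbT; exact: le_lt_trans.
have mA : measurable_fun [set: T] (A : T -> T) by exact: nondecreasing_measurable.
have mB : measurable_fun [set: T] (B : T -> T).
  have := nondecreasing_measurable measurableT Bnd.
  by move=> /measurable_funN; congr measurable_fun; apply/funext => x; rewrite /= opprK.
have [C _ HC] := bump_bounded sb k0.
have bI (D : R -> R) : measurable_fun [set: T] (D : T -> T) -> (forall x, 0 <= D x <= fine (m setT)) ->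
    leb.-integrable setT (EFin \o (fun x => D x * bump b k c x)).
  move=> mD D01; apply: (@compact_bounded_integrable _ _ (fine (m setT) * C) (`|c| + k)).
  - by rewrite addr_ge0// ltW.
  - exact: measurable_funM.
  - move=> x; rewrite normrM ler_pM//; have /andP[? ?] := D01 x; rewrite ger0_norm//.
  - move=> x xc; rewrite bump_supp ?mulr0//.
    by have := ler_normD (x - c) c; rewrite subrK; lra.
have A01 x : 0 <= A x <= fine (m setT).
  by apply/andP; split; [exact: fine_fm_ge0|apply: fine_fm_le].
have B01 x : 0 <= B x <= fine (m setT).
  by apply/andP; split; [exact: fine_fm_ge0|apply: fine_fm_le].
have iA := bI _ mA A01; have iB := bI _ mB B01.
have EA : \int[leb]_x (A x * bump b k c x) = \int[m]_x (1 - ramp b k c x).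
  rewrite /Rintegral; congr fine.
  transitivity (\int[leb]_x ((bump b k c x)%:E * m [set w | w < x]%R))%E.
    apply: eq_integral => x _; rewrite mulrC EFinM /A fmE//.
  rewrite K1; apply: eq_integral => w _; rewrite -tail; congr (integral _ _ _).
  by apply/seteqP; split => z /=; rewrite in_itv/= andbT.
have EB : \int[leb]_x (B x * bump b k c x) = \int[m]_x (ramp b k c x).
  rewrite /Rintegral; congr fine.
  transitivity (\int[leb]_x ((bump b k c x)%:E * m [set w | x < w]%R))%E.
    apply: eq_integral => x _; rewrite mulrC EFinM /B fmE//.
    suff -> : [set w : R | x < w] = `]x, +oo[%classic by [].
    by apply/seteqP; split => z /=; rewrite in_itv/= andbT.
  by rewrite K2; apply: eq_integral => w _; rewrite -head.
under eq_Rintegral do rewrite mulrBl.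
rewrite RintegralB// EA EB -RintegralB//.
- by apply: eq_Rintegral => x _; ring.
- apply: (@fm_integrable _ _ 1); first by apply: measurable_funB => //; exact: continuous_measurable_fun.
  by move=> x; have /andP[? ?] := ramp01 sb k c x; rewrite ler_norml; apply/andP; split; lra.
- apply: (@fm_integrable _ _ 1); first exact: continuous_measurable_fun.
  by move=> x; have /andP[? ?] := ramp01 sb k c x; rewrite ger0_norm.
Qed.

End ParametricIntegrals.

(** * Time regularity of weak solutions *)

Section Solution.
Context {R : realType}.
Local Notation leb := (@lebesgue_measure R).
Local Notation T := (measurableTypeR R).
Local Notation fmeasure := {finite_measure set T -> \bar R}.

Lemma cont_Rint_bound (J : R -> R) K t : 0 <= t -> continuous J -> (forall s, 0 < s <= t -> `|J s| <= K) ->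
  `|\int[leb]_(s in `]0, t]) J s| <= K * t.
Proof.
move=> t0 cJ JK; rewrite -[X in K * X]subr0 -Rint_oc_cst//.
apply: le_trans; first by apply: le_normr_Rintegral => //; exact: cont_oc_integrable.
apply: le_Rintegral => //.
- by apply: cont_oc_integrable => s; apply: cvg_norm; exact: cJ.
- by apply: cont_oc_integrable => s; exact: cvg_cst.
Qed.

Lemma Rint_le_measure (m : fmeasure) (f : R -> R) (D : set T) : measurable D -> measurable_fun setT f ->
  (forall x, 0 <= f x <= 1) -> (forall x, ~ D x -> f x = 0) -> \int[m]_x f x <= fine (m D).
Proof.
move=> mD mf f01 fD.
have -> : fine (m D) = \int[m]_x \1_D x by rewrite /Rintegral integral_indic// setIT.
apply: le_Rintegral => //.
- by apply: (@fm_integrable _ _ _ 1) => // x; have /andP[? ?] := f01 x; rewrite ger0_norm.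
- apply: (@fm_integrable _ _ _ 1); first exact: measurable_indic.
  by move=> x; rewrite indicE; case: (_ \in _); rewrite ?normr1// normr0.
- move=> x _; rewrite indicE; have [xD|xD] := boolP (x \in D); first by have /andP[] := f01 x.
  by rewrite fD// => Dx; move/negP: xD; apply; rewrite inE.
Qed.

Lemma measure_le_Rint (m : fmeasure) (f : R -> R) (D : set T) : measurable D -> measurable_fun setT f ->
  (forall x, 0 <= f x <= 1) -> (forall x, D x -> f x = 1) -> fine (m D) <= \int[m]_x f x.
Proof.
move=> mD mf f01 fD.
have -> : fine (m D) = \int[m]_x \1_D x by rewrite /Rintegral integral_indic// setIT.
apply: le_Rintegral => //.
- apply: (@fm_integrable _ _ _ 1); first exact: measurable_indic.
  by move=> x; rewrite indicE; case: (_ \in _); rewrite ?normr1// normr0.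
- by apply: (@fm_integrable _ _ _ 1) => // x; have /andP[? ?] := f01 x; rewrite ger0_norm.
- move=> x _; rewrite indicE; have [xD|xD] := boolP (x \in D); last by have /andP[] := f01 x.
  by rewrite fD//; move: xD; rewrite inE.
Qed.

Variables (pp pm : R -> R) (u : R -> R -> R) (mu : R -> fmeasure).
Hypothesis PU : partition_of_unity pp pm.
Hypothesis hsol : weak_cons_sol pp pm u mu.

(** Solutions are frozen at their initial value for negative times, so that continuity can be stated
    and used on the whole line. *)
Definition uext (s : R) := u (Num.max s 0).
Definition mext (s : R) := mu (Num.max s 0).
Local Notation ub := uext.
Local Notation mb := mext.

Lemma max0_cont : continuous (fun s : R => Num.max s 0).
Proof. by move=> s; apply: (@continuous_max _ _ id (fun=> 0)); [exact: cvg_id|exact: cvg_cst]. Qed.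

Lemma max0_dist (s t : R) : `|Num.max s 0 - Num.max t 0| <= `|s - t|.
Proof.
by have [s0|s0] := leP s 0; have [t0|t0] := leP t 0; rewrite ?subrr ?normr0// ler_normr ?ler_norml; lra.
Qed.

Lemma max0_ge0 (s : R) : 0 <= Num.max s 0. Proof. by rewrite le_max lexx orbT. Qed.

Lemma max0_le (s t : R) : 0 <= t -> s <= t -> Num.max s 0 <= t.
Proof. by move=> t0 st; rewrite ge_max st. Qed.

Lemma uext_cont : continuous (fun p : R * R => ub p.1 p.2).
Proof.
move=> [t0 x0]; pose T0 := `|t0| + 1; have T00 : 0 < T0 by rewrite ltr_wpDl.
have [_ _ /(_ _ T00)[[al [C [/andP[al0 al1] C0 HC]]] _] _ _] := hsol.
apply/cvgrPdist_le => e e0 /=.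
have C1 : 0 < C + 1 by rewrite ltr_wpDl.
have eC : 0 <= e / (C + 1) by rewrite divr_ge0 ?ltW.
(* Inverts the Hoelder modulus, so that [C * d] to the power [al] stays below [e]. *)
pose d := (e / (C + 1)) `^ al^-1.
have d0 : 0 < d by rewrite powR_gt0// divr_gt0.
have dE : d `^ al = e / (C + 1) by rewrite -powRrM mulVf ?gt_eqF// powRr1.
have d2 : 0 < d / 2 by rewrite divr_gt0.
have /cvgrPdist_le/(_ _ d2) n1 : (fun p : R * R => p.1) @ (t0, x0) --> t0 by exact: cvg_fst.
have /cvgrPdist_le/(_ _ d2) n2 : (fun p : R * R => p.2) @ (t0, x0) --> x0 by exact: cvg_snd.
have /cvgrPdist_le/(_ _ ltr01) n3 : (fun p : R * R => p.1) @ (t0, x0) --> t0 by exact: cvg_fst.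
near=> p.
have p1 : `|t0 - p.1| <= d / 2 by near: p.
have p2 : `|x0 - p.2| <= d / 2 by near: p.
have p3 : `|t0 - p.1| <= 1 by near: p.
have b0 : 0 <= Num.max t0 0 <= T0.
  by rewrite max0_ge0/= max0_le ?(ltW T00)// /T0 (le_trans (ler_norm _))// lerDl.
have b1 : 0 <= Num.max p.1 0 <= T0.
  rewrite max0_ge0/= max0_le ?(ltW T00)// /T0; have := ler_norm t0.
  by move: p3; rewrite ler_norml => /andP[? ?]; lra.
apply: (le_trans (HC _ _ _ _ b0 b1)).
apply: (@le_trans _ _ (C * d `^ al)).
  have h1 : `|Num.max t0 0 - Num.max p.1 0| + `|x0 - p.2| <= d.
    by rewrite [leRHS]splitr; apply: lerD => //; apply: le_trans p1; exact: max0_dist.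
  by rewrite ler_wpM2l//; apply: ge0_ler_powR; rewrite ?nnegrE ?addr_ge0//; exact: ltW.
by rewrite dE mulrA ler_pdivrMr// mulrC ler_wpM2l ?(ltW e0)// lerDl.
Unshelve. all: by end_near. Qed.

Lemma uext_slice t : continuous (ub t).
Proof. exact: slice_continuous uext_cont. Qed.

Lemma uext_bound T0 : exists2 B, 0 <= B & forall s x, s <= T0 -> `|ub s x| <= B.
Proof.
pose T1 := `|T0| + 1; have T10 : 0 < T1 by rewrite ltr_wpDl.
have [/(_ 0 (lexx 0))[Hu _ _] _ /(_ _ T10)[[al [C [/andP[al0 al1] C0 HC]]] _] _ _] := hsol.
have [B HB] := E2_bounded PU Hu.
have B0 : 0 <= B by exact: le_trans (normr_ge0 _) (HB 0).
exists (C * T1 `^ al + B); first by rewrite addr_ge0// mulr_ge0// powR_ge0.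
move=> s x sT.
have b1 : 0 <= Num.max s 0 <= T1.
  by rewrite max0_ge0/= max0_le ?(ltW T10)// /T1; have := ler_norm T0; lra.
have b0 : 0 <= (0 : R) <= T1 by rewrite lexx ltW.
have -> : ub s x = (ub s x - u 0 x) + u 0 x by rewrite subrK.
apply: (le_trans (ler_normD _ _)); rewrite lerD//.
apply: (le_trans (HC _ _ _ _ b1 b0)); rewrite ler_wpM2l//.
have h1 : `|Num.max s 0 - 0| + `|x - x| <= T1.
  by rewrite subrr normr0 addr0 subr0 ger0_norm; [case/andP: b1|exact: max0_ge0].
by apply: ge0_ler_powR; rewrite ?nnegrE ?addr_ge0//; exact: ltW.
Qed.

Lemma mext_cont (f : R -> R) : continuous f -> (exists C, forall x, `|f x| <= C) ->
  continuous (fun t => \int[mb t]_x f x).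
Proof.
move=> cf bf s; have [_ _ _ _ /(_ f cf bf)/subspace_continuousP wc] := hsol.
have [C HC] := bf; have mf := continuous_measurable_fun cf.
have fin t : (\int[mu t]_x (f x)%:E)%E \is a fin_num.
  by apply: integrable_fin_num => //; exact: fm_integrable HC.
have cv : (fun t => \int[mu t]_x f x) @ within [set t : R | 0 <= t] (nbhs (Num.max s 0)) -->
    \int[mu (Num.max s 0)]_x f x.
  apply: (@fine_cvg _ _ _ _ (fun t => (\int[mu t]_x (f x)%:E)%E)).
  by rewrite /Rintegral fineK; [exact: (wc _ (max0_ge0 s))|exact: fin].
apply: (@cvg_comp _ _ _ (fun s : R => Num.max s 0) (fun t => \int[mu t]_x f x) _ (within [set t : R | 0 <= t] (nbhs (Num.max s 0)))) => //.
move=> A; rewrite /within /= => nA.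
have H2 : nbhs s [set z | 0 <= Num.max z 0 -> A (Num.max z 0)] by exact: (max0_cont nA).
apply: filterS H2 => z; apply; exact: max0_ge0.
Qed.

Definition total_mass (s : R) := fine (mb s setT).

Local Notation mass := total_mass.

Lemma mass_cont : continuous mass.
Proof.
have -> : mass = (fun t => \int[mb t]_x 1).
  by apply/funext => t; rewrite Rintegral_cst// mul1r.
by apply: mext_cont; [move=> x; exact: cvg_cst|exists 1 => x; rewrite normr1].
Qed.

Lemma mass_bound T0 : exists2 M1, 0 <= M1 & forall s, s <= T0 -> mass s <= M1.
Proof.
have T00 : 0 <= Num.max T0 0 by exact: max0_ge0.
have [c c1 Hc] := EVT_max T00 (continuous_subspaceT mass_cont).
exists (mass c); first exact: fine_fm_ge0.
move=> s sT; have -> : mass s = mass (Num.max s 0) by rewrite /total_mass /mext (max_l (max0_ge0 s)).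
by apply: Hc; rewrite in_itv/= max0_ge0/= max0_le// le_max sT.
Qed.

Lemma mass_near (s0 : R) : exists M1 : R, \forall s \near s0, fine (mb s setT) <= M1.
Proof.
have [M1 _ H] := mass_bound (s0 + 1); exists M1; near=> s; apply: H; apply: ltW.
by near: s; apply: lt_nbhsl; lra.
Unshelve. all: by end_near. Qed.

Lemma cont_int_mb (f : R -> R -> R) : continuous (fun p : R * R => f p.1 p.2) ->
  (forall s, exists K : R, forall x, K < `|x| -> f s x = 0) ->
  locally_supported f -> continuous (fun s => \int[mb s]_x f s x).
Proof.
move=> cf sf lf s0; have [M1 HM] := mass_near s0.
have cfs s : continuous (f s) by exact: slice_continuous.
have bf s : exists C, forall x, `|f s x| <= C.
  by have [K HK] := sf s; have [C _ HC] := cont_supp_bounded (cfs s) HK; exists C.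
apply: (cvg_int_measures cfs bf _ HM); last exact: mext_cont.
by have [K HK] := lf s0; apply: compact_uniform HK.
Qed.

Lemma window_int_mb (f : R -> R -> R) (c : R -> R) k : continuous (fun p : R * R => f p.1 p.2) ->
  continuous c -> (forall s x, k < `|x - c s| -> f s x = 0) -> continuous (fun s => \int[mb s]_x f s x).
Proof.
move=> cf cc fk; apply: cont_int_mb => //; last exact: locally_supported_window fk.
move=> s; exists (`|c s| + k) => x xk; apply: fk.
by have := ler_normD (x - c s) (c s); rewrite subrK; lra.
Qed.

Variable b : R -> R.
Hypothesis sb : smooth_step b.

Lemma cont_ramp_mb k c : 0 < k -> continuous c -> continuous (fun s => \int[mb s]_x ramp b k (c s) x).
Proof.
move=> k0 cc s0; have [M1 HM] := mass_near s0.
have rC s x : `|ramp b k (c s) x| <= 1.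
  by have /andP[? ?] := ramp01 sb k (c s) x; rewrite ger0_norm.
apply: (cvg_int_measures _ _ _ HM).
- by move=> s; exact: ramp_cont.
- by move=> s; exists 1.
- move=> e e0; have [C C0 HC] := step_lip sb.
  have d0 : 0 < e / ((C + 1) * k^-1) by rewrite divr_gt0// mulr_gt0 ?invr_gt0// ltr_wpDl.
  have /cvgrPdist_le/(_ _ d0) := cc s0; apply: filterS => s sc x.
  rewrite /ramp; apply: (le_trans (HC _ _)).
  rewrite -mulrBr (_ : x - c s - (x - c s0) = c s0 - c s); last by ring.
  rewrite normrM gtr0_norm ?invr_gt0// mulrA.
  apply: (@le_trans _ _ ((C + 1) * k^-1 * `|c s0 - c s|)).
    by rewrite ler_wpM2r// ler_wpM2r ?invr_ge0 ?(ltW k0)// lerDl.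
  by rewrite mulrC -ler_pdivlMr// mulr_gt0 ?invr_gt0// ltr_wpDl.
- by apply: mext_cont; [exact: ramp_cont|exists 1].
Qed.

End Solution.

(** * Momentum along lines *)

Section Lines.
Context {R : realType}.
Local Notation leb := (@lebesgue_measure R).
Local Notation T := (measurableTypeR R).
Local Notation fmeasure := {finite_measure set T -> \bar R}.
Variables (b : R -> R).
Hypothesis sb : smooth_step b.

Let b1 : smooth b. Proof. by case: sb. Qed.

Section Moving.
Variables (k c0 sg : R).
Local Notation c := (fun s : R => c0 + sg * s).

Lemma line_cont : continuous c.
Proof. by move=> s; apply: cvgD; [exact: cvg_cst|apply: cvgM; [exact: cvg_cst|exact: cvg_id]]. Qed.

(** A centre moving along a straight line keeps the argument affine in [(t, x)], and hence the test
    function in the smooth class. *)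
Lemma ramp_line_S2 : smooth2_alg (fun t x => ramp b k (c t) x).
Proof.
have -> : (fun t x => ramp b k (c t) x) = (fun t x => b (k^-1 * x + (- (k^-1 * sg)) * t + (- (k^-1 * c0)))).
  by apply/funext => t; apply/funext => x; rewrite /ramp; congr b; ring.
exact: S2_affine.
Qed.

Lemma bump_line_S2 : smooth2_alg (fun t x => bump b k (c t) x).
Proof.
have -> : (fun t x => bump b k (c t) x) =
    (fun t x => k^-1 * derive1 b (k^-1 * x + (- (k^-1 * sg)) * t + (- (k^-1 * c0)))).
  by apply/funext => t; apply/funext => x; rewrite /bump; congr (_ * derive1 b _); ring.
by apply: (S2_mul (S2_cst k^-1)); apply: S2_affine; exact: smooth_deriv.
Qed.

Lemma ramp_line_dt (t x : R) : is_derive t 1 (fun s => ramp b k (c s) x) (- sg * bump b k (c t) x).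
Proof.
have D := @affine_dt _ b k^-1 (- (k^-1 * sg)) (- (k^-1 * c0)) t x b1.
have -> : (fun s => ramp b k (c s) x) = (fun s => b (k^-1 * x + (- (k^-1 * sg)) * s + (- (k^-1 * c0)))).
  by apply/funext => s; rewrite /ramp; congr b; ring.
apply: (is_derive_eq D); rewrite /bump mulrA; congr (_ * derive1 b _); ring.
Qed.

Lemma bump_line_dt (t x : R) : is_derive t 1 (fun s => bump b k (c s) x) (- sg * dbump b k (c t) x).
Proof.
have D := @affine_dt _ (derive1 b) k^-1 (- (k^-1 * sg)) (- (k^-1 * c0)) t x (smooth_deriv b1).
have D2 := is_deriveM (is_derive_cst k^-1 t 1) D.
have -> : (fun s => bump b k (c s) x) =
    (cst k^-1 \* (fun s => derive1 b (k^-1 * x + (- (k^-1 * sg)) * s + (- (k^-1 * c0)))))%R.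
  by apply/funext => s; rewrite /bump /=; congr (_ * derive1 b _); ring.
apply: (is_derive_eq D2); rewrite scaler0 addr0 /dbump /GRing.scale/=.
have -> : k^-1 * x + - (k^-1 * sg) * t + - (k^-1 * c0) = k^-1 * (x - (c0 + sg * t)) by ring.
by move: (derive1 (derive1 b) _) => d; ring.
Qed.

End Moving.

Variables (pp pm : R -> R) (u : R -> R -> R) (mu : R -> fmeasure).
Hypothesis PU : partition_of_unity pp pm.
Hypothesis hsol : weak_cons_sol pp pm u mu.
Local Notation ub := (uext u).
Local Notation mb := (mext mu).
Local Notation mass := (total_mass mu).

Lemma ext_ge0 t : 0 <= t -> ub t = u t /\ mb t = mu t.
Proof. by move=> t0; rewrite /uext /mext max_l. Qed.

Lemma time_S2 (a : R -> R) : smooth a -> smooth2_alg (fun t x : R => a t).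
Proof.
move=> sa; have := @S2_affine _ a 0 1 0 sa.
by congr smooth2_alg; apply/funext => t; apply/funext => x; congr a; ring.
Qed.

(** The rate of change of the velocity averaged by a bump whose centre moves at speed [v]: the
    quadratic flux relative to that frame, plus the nonlocal source in the form given by
    [ramp_int_Q]. *)
Definition momentum_flux (v : R) (t k c : R) :=
  \int[leb]_x (2^-1 * (ub t x - v) ^+ 2 * dbump b k c x) + 4^-1 * \int[mb t]_x (1 - 2 * ramp b k c x).

Lemma ub_mul_cont (f : R -> R -> R) : continuous (fun p : R * R => f p.1 p.2) ->
  continuous (fun p : R * R => ub p.1 p.2 * f p.1 p.2).
Proof. by move=> cf p; apply: cvgM; [exact: (uext_cont hsol)|exact: cf]. Qed.

Lemma sq_flux_cont (v c : R -> R) k : continuous v -> continuous c ->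
  continuous (fun p : R * R => 2^-1 * (ub p.1 p.2 - v p.1) ^+ 2 * dbump b k (c p.1) p.2).
Proof.
move=> cv cc.
have cd : continuous (fun p : R * R => ub p.1 p.2 - v p.1).
  move=> p; apply: cvgB; first exact: (uext_cont hsol).
  by apply: (@continuous_comp _ _ _ (@fst R R) v); [exact: cvg_fst|exact: cv].
move=> p; apply: cvgM; last exact: (@dbump_cont2 _ _ sb k c cc).
by apply: cvgM; [exact: cvg_cst|apply: cvgM; exact: cd].
Qed.

Lemma one_sub_ramp_int (m : fmeasure) k c :
  \int[m]_x (1 - 2 * ramp b k c x) = fine (m setT) - 2 * \int[m]_x ramp b k c x.
Proof.
have ir : m.-integrable setT (EFin \o ramp b k c).
  apply: (@fm_integrable _ _ _ 1); first by apply: continuous_measurable_fun; exact: ramp_cont.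
  by move=> x; have /andP[? ?] := ramp01 sb k c x; rewrite ger0_norm.
rewrite RintegralB//.
- by rewrite Rintegral_cst// mul1r RintegralZl.
- by apply: (@fm_integrable _ _ _ 1) => // x; rewrite normr1.
- exact: integrableZ_EFin.
Qed.

Lemma momentum_flux_cont (v c : R -> R) k : 0 < k -> continuous v -> continuous c ->
  continuous (fun s => momentum_flux (v s) s k (c s)).
Proof.
move=> k0 cv cc; have H1 : continuous (fun s => \int[leb]_x (2^-1 * (ub s x - v s) ^+ 2 * dbump b k (c s) x)).
  apply: (@cont_int_leb _ (fun s x => 2^-1 * (ub s x - v s) ^+ 2 * dbump b k (c s) x)).
    exact: sq_flux_cont.
  by apply: (locally_supported_window cc (k := k)) => s x xk; rewrite dbump_supp// mulr0.
have H2 : continuous (fun s => \int[mb s]_x (1 - 2 * ramp b k (c s) x)).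
  have -> : (fun s => \int[mb s]_x (1 - 2 * ramp b k (c s) x)) =
      (fun s => mass s - 2 * \int[mb s]_x ramp b k (c s) x).
    by apply/funext => s; rewrite one_sub_ramp_int.
  move=> s; apply: cvgB; first exact: (mass_cont hsol).
  apply: cvgM; [exact: cvg_cst|exact: (cont_ramp_mb hsol sb k0 cc)].
by move=> s; apply: cvgD; [exact: H1|apply: cvgM; [exact: cvg_cst|exact: H2]].
Qed.

Lemma bump_int_cont (c : R -> R) k : 0 < k -> continuous c ->
  continuous (fun s => \int[leb]_x (ub s x * bump b k (c s) x)).
Proof.
move=> k0 cc; apply: (@cont_int_leb _ (fun s x => ub s x * bump b k (c s) x)).
  by apply: (ub_mul_cont (f := fun s x => bump b k (c s) x)); exact: (@bump_cont2 _ _ sb k c cc).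
by apply: (locally_supported_window cc (k := k)) => s x xk; rewrite bump_supp// mulr0.
Qed.

Lemma window_far (k c x : R) : `|c| + k < `|x| -> k < `|x - c|.
Proof. by have := ler_normD (x - c) c; rewrite subrK; lra. Qed.

Lemma dbump_int0 k c : 0 < k -> \int[leb]_x dbump b k c x = 0.
Proof.
move=> k0; have ck : 0 <= `|c| + k by rewrite addr_ge0// ltW.
rewrite (@Rint_symm _ _ (`|c| + k))//; last by move=> x /window_far; exact: dbump_supp.
have [_ _ <-] := dbump_bprim sb k0 c; last lra.
rewrite !bump_supp ?subrr//; have := ler_norm c; have := ler_norm (- c); rewrite normrN.
- by move=> ? ?; rewrite ltr0_norm; lra.
- by move=> ? ?; rewrite gtr0_norm; lra.
Qed.

(* The [sg]-terms complete the square because [dbump] has zero integral. *)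
Lemma momentum_inner k c sg (a a' t : R) : 0 < k -> 0 <= t ->
  (\int[leb]_x (u t x * (a' * bump b k c x + a * (- sg * dbump b k c x))
     + 2^-1 * (u t x) ^+ 2 * (a * dbump b k c x)
     + 4^-1 * (fine (mu t `]-oo, x[%classic) - fine (mu t `]x, +oo[%classic)) * (a * bump b k c x))%:E
   = (a' * \int[leb]_x (ub t x * bump b k c x) + a * momentum_flux sg t k c)%:E)%E.
Proof.
move=> k0 t0; have [Eu Em] := ext_ge0 t0.
pose Q x := fine (mu t `]-oo, x[%classic) - fine (mu t `]x, +oo[%classic).
have And : {homo Q : x y / x <= y}.
  move=> x y xy; apply: lerB; apply: fine_fm_le => // z /=; rewrite !in_itv/= ?andbT.
  - by move=> /lt_le_trans; exact.
  - exact: le_lt_trans.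
have mQ : measurable_fun [set: T] (Q : T -> T) by exact: nondecreasing_measurable.
have QM x : `|Q x| <= fine (mu t setT).
  have h1 : fine (mu t `]-oo, x[%classic) <= fine (mu t setT) by exact: fine_fm_le.
  have h2 : fine (mu t `]x, +oo[%classic) <= fine (mu t setT) by exact: fine_fm_le.
  have h3 := fine_fm_ge0 (mu t) `]-oo, x[%classic.
  have h4 := fine_fm_ge0 (mu t) `]x, +oo[%classic.
  by rewrite /Q ler_norml; apply/andP; split; lra.
have cu : continuous (u t) by rewrite -Eu; exact: (uext_slice hsol).
have cb : continuous (bump b k c) by exact: bump_cont.
have cdb : continuous (dbump b k c) by exact: dbump_cont.
have ck : 0 <= `|c| + k by rewrite addr_ge0// ltW.
have i1 : leb.-integrable setT (EFin \o (fun x => u t x * bump b k c x)).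
  apply: (@cont_supp_integrable _ _ (`|c| + k)); last by move=> x /window_far xk; rewrite bump_supp ?mulr0.
  by move=> x; apply: cvgM; [exact: cu|exact: cb].
have i2 : leb.-integrable setT (EFin \o (fun x => 2^-1 * (u t x - sg) ^+ 2 * dbump b k c x)).
  apply: (@cont_supp_integrable _ _ (`|c| + k)); last by move=> x /window_far xk; rewrite dbump_supp ?mulr0.
  have cs : continuous (fun x => u t x - sg) by move=> x; apply: cvgB; [exact: cu|exact: cvg_cst].
  move=> x; apply: cvgM; last exact: cdb.
  by apply: cvgM; [exact: cvg_cst|apply: cvgM; exact: cs].
have i3 : leb.-integrable setT (EFin \o (fun x => dbump b k c x)).
  by apply: (@cont_supp_integrable _ _ (`|c| + k)) => // x /window_far; exact: dbump_supp.
have i4 : leb.-integrable setT (EFin \o (fun x => Q x * bump b k c x)).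
  have [C _ HC] := bump_bounded sb k0.
  apply: (@compact_bounded_integrable _ _ (fine (mu t setT) * C) (`|c| + k)) => //.
  - by apply: measurable_funM => //; exact: continuous_measurable_fun.
  - by move=> x; rewrite normrM ler_pM.
  - by move=> x /window_far xk; rewrite bump_supp ?mulr0.
pose F x := a' * (u t x * bump b k c x) + (a * (2^-1 * (u t x - sg) ^+ 2 * dbump b k c x) +
  (- (a * 2^-1 * sg ^+ 2) * dbump b k c x + a * 4^-1 * (Q x * bump b k c x))).
have j1 := integrableZ_EFin a' measurableT i1.
have j2 := integrableZ_EFin a measurableT i2.
have j3 := integrableZ_EFin (- (a * 2^-1 * sg ^+ 2)) measurableT i3.
have j4 := integrableZ_EFin (a * 4^-1) measurableT i4.
have j34 := integrableD_EFin measurableT j3 j4.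
have j234 := integrableD_EFin measurableT j2 j34.
have iF : leb.-integrable setT (EFin \o F) by exact: integrableD_EFin.
transitivity (\int[leb]_x (F x)%:E)%E.
  by apply: eq_integral => x _; rewrite /F /Q; congr EFin; field.
rewrite -(@fineK _ (\int[leb]_x (F x)%:E)%E); last exact: integrable_fin_num.
congr EFin; rewrite -[LHS]/(\int[leb]_x F x) /F.
rewrite RintegralD// RintegralD// RintegralD//.
rewrite (RintegralZl a' measurableT i1) (RintegralZl a measurableT i2) (RintegralZl _ measurableT i3).
rewrite (RintegralZl _ measurableT i4) dbump_int0// mulr0 add0r.
rewrite /momentum_flux Eu Em /Q ramp_int_Q//; ring.
Qed.

Lemma line_test (p : R -> R -> R) (a : R -> R) k c0 sg K : smooth a -> (forall t, K < `|t| -> a t = 0) ->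
  smooth2_alg p -> (forall t x, k < `|x - (c0 + sg * t)| -> p t x = 0) ->
  test_fun (fun t x => a t * p t x).
Proof.
move=> sa aK sp pk; split.
  by apply: smooth2_algP; apply: S2_mul => //; exact: time_S2.
exists (Num.max K (`|c0| + `|sg| * K + k)) => t x.
have [tK|tK] := ltP K `|t|; first by rewrite aK// mul0r.
case=> [|]; rewrite gt_max => /andP[h1 h2]; first by rewrite aK// mul0r.
rewrite pk ?mulr0//; apply: window_far; apply: le_lt_trans h2; rewrite lerD2r.
by apply: (le_trans (ler_normD _ _)); rewrite lerD2l normrM ler_wpM2l.
Qed.

Lemma mul_dt (a p : R -> R) (t d : R) : smooth a -> is_derive t 1 p d ->
  derive1 (fun s => a s * p s) t = derive1 a t * p t + a t * d.
Proof.
move=> sa dp; apply: derive1_is.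
apply: (is_derive_eq (is_deriveM (derivable_is (smooth_derivable (x:=t) sa)) dp)).
by rewrite /GRing.scale/= addrC [p t * _]mulrC.
Qed.

Lemma mul_dx (a : R) (p : R -> R) (x d : R) : is_derive x 1 p d -> derive1 (fun z => a * p z) x = a * d.
Proof.
by move=> dp; apply: derive1_is.
Qed.

Lemma momentum_line k c0 sg t : 0 < k -> 0 <= t ->
  \int[leb]_x (ub t x * bump b k (c0 + sg * t) x) - \int[leb]_x (ub 0 x * bump b k c0 x) =
  \int[leb]_(s in `]0, t]) momentum_flux sg s k (c0 + sg * s).
Proof.
move=> k0; have cc := @line_cont c0 sg.
pose I t := \int[leb]_x (ub t x * bump b k (c0 + sg * t) x).
have -> : \int[leb]_x (ub 0 x * bump b k c0 x) = I 0 by rewrite /I mulr0 addr0.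
move: t; apply: (@time_localise _ _ sb I (fun s => momentum_flux sg s k (c0 + sg * s))).
- exact: bump_int_cont.
- by apply: (momentum_flux_cont (v := fun=> sg)) => // s; exact: cvg_cst.
move=> a sa [K aK] a0.
have tphi : test_fun (fun t x => a t * bump b k (c0 + sg * t) x).
  by apply: (line_test (k := k) (c0 := c0) (sg := sg) sa aK); [exact: bump_line_S2|move=> t x; exact: bump_supp].
have [_ /(_ _ tphi)[W1 _] _ _ _] := hsol.
transitivity (\int[leb]_(t in [set t : R | (0 <= t)%R]) \int[leb]_x
           (u t x * dt (fun t x => a t * bump b k (c0 + sg * t) x) t x + 2^-1 * (u t x) ^+ 2 * dx (fun t x => a t * bump b k (c0 + sg * t) x) t x
            + 4^-1 * (fine (mu t `]-oo, x[%classic) - fine (mu t `]x, +oo[%classic))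
                   * (a t * bump b k (c0 + sg * t) x))%R%:E)%E.
  apply: eq_integral => t; rewrite inE/= => t0; rewrite -momentum_inner//.
  apply: eq_integral => x _; rewrite /dt /dx (mul_dt sa (bump_line_dt k c0 sg t x)).
  by rewrite (mul_dx (a t) (bump_derive sb k (c0 + sg * t) x)).
rewrite W1 EFinN; congr (- _)%E.
have [Eu _] := ext_ge0 (lexx 0).
rewrite /I /Rintegral Eu fineK; first by apply: eq_integral => x _; rewrite a0 mul1r.
apply: integrable_fin_num => //; apply: (@cont_supp_integrable _ _ (`|c0 + sg * 0| + k)).
  move=> x; apply: cvgM; last exact: bump_cont.
  by rewrite -Eu; exact: (uext_slice hsol).
by move=> x /window_far xk; rewrite (bump_supp sb k0 xk) mulr0.
Qed.

End Lines.

(** * Transport of the energy and its quantiles *)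

Section Transport.
Context {R : realType}.
Local Notation leb := (@lebesgue_measure R).
Local Notation T := (measurableTypeR R).
Local Notation fmeasure := {finite_measure set T -> \bar R}.
Variables (b : R -> R).
Hypothesis sb : smooth_step b.
Variables (pp pm : R -> R) (u : R -> R -> R) (mu : R -> fmeasure).
Hypothesis PU : partition_of_unity pp pm.
Hypothesis hsol : weak_cons_sol pp pm u mu.
Local Notation ub := (uext u).
Local Notation mb := (mext mu).
Local Notation mass := (total_mass mu).
Local Notation F := (fun s => cdfm (mb s)).

Lemma five_term_bound (A B C D I J e q : R) : (A - B) - (C - D) = I - J -> - q <= J -> J <= q -> q <= e / 3 ->
  0 <= B -> 0 <= D -> B <= e / 3 -> D <= e / 3 -> `|A - C - I| <= e.
Proof. by move=> *; rewrite ler_norml; apply/andP; split; lra. Qed.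

Lemma four_term_bound (A B C D e q : R) : - q <= B - D -> B - D <= q -> q <= e / 3 ->
  A - e / 3 <= B -> B <= A -> C - e / 3 <= D -> D <= C -> `|A - C| <= e.
Proof. by move=> *; rewrite ler_norml; apply/andP; split; lra. Qed.

Lemma dist_between (a c m k s : R) : `|a - m| <= k -> `|c - m| <= k -> a < s <= c -> `|s - m| <= k.
Proof.
rewrite !ler_norml => /andP[? _] /andP[_ ?] /andP[? ?]; apply/andP; split; lra.
Qed.

Lemma slope_bound (A B v e l : R) : A <= B + (v + e) * l -> B + (v - e) * l <= A -> `|A - B - v * l| <= e * l.
Proof. by move=> ? ?; rewrite ler_norml; apply/andP; split; lra. Qed.

Lemma ftc_between (I J : R -> R) : continuous J ->
  (forall t, 0 <= t -> I t - I 0 = \int[leb]_(s in `]0, t]) J s) ->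
  forall s1 s2, 0 <= s1 -> s1 <= s2 -> I s2 - I s1 = \int[leb]_(s in `]s1, s2]) J s.
Proof.
move=> cJ H s1 s2 s10 s12.
rewrite -(@Rintegral_itvB _ J (BRight 0) (BRight s2) s1) ?bnd_simp//; last exact: cont_oc_integrable.
by rewrite -!H//; [ring|exact: le_trans s12].
Qed.

Lemma cutoff_test (p : R -> R -> R) (a : R -> R) K K2 : smooth a -> (forall t, K < `|t| -> a t = 0) ->
  smooth2_alg p -> (forall t x, `|t| <= K -> K2 < `|x| -> p t x = 0) ->
  test_fun (fun t x => a t * p t x).
Proof.
move=> sa aK sp pk; split.
  by apply: smooth2_algP; apply: S2_mul => //; exact: time_S2.
exists (Num.max K K2) => t x.
have [tK|tK] := ltP K `|t|; first by rewrite aK// mul0r.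
case=> [|]; rewrite gt_max => /andP[h1 h2]; first by rewrite aK// mul0r.
by rewrite pk ?mulr0.
Qed.

(** A smoothed version of the energy to the right of [c]; [flux] is its rate of change when the
    centre moves at speed [sg]. *)
Definition ramp_mass s k c := \int[mb s]_x ramp b k c x.
Definition flux s k c (sg : R) := \int[mb s]_x ((ub s x - sg) * bump b k c x).

Lemma flux_cont (c : R -> R) k sg : 0 < k -> continuous c -> continuous (fun s => flux s k (c s) sg).
Proof.
move=> k0 cc; apply: (@window_int_mb _ _ _ _ _ hsol (fun s x => (ub s x - sg) * bump b k (c s) x) c k) => //.
  move=> p; apply: cvgM; last exact: (@bump_cont2 _ _ sb k c cc).
  by apply: cvgB; [exact: (uext_cont hsol)|exact: cvg_cst].
by move=> s x xk; rewrite bump_supp ?mulr0.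
Qed.

Lemma ramp_fm_integrable (m : fmeasure) k c : m.-integrable setT (EFin \o ramp b k c).
Proof.
apply: (@fm_integrable _ _ _ 1); first by apply: continuous_measurable_fun; exact: ramp_cont.
by move=> x; have /andP[? ?] := ramp01 sb k c x; rewrite ger0_norm.
Qed.

Lemma bump_fm_integrable (m : fmeasure) (f : R -> R) k c : 0 < k -> continuous f ->
  m.-integrable setT (EFin \o (fun x => f x * bump b k c x)).
Proof.
move=> k0 cf.
have cfb : continuous (fun x => f x * bump b k c x).
  by move=> x; apply: cvgM; [exact: cf|exact: bump_cont].
have [C _ HC] : exists2 C, 0 <= C & forall x, `|f x * bump b k c x| <= C.
  by apply: (@cont_supp_bounded _ _ (`|c| + k)) => // x /window_far xk; rewrite bump_supp ?mulr0.
by apply: (@fm_integrable _ _ _ C) => //; exact: continuous_measurable_fun.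
Qed.

(** A single ramp has no compact support and cannot be tested with; its difference with a stationary
    ramp far to the right can. *)
Lemma transport_cut k c0 sg K t : 0 < k -> 0 < K -> 0 <= t ->
  (ramp_mass t k (c0 + sg * t) - ramp_mass t K (2 * K)) - (ramp_mass 0 k c0 - ramp_mass 0 K (2 * K)) =
  \int[leb]_(s in `]0, t]) (flux s k (c0 + sg * s) sg - flux s K (2 * K) 0).
Proof.
move=> k0 K0; have cc := @line_cont _ c0 sg.
pose I t := ramp_mass t k (c0 + sg * t) - ramp_mass t K (2 * K).
have -> : ramp_mass 0 k c0 - ramp_mass 0 K (2 * K) = I 0 by rewrite /I mulr0 addr0.
have cK : continuous (fun _ : R => 2 * K) by move=> s; exact: cvg_cst.
move: t; apply: (@time_localise _ _ sb I (fun s => flux s k (c0 + sg * s) sg - flux s K (2 * K) 0)).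
- move=> s; apply: cvgB; first exact: (cont_ramp_mb hsol sb k0 cc).
  exact: (cont_ramp_mb hsol sb K0 cK).
- have F1 := flux_cont (sg:=sg) k0 cc; have F2 := flux_cont (sg:=0) K0 cK.
  by move=> s; apply: cvgB; [exact: F1|exact: F2].
move=> a sa [Ka aK] a0.
pose p t x := ramp b k (c0 + sg * t) x + (-1) * ramp b K (2 * K + 0 * t) x.
have tphi : test_fun (fun t x => a t * p t x).
  apply: (@cutoff_test _ _ Ka (`|c0| + `|sg| * Ka + k + 3 * K) sa aK).
    by apply: S2_add; [exact: ramp_line_S2|apply: S2_mul; [exact: S2_cst|exact: ramp_line_S2]].
  move=> s x sK xK; rewrite /p mul0r addr0.
  have gb : `|c0 + sg * s| <= `|c0| + `|sg| * Ka.
    by apply: (le_trans (ler_normD _ _)); rewrite lerD2l normrM ler_wpM2l.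
  move: gb; rewrite ler_norml => /andP[g1 g2].
  move: xK; rewrite lter_normr => /orP[x1|x1].
    by rewrite !ramp_hi ?mulr1 ?subrr//; have := normr_ge0 c0; have := mulr_ge0 (normr_ge0 sg) (le_trans (normr_ge0 _) sK); lra.
  by rewrite !ramp_lo ?mulr0 ?addr0//; have := normr_ge0 c0; have := mulr_ge0 (normr_ge0 sg) (le_trans (normr_ge0 _) sK); lra.
have [_ /(_ _ tphi)[_ W2] _ _ _] := hsol.
transitivity (\int[leb]_(t in [set t : R | (0 <= t)%R]) \int[mu t]_x
           (dt (fun t x => a t * p t x) t x + u t x * dx (fun t x => a t * p t x) t x)%:E)%E.
  apply: eq_integral => t; rewrite inE/= => t0; have [Eu Em] := ext_ge0 u mu t0.
  pose G x := (derive1 a t * ramp b k (c0 + sg * t) x + (- derive1 a t) * ramp b K (2 * K) x) +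
    (a t * ((ub t x - sg) * bump b k (c0 + sg * t) x) + (- a t) * ((ub t x - 0) * bump b K (2 * K) x)).
  have cus r : continuous (fun x => ub t x - r) by move=> x; apply: cvgB; [exact: (uext_slice hsol)|exact: cvg_cst].
  have i1 := ramp_fm_integrable (mu t) k (c0 + sg * t).
  have i2 := ramp_fm_integrable (mu t) K (2 * K).
  have i3 := bump_fm_integrable (mu t) (c0 + sg * t) k0 (cus sg).
  have i4 := bump_fm_integrable (mu t) (2 * K) K0 (cus 0).
  have j12 := integrableD_EFin measurableT (integrableZ_EFin (derive1 a t) measurableT i1) (integrableZ_EFin (- derive1 a t) measurableT i2).
  have j34 := integrableD_EFin measurableT (integrableZ_EFin (a t) measurableT i3) (integrableZ_EFin (- a t) measurableT i4).
  transitivity (\int[mu t]_x (G x)%:E)%E; last first.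
    apply: eq_integral => x _; rewrite /dt /dx.
    have Dp : is_derive t 1 (fun s => p s x) (- sg * bump b k (c0 + sg * t) x).
      have D1 := ramp_line_dt sb k c0 sg t x.
      have D2 := is_deriveM (is_derive_cst (-1 : R) t 1) (ramp_line_dt sb K (2 * K) 0 t x).
      apply: (is_derive_eq (is_deriveD D1 D2)); rewrite scaler0 addr0 oppr0 mul0r scaler0 addr0//.
    have Dx : is_derive x 1 (p t) (bump b k (c0 + sg * t) x - bump b K (2 * K) x).
      have D1 := ramp_derive sb k (c0 + sg * t) x.
      have D2 := is_deriveM (is_derive_cst (-1 : R) x 1) (ramp_derive sb K (2 * K + 0 * t) x).
      apply: (is_derive_eq (is_deriveD D1 D2)); rewrite scaler0 addr0 mul0r addr0 /GRing.scale/= mulN1r//.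
    rewrite (mul_dt sa Dp) (mul_dx (a t) Dx) /G Eu /p mul0r addr0; congr EFin; ring.
  rewrite -(@fineK _ (\int[mu t]_x (G x)%:E)%E); last first.
    by apply: integrable_fin_num => //; exact: integrableD_EFin.
  congr EFin; rewrite -[RHS]/(\int[mu t]_x G x) /G RintegralD// RintegralD; [|by []|exact: integrableZ_EFin|exact: integrableZ_EFin].
  rewrite [in RHS]RintegralD; [|by []|exact: integrableZ_EFin|exact: integrableZ_EFin].
  rewrite (RintegralZl _ measurableT i1) (RintegralZl _ measurableT i2) (RintegralZl _ measurableT i3) (RintegralZl _ measurableT i4).
  by rewrite !mulNr -!mulrBr /I /ramp_mass /flux Em.
rewrite W2 EFinN; congr (- _)%E.
have [_ Em] := ext_ge0 u mu (lexx 0).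
rewrite /I /ramp_mass Em -RintegralB//; [|exact: ramp_fm_integrable..].
rewrite /Rintegral fineK.
  by apply: eq_integral => x _; rewrite a0 mul1r /p mul0r addr0 mulN1r.
by apply: integrable_fin_num => //; apply: integrableB_EFin => //; exact: ramp_fm_integrable.
Qed.

Lemma ramp_mass_le (m : fmeasure) k c : 0 < k -> \int[m]_x ramp b k c x <= fine (m setT) - cdfm m (c - k).
Proof.
move=> k0; rewrite -cdfm_y; apply: Rint_le_measure => //.
- by apply: continuous_measurable_fun; exact: ramp_cont.
- exact: ramp01.
- by move=> x; rewrite /= in_itv/= andbT => /negP; rewrite -leNgt; exact: ramp_lo.
Qed.

Lemma ramp_mass_ge (m : fmeasure) k c : 0 < k -> fine (m setT) - cdfm m (c + k) <= \int[m]_x ramp b k c x.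
Proof.
move=> k0; rewrite -cdfm_y; apply: measure_le_Rint => //.
- by apply: continuous_measurable_fun; exact: ramp_cont.
- exact: ramp01.
- by move=> x; rewrite /= in_itv/= andbT => /ltW; exact: ramp_hi.
Qed.

Lemma ramp_mass_ge0 (m : fmeasure) k c : 0 <= \int[m]_x ramp b k c x.
Proof. by apply: Rintegral_ge0 => x _; have /andP[] := ramp01 sb k c x. Qed.

(** A ramp of width [K] has slope of order [1 / K], while velocity and mass are bounded up to time
    [t]; wherever the ramp stands, the flux through it dies out as [K] grows. *)
Lemma flux_wide t : 0 <= t -> exists2 C, 0 <= C & forall K c, 0 < K ->
  `|\int[leb]_(s in `]0, t]) flux s K c 0| <= C / K.
Proof.
move=> t0; have [B B0 HB] := uext_bound PU hsol t; have [M1 M0 HM] := mass_bound hsol t.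
have [C C0 HC] := step_derive1_bounded sb.
exists (B * C * M1 * t); first by rewrite !mulr_ge0.
move=> K c K0; have iK : 0 <= K^-1 by rewrite invr_ge0 ltW.
have cK : continuous (fun _ : R => c) by move=> s; exact: cvg_cst.
rewrite (_ : B * C * M1 * t / K = B * (K^-1 * C) * M1 * t); last by ring.
apply: cont_Rint_bound => //; first exact: (flux_cont (sg:=0) K0 cK).
move=> s /andP[_ st]; apply: le_trans.
  apply: (@fm_Rint_bound _ (mb s) _ (B * (K^-1 * C))).
    apply: continuous_measurable_fun => x; apply: cvgM; last exact: bump_cont.
    by apply: cvgB; [exact: (uext_slice hsol)|exact: cvg_cst].
  move=> x; rewrite subr0 normrM ler_pM// ?HB// /bump normrM (ger0_norm iK) ler_wpM2l//.
by rewrite ler_wpM2l ?HM// !mulr_ge0.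
Qed.

Lemma transport_line k c0 sg t : 0 < k -> 0 <= t ->
  ramp_mass t k (c0 + sg * t) - ramp_mass 0 k c0 = \int[leb]_(s in `]0, t]) flux s k (c0 + sg * s) sg.
Proof.
move=> k0 t0; apply/eqP; rewrite -subr_eq0 -normr_le0; apply/ler_addgt0Pl => e e0; rewrite addr0.
have e3 : 0 < e / 3 by rewrite divr_gt0.
have [C C0 HC] := flux_wide t0.
have [x1 H1] := cdfm_hi (mb t) e3; have [x2 H2] := cdfm_hi (mb 0) e3.
(* The auxiliary ramp, centred at [2 * K] with width [K], starts at [K]. Beyond [K] little energy is
   left at times [0] and [t], and the last entry makes its flux small. *)
pose K := Num.max (Num.max x1 x2) (Num.max 1 (C / (e / 3))).
have K0 : 0 < K by rewrite /K !lt_max ltr01 orbT.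
have K1 : x1 <= K by rewrite /K !le_max lexx.
have K2 : x2 <= K by rewrite /K !le_max lexx orbT.
have K3 : C / K <= e / 3.
  by rewrite ler_pdivrMr// mulrC -ler_pdivrMr// /K !le_max lexx !orbT.
have cc := @line_cont _ c0 sg.
have cK : continuous (fun _ : R => 2 * K) by move=> s; exact: cvg_cst.
have := transport_cut c0 sg k0 K0 t0.
rewrite RintegralB//; [|exact: cont_oc_integrable (flux_cont (sg:=sg) k0 cc)|exact: cont_oc_integrable (flux_cont (sg:=0) K0 cK)].
have := HC K (2 * K) K0; rewrite ler_norml => /andP[h1 h2].
have h3 : 0 <= ramp_mass t K (2 * K) by exact: ramp_mass_ge0.
have h4 : 0 <= ramp_mass 0 K (2 * K) by exact: ramp_mass_ge0.
have EK : 2 * K - K = K by ring.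
have h5 : ramp_mass t K (2 * K) <= e / 3.
  apply: (le_trans (ramp_mass_le _ _ K0)); rewrite EK; have := cdfm_nd (mb t) K1; lra.
have h6 : ramp_mass 0 K (2 * K) <= e / 3.
  apply: (le_trans (ramp_mass_le _ _ K0)); rewrite EK; have := cdfm_nd (mb 0) K2; lra.
move=> E; exact: (five_term_bound E h1 h2 K3 h3 h4 h5 h6).
Qed.

(** A wide stationary ramp far to the left sees nearly all the energy at both times, and its width
    makes the flux through it negligible. *)
Lemma mass_const t : mass t = mass 0.
Proof.
have -> : mass t = mass (Num.max t 0) by rewrite /total_mass /mext (max_l (max0_ge0 t)).
move: (max0_ge0 t); move: (Num.max t 0) => {}t t0.
apply/eqP; rewrite -subr_eq0 -normr_le0; apply/ler_addgt0Pl => e e0; rewrite addr0.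
have e3 : 0 < e / 3 by rewrite divr_gt0.
have [C C0 HC] := flux_wide t0.
have [x1 H1] := cdfm_lo (mb t) e3; have [x2 H2] := cdfm_lo (mb 0) e3.
pose K := Num.max (Num.max (- x1) (- x2)) (Num.max 1 (C / (e / 3))).
have K0 : 0 < K by rewrite /K !lt_max ltr01 orbT.
have K1 : - K <= x1 by rewrite lerNl /K !le_max lexx.
have K2 : - K <= x2 by rewrite lerNl /K !le_max lexx orbT.
have K3 : C / K <= e / 3.
  by rewrite ler_pdivrMr// mulrC -ler_pdivrMr// /K !le_max lexx !orbT.
have := transport_line (- (2 * K)) 0 K0 t0; rewrite mul0r addr0.
rewrite (_ : \int[leb]_(s in `]0, t]) _ = \int[leb]_(s in `]0, t]) flux s K (- (2 * K)) 0); last first.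
  by apply: eq_Rintegral => s _; rewrite mul0r addr0.
move=> E; have := HC K (- (2 * K)) K0; rewrite -E ler_norml => /andP[h1 h2].
have EK : - (2 * K) + K = - K by ring.
have EK' : - (2 * K) - K <= - K by lra.
have g1 : mass t - e / 3 <= ramp_mass t K (- (2 * K)).
  apply: le_trans (ramp_mass_ge _ _ K0); rewrite EK; have := cdfm_nd (mb t) K1; rewrite /total_mass; lra.
have g2 : mass 0 - e / 3 <= ramp_mass 0 K (- (2 * K)).
  apply: le_trans (ramp_mass_ge _ _ K0); rewrite EK; have := cdfm_nd (mb 0) K2; rewrite /total_mass; lra.
have g3 : ramp_mass t K (- (2 * K)) <= mass t.
  apply: (le_trans (ramp_mass_le _ _ K0)); have := cdfm_ge0 (mb t) (- (2 * K) - K); rewrite /total_mass; lra.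
have g4 : ramp_mass 0 K (- (2 * K)) <= mass 0.
  apply: (le_trans (ramp_mass_le _ _ K0)); have := cdfm_ge0 (mb 0) (- (2 * K) - K); rewrite /total_mass; lra.
exact: (four_term_bound h1 h2 K3 g1 g3 g2 g4).
Qed.

Lemma transport_between k c0 sg s1 s2 : 0 < k -> 0 <= s1 -> s1 <= s2 ->
  ramp_mass s2 k (c0 + sg * s2) - ramp_mass s1 k (c0 + sg * s1) =
  \int[leb]_(s in `]s1, s2]) flux s k (c0 + sg * s) sg.
Proof.
move=> k0; have cc := @line_cont _ c0 sg.
move: s1 s2; apply: (@ftc_between (fun s => ramp_mass s k (c0 + sg * s))).
  exact: (flux_cont (sg:=sg) k0 cc).
by move=> t t0; rewrite mulr0 addr0 transport_line.
Qed.

(** The flux through a line at least as fast as the fluid near it is nonpositive, so energy can only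
    fall behind it. The offsets by [k] are the cost of replacing ramps by sharp half-lines;
    [trap_dn] is the mirror image. *)
Lemma trap_up k c0 sg s1 s2 : 0 < k -> 0 <= s1 -> s1 <= s2 ->
  (forall s x, s1 < s <= s2 -> `|x - (c0 + sg * s)| <= k -> ub s x <= sg) ->
  F s1 (c0 + sg * s1 - k) <= F s2 (c0 + sg * s2 + k).
Proof.
move=> k0 s10 s12 H.
have : ramp_mass s2 k (c0 + sg * s2) <= ramp_mass s1 k (c0 + sg * s1).
  rewrite -subr_le0 transport_between// -oppr_ge0 -mulN1r -RintegralZl//; last first.
    by apply: cont_oc_integrable; exact: (flux_cont (sg:=sg) k0 (@line_cont _ c0 sg)).
  apply: Rintegral_ge0 => s; rewrite /= in_itv/= => ss.
  rewrite mulN1r oppr_ge0 -oppr_ge0 -mulN1r -RintegralZl//; last first.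
    apply: bump_fm_integrable => // x; apply: cvgB; [exact: (uext_slice hsol)|exact: cvg_cst].
  apply: Rintegral_ge0 => x _; rewrite mulN1r -mulNr.
  have [xk|xk] := leP `|x - (c0 + sg * s)| k; last by rewrite bump_supp// mulr0.
  by rewrite mulr_ge0 ?bump_ge0// opprB subr_ge0 H.
have := ramp_mass_le (mb s1) (c0 + sg * s1) k0; have := ramp_mass_ge (mb s2) (c0 + sg * s2) k0.
have := mass_const s1; have := mass_const s2; rewrite /total_mass /ramp_mass; lra.
Qed.

Lemma trap_dn k c0 sg s1 s2 : 0 < k -> 0 <= s1 -> s1 <= s2 ->
  (forall s x, s1 < s <= s2 -> `|x - (c0 + sg * s)| <= k -> sg <= ub s x) ->
  F s2 (c0 + sg * s2 - k) <= F s1 (c0 + sg * s1 + k).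
Proof.
move=> k0 s10 s12 H.
have : ramp_mass s1 k (c0 + sg * s1) <= ramp_mass s2 k (c0 + sg * s2).
  rewrite -subr_ge0 transport_between//.
  apply: Rintegral_ge0 => s; rewrite /= in_itv/= => ss.
  apply: Rintegral_ge0 => x _.
  have [xk|xk] := leP `|x - (c0 + sg * s)| k; last by rewrite bump_supp// mulr0.
  by rewrite mulr_ge0 ?bump_ge0// subr_ge0 H.
have := ramp_mass_le (mb s2) (c0 + sg * s2) k0; have := ramp_mass_ge (mb s1) (c0 + sg * s1) k0.
have := mass_const s1; have := mass_const s2; rewrite /total_mass /ramp_mass; lra.
Qed.

Lemma quantile_exists eta : 0 < eta -> eta < mass 0 ->
  exists chi : R -> R, forall s x, (chi s <= x) = (eta <= F s x).
Proof.
move=> e0 eM; suff /choice[chi H] : forall s : R, exists q, forall x, (q <= x) = (eta <= F s x) by exists chi.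
move=> s; have [x0 H0] := cdfm_lo (mb s) e0.
have eM' : 0 < mass s - eta by rewrite (mass_const s) subr_gt0.
have [x1 H1] := cdfm_hi (mb s) eM'.
apply: (@galois_point _ _ eta x0 x1) => //.
- exact: cdfm_nd.
- by move=> x; exact: cdfm_rc.
- by move: H1; rewrite /total_mass; lra.
Qed.

Section Quantile.
Variables (eta : R) (chi : R -> R).
Hypothesis Hchi : forall s x, (chi s <= x) = (eta <= F s x).

Lemma quantile_ge s : eta <= F s (chi s). Proof. by rewrite -Hchi. Qed.

Lemma quantile_lt s x : x < chi s -> F s x < eta.
Proof. by rewrite ltNge Hchi -ltNge. Qed.

Lemma quantile_up sg s1 s2 k0 : 0 < k0 -> 0 <= s1 -> s1 <= s2 ->
  (forall s x, s1 < s <= s2 -> `|x - (chi s1 + sg * (s - s1))| <= k0 -> ub s x <= sg) ->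
  chi s2 <= chi s1 + sg * (s2 - s1).
Proof.
move=> k00 s10 s12 H; apply/ler_addgt0Pl => e e0.
pose k := Num.min (k0 / 2) (e / 2).
have kp : 0 < k by rewrite /k lt_min !divr_gt0.
have k1 : k <= k0 / 2 by rewrite /k ge_min lexx.
have k2 : k <= e / 2 by rewrite /k ge_min lexx orbT.
(* At time [s1] the left edge of the window is the quantile itself, where the energy is at least
   [eta]. At time [s2] the right edge exceeds the claimed bound by [2 * k <= e]. *)
pose c0 := chi s1 + k - sg * s1.
have E1 : c0 + sg * s1 - k = chi s1 by rewrite /c0; ring.
have := trap_up (c0 := c0) (sg := sg) kp s10 s12; rewrite E1 => /(_ _)/= TU.
have : eta <= F s2 (c0 + sg * s2 + k).
  apply: le_trans (quantile_ge s1) (TU _) => s x ss xk; apply: (H s x ss).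
  have : x - (chi s1 + sg * (s - s1)) = (x - (c0 + sg * s)) + k by rewrite /c0; ring.
  by move=> ->; apply: le_trans (ler_normD _ _) _; rewrite (gtr0_norm kp); lra.
rewrite -Hchi => /le_trans; apply; rewrite /c0; lra.
Qed.

Lemma quantile_dn sg s1 s2 k0 : 0 < k0 -> 0 <= s1 -> s1 <= s2 ->
  (forall s x, s1 < s <= s2 -> `|x - (chi s1 + sg * (s - s1))| <= k0 -> sg <= ub s x) ->
  chi s1 + sg * (s2 - s1) <= chi s2.
Proof.
move=> k00 s10 s12 H; apply/ler_addgt0Pl => e e0.
pose k := Num.min (k0 / 3) (e / 3).
have kp : 0 < k by rewrite /k lt_min !divr_gt0.
have k1 : k <= k0 / 3 by rewrite /k ge_min lexx.
have k2 : k <= e / 3 by rewrite /k ge_min lexx orbT.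
(* Here the right edge of the window starts at [chi s1 - k], strictly left of the quantile, because
   only there is the energy strictly below [eta]. The total loss is [3 * k <= e]. *)
pose c0 := chi s1 - 2 * k - sg * s1.
have E1 : c0 + sg * s1 + k = chi s1 - k by rewrite /c0; ring.
have := trap_dn (c0 := c0) (sg := sg) kp s10 s12; rewrite E1 => /(_ _)/= TD.
have lt1 : F s1 (chi s1 - k) < eta by apply: quantile_lt; lra.
have : F s2 (c0 + sg * s2 - k) < eta.
  apply: le_lt_trans (TD _) lt1 => s x ss xk; apply: (H s x ss).
  have : x - (chi s1 + sg * (s - s1)) = (x - (c0 + sg * s)) - 2 * k by rewrite /c0; ring.
  move=> ->; apply: le_trans (ler_normB _ _) _.
  by rewrite (@gtr0_norm _ (2 * k)) ?mulr_gt0//; lra.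
rewrite ltNge -Hchi -ltNge /c0; lra.
Qed.

Lemma quantile_lip_ge0 T0 B : (forall s x, s <= T0 -> `|ub s x| <= B) -> forall s1 s2, 0 <= s1 -> s1 <= s2 -> s2 <= T0 ->
  `|chi s2 - chi s1| <= B * (s2 - s1).
Proof.
move=> HB s1 s2 s10 s12 s2T.
have h1 : chi s2 <= chi s1 + B * (s2 - s1).
  apply: (quantile_up ltr01) => // s x /andP[_ ss] _; apply: le_trans (ler_norm _) _.
  by apply: HB; exact: le_trans ss s2T.
have h2 : chi s1 + - B * (s2 - s1) <= chi s2.
  apply: (quantile_dn ltr01) => // s x /andP[_ ss] _.
  have : `|ub s x| <= B by apply: HB; exact: le_trans ss s2T.
  by rewrite ler_norml => /andP[].
rewrite ler_norml; apply/andP; split; lra.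
Qed.

Lemma quantile_max0 s : chi s = chi (Num.max s 0).
Proof.
have E x : (chi s <= x) = (chi (Num.max s 0) <= x).
  by rewrite !Hchi /mext (max_l (max0_ge0 s)).
by apply/eqP; rewrite eq_le E lexx /= -E lexx.
Qed.

Lemma quantile_lip T0 : exists2 B, 0 <= B & forall s1 s2, s1 <= T0 -> s2 <= T0 -> `|chi s2 - chi s1| <= B * `|s2 - s1|.
Proof.
have [B B0 HB] := uext_bound PU hsol (Num.max T0 0); exists B => // s1 s2 h1 h2.
rewrite (quantile_max0 s1) (quantile_max0 s2).
apply: (@le_trans _ _ (B * `|Num.max s2 0 - Num.max s1 0|)); last by rewrite ler_wpM2l ?max0_dist.
have m1 : Num.max s1 0 <= Num.max T0 0 by rewrite ge_max !le_max h1 lexx !orbT.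
have m2 : Num.max s2 0 <= Num.max T0 0 by rewrite ge_max !le_max h2 lexx !orbT.
have key a c : 0 <= a -> a <= c -> c <= Num.max T0 0 -> `|chi c - chi a| <= B * `|c - a|.
  move=> a0 ac cT; have -> : `|c - a| = c - a by rewrite ger0_norm// subr_ge0.
  exact: (quantile_lip_ge0 HB).
have [s12|/ltW s12] := leP (Num.max s1 0) (Num.max s2 0); first by apply: key => //; exact: max0_ge0.
by rewrite distrC [X in B * X]distrC; apply: key => //; exact: max0_ge0.
Qed.

Lemma quantile_cont : continuous chi.
Proof.
move=> s; have [B B0 HB] := quantile_lip (s + 1).
apply/cvgrPdist_le => e e0; have B1 : 0 < B + 1 by rewrite ltr_wpDl.
have d0 : 0 < e / (B + 1) by rewrite divr_gt0.
have /cvgrPdist_le/(_ _ d0) n1 : (fun t : R => t) @ s --> s by exact: cvg_id.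
near=> t; apply: (le_trans (HB t s _ _)); [|by rewrite lerDl|].
  by apply: ltW; near: t; apply: lt_nbhsl; rewrite ltrDl.
apply: (@le_trans _ _ ((B + 1) * `|s - t|)); first by rewrite ler_wpM2r// lerDl.
by rewrite mulrC -ler_pdivlMr//; near: t.
Unshelve. all: by end_near. Qed.

(** Near the point, [u] is within [e] of its value [v], so lines of slopes [v + e] and [v - e] are
    barriers for the quantile. A backward increment is a forward one restarted at the earlier time,
    which needs [t0] positive. *)
Lemma quantile_derive (t0 : R) : 0 < t0 -> is_derive t0 1 chi (ub t0 (chi t0)).
Proof.
move=> t00; set v := ub t0 (chi t0).
apply: is_derive_quot; apply/cvgrPdist_le => e e0.
have cu : {for (t0, chi t0), continuous (fun p : R * R => ub p.1 p.2)} by exact: (uext_cont hsol).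
have /cvgrPdist_le/(_ _ e0) := cu.
rewrite near_nbhs => /nbhs_ballP[d /= d0 Hd].
have [B B0 HB] := quantile_lip (t0 + 1).
(* Bounds the drift of the quantile plus that of the barrier per unit time, so that for small [k]
   both remain in the box where [u] is close to [v]. *)
pose L := B + `|v| + e.
have L0 : 0 < L by rewrite /L; have := normr_ge0 v; lra.
have d2 : 0 < d / 2 by rewrite divr_gt0.
have dL : 0 < d / 2 / L by rewrite divr_gt0.
near=> k.
have k0 : k != 0 by near: k; exact: nbhs_dnbhs_neq.
have k1 : `|k| < 1 by near: k; exact: dnbhs0_lt.
have kt : `|k| < t0 by near: k; exact: dnbhs0_lt.
have kd : `|k| < d / 2 by near: k; exact: dnbhs0_lt.
have kL : L * `|k| < d / 2.
  by rewrite mulrC -ltr_pdivlMr//; near: k; exact: dnbhs0_lt.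
have box s1 s2 s x (sg : R) : `|s1 - t0| <= `|k| -> s2 - s1 = `|k| -> s1 < s <= s2 -> `|s - t0| <= `|k| -> `|sg| <= `|v| + e ->
    `|x - (chi s1 + sg * (s - s1))| <= d / 2 - L * `|k| -> `|ub s x - v| <= e.
  move=> h1 h2 /andP[h3 h4] h5 h6 h7; rewrite distrC; apply: (Hd (s, x)); split => /=.
    by rewrite /ball/= distrC; lra.
  rewrite /ball/= distrC.
  have g1 : `|chi s1 - chi t0| <= B * `|k|.
    apply: (le_trans (HB _ _ _ _)); [lra| |by rewrite ler_wpM2l].
    by move: h1; rewrite ler_norml => /andP[? ?]; lra.
  have g2 : `|sg * (s - s1)| <= (`|v| + e) * `|k|.
    by rewrite normrM ler_pM// gtr0_norm ?subr_gt0// -h2 lerD2r.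
  have -> : x - chi t0 = (x - (chi s1 + sg * (s - s1))) + ((chi s1 - chi t0) + sg * (s - s1)) by ring.
  apply: (le_lt_trans (ler_normD _ _)); have := ler_normD (chi s1 - chi t0) (sg * (s - s1)).
  rewrite /L in kL h7 *; nra.
have dk : 0 < d / 2 - L * `|k| by rewrite subr_gt0.
have incr s1 s2 : 0 <= s1 -> `|s1 - t0| <= `|k| -> `|s2 - t0| <= `|k| -> s2 - s1 = `|k| -> `|chi s2 - chi s1 - v * `|k| | <= e * `|k|.
  move=> s10 h1 h1' h2; have s12 : s1 <= s2 by rewrite -subr_ge0 h2.
  have hs s : s1 < s <= s2 -> `|s - t0| <= `|k|.
    exact: (dist_between h1 h1').
  have up : chi s2 <= chi s1 + (v + e) * (s2 - s1).
    apply: (quantile_up dk s10 s12) => s x ss xk.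
    have : `|ub s x - v| <= e.
      apply: (box s1 s2 s x (v + e)) => //; first exact: hs.
      by apply: le_trans (ler_normD _ _) _; rewrite (gtr0_norm e0).
    by rewrite ler_distl => /andP[].
  have dn : chi s1 + (v - e) * (s2 - s1) <= chi s2.
    apply: (quantile_dn dk s10 s12) => s x ss xk.
    have : `|ub s x - v| <= e.
      apply: (box s1 s2 s x (v - e)) => //; first exact: hs.
      by apply: le_trans (ler_normB _ _) _; rewrite (gtr0_norm e0).
    by rewrite ler_distl => /andP[].
  by rewrite h2 in up dn; exact: slope_bound up dn.
rewrite -(@ler_pM2l _ `|k|) ?normr_gt0// -normrM mulrBr mulVKf//.
have [kp|kn] := leP 0 k.
  have := incr t0 (k + t0) (ltW t00); rewrite subrr normr0 addrK => /(_ (normr_ge0 k) (lexx _)).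
  rewrite (ger0_norm kp) => /(_ erefl); rewrite distrC.
  by rewrite [k * v]mulrC [k * e]mulrC.
have := incr (k + t0) t0; rewrite subrr normr0 addrK.
rewrite (ltr0_norm kn) => /(_ _ (lexx _))/= H.
have kt0 : 0 <= k + t0 by move: kt; rewrite (ltr0_norm kn); lra.
have := H kt0 (ltW _) _; rewrite oppr_gt0 => /(_ kn).
have -> : t0 - (k + t0) = - k by ring.
move=> /(_ erefl).
by rewrite (_ : chi t0 - chi (k + t0) - v * - k = k * v - (chi (k + t0) - chi t0)); [rewrite [- k * e]mulrC|ring].
Unshelve. all: by end_near. Qed.

End Quantile.

End Transport.

(** * Velocity along quantile curves *)

Section Velocity.
Context {R : realType}.
Local Notation leb := (@lebesgue_measure R).
Local Notation T := (measurableTypeR R).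
Local Notation fmeasure := {finite_measure set T -> \bar R}.

Lemma ftc_is_derive (I J : R -> R) (t0 : R) : continuous J ->
  (forall s1 s2, 0 <= s1 -> s1 <= s2 -> I s2 - I s1 = \int[leb]_(s in `]s1, s2]) J s) ->
  0 < t0 -> is_derive t0 1 I (J t0).
Proof.
move=> cJ IE t00; apply: is_derive_quot; apply/cvgrPdist_le => e e0.
have /cvgrPdist_le/(_ _ e0) := cJ t0.
rewrite near_nbhs => /nbhs_ballP[d /= d0 Hd].
near=> k.
have k0 : k != 0 by near: k; exact: nbhs_dnbhs_neq.
have kd : `|k| < d by near: k; exact: dnbhs0_lt.
have kt : `|k| < t0 by near: k; exact: dnbhs0_lt.
have key a c : 0 <= a -> a <= c -> (forall z, a < z <= c -> `|t0 - z| < d) ->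
    `|J t0 * (c - a) - (I c - I a)| <= e * (c - a).
  move=> a0 ac Hz.
  have cc (r : R) : continuous (fun _ : R => r) by move=> z; exact: cvg_cst.
  have cd : continuous (fun z => J t0 - J z) by move=> z; apply: cvgB; [exact: cvg_cst|exact: cJ].
  rewrite IE// -(Rint_oc_cst (J t0) ac) -(Rint_oc_cst e ac) -RintegralB//; [|exact: cont_oc_integrable (cc _)|exact: cont_oc_integrable].
  apply: le_trans; first by apply: le_normr_Rintegral => //; exact: cont_oc_integrable cd.
  apply: le_Rintegral => //.
  - by apply: cont_oc_integrable => z; apply: cvg_norm; exact: cd.
  - exact: cont_oc_integrable (cc _).
  - by move=> z /= /Hz zd; apply: Hd; exact: zd.
rewrite -(@ler_pM2l _ `|k|) ?normr_gt0// -normrM mulrBr mulVKf//.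
have [k1|k1] := leP 0 k.
  rewrite (ger0_norm k1) in kd kt *; have := key t0 (k + t0) (ltW t00); rewrite addrK mulrC [e * _]mulrC; apply.
    by rewrite lerDr.
  by move=> z /andP[z1 z2]; rewrite ltr_norml; apply/andP; split; lra.
rewrite (ltr0_norm k1) in kd kt *; have kt0 : 0 <= k + t0 by lra.
have := key (k + t0) t0 kt0; rewrite (_ : t0 - (k + t0) = - k); last by ring.
have -> : k * J t0 - (I (k + t0) - I t0) = - (J t0 * - k - (I t0 - I (k + t0))) by ring.
rewrite normrN [e * _]mulrC; apply; first by rewrite gerDr ltW.
by move=> z /andP[z1 z2]; rewrite ltr_norml; apply/andP; split; lra.
Unshelve. all: by end_near. Qed.

(** Transfers a derivative between functions in contact of first order. It is applied to averages
    along a quantile and along its tangent line, with [g] the distance between the two curves. *)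
Lemma is_derive_squeeze (h I g : R -> R) (t0 d C : R) : is_derive t0 1 I d -> is_derive t0 1 g 0 ->
  g t0 = 0 -> (\forall t \near t0, `|h t - I t| <= C * `|g t|) -> is_derive t0 1 h d.
Proof.
move=> DI Dg g0 hI; apply: is_derive_quot; apply/cvgrPdist_le => e e0.
have e2 : 0 < e / 2 by rewrite divr_gt0.
have C1 : 0 < `|C| + 1 by rewrite ltr_wpDl.
have eC : 0 < e / 2 / (`|C| + 1) by rewrite divr_gt0.
have /cvgrPdist_le/(_ _ e2) qI := quot_is_derive DI.
have /cvgrPdist_le/(_ _ eC) qg := quot_is_derive Dg.
have h0 : h t0 = I t0.
  by have := nbhs_singleton hI; rewrite g0 normr0 mulr0 normr_le0 subr_eq0 => /eqP.
move: hI => /nbhs_ballP[r /= r0 Hr].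
near=> k.
have k0 : k != 0 by near: k; exact: nbhs_dnbhs_neq.
have kr : `|k| < r by near: k; exact: dnbhs0_lt.
have q1 : `|d - k^-1 * (I (k + t0) - I t0)| <= e / 2 by near: k.
have q2 : `|0 - k^-1 * (g (k + t0) - g t0)| <= e / 2 / (`|C| + 1) by near: k.
have q3 : `|h (k + t0) - I (k + t0)| <= C * `|g (k + t0)|.
  by apply: Hr; rewrite /ball/= (_ : t0 - (k + t0) = - k) ?normrN//; ring.
have -> : d - k^-1 * (h (k + t0) - h t0) = (d - k^-1 * (I (k + t0) - I t0)) - k^-1 * (h (k + t0) - I (k + t0)).
  by rewrite h0; ring.
apply: (le_trans (ler_normB _ _)); rewrite [e]splitr lerD//.
rewrite normrM; apply: (@le_trans _ _ ((`|C| + 1) * `|k^-1 * g (k + t0)|)).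
  rewrite normrM mulrCA ler_wpM2l//; apply: (le_trans q3); rewrite ler_wpM2r//.
  by rewrite (le_trans (ler_norm _))// lerDl.
by rewrite mulrC -ler_pdivlMr//; move: q2; rewrite g0 subr0 sub0r normrN.
Unshelve. all: by end_near. Qed.

Variables (b : R -> R).
Hypothesis sb : smooth_step b.

Lemma bump_lip k : 0 < k -> exists2 C, 0 <= C & forall c c' x, `|bump b k c x - bump b k c' x| <= C * `|c - c'|.
Proof.
move=> k0; have [C C0 HC] := dbump_bounded sb k0; exists C => // c c' x.
have E z : bump b k z x = bump b k 0 (x - z) by rewrite /bump subr0.
rewrite !E; apply: (le_trans (bprim_lip (dbump_bprim sb k0 0) (HC 0) _ _)).
by rewrite (_ : x - c - (x - c') = - (c - c')) ?normrN//; ring.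
Qed.

Variables (pp pm : R -> R) (u : R -> R -> R) (mu : R -> fmeasure).
Hypothesis PU : partition_of_unity pp pm.
Hypothesis hsol : weak_cons_sol pp pm u mu.
Local Notation ub := (uext u).
Local Notation mb := (mext mu).
Local Notation mass := (total_mass mu).
Local Notation F := (fun s => cdfm (mb s)).

(** Valid at every time, exceptional ones included, since the absolutely continuous part of the
    energy never exceeds the energy. *)
Lemma uext_holder s x z : x <= z -> (ub s z - ub s x) ^+ 2 <= (z - x) * fine (mb s `]x, z[%classic).
Proof.
move=> xz; have [/(_ _ (max0_ge0 s))[_ _ [g [ug [N [mN N0 HN]]]]] _ _ _ _] := hsol.
apply: (weak_deriv_holder xz ug); rewrite fmE// /mext HN//.
by rewrite leeDl.
Qed.

Section Quantile.
Variables (eta : R) (chi : R -> R).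
Hypothesis Hchi : forall s x, (chi s <= x) = (eta <= F s x).

Local Notation vel := (fun s => ub s (chi s)).

Lemma vel_cont : continuous vel.
Proof.
move=> s; apply: (curve_continuous (f := ub)); first exact: (uext_cont hsol).
exact: (quantile_cont sb PU hsol Hchi).
Qed.

(** The bump may only be moved along a line, so the derivative is computed along the tangent to the
    quantile at [t0] and carried over. For fixed [k] the average is Lipschitz in the centre, and the
    two centres differ by a term of higher order. *)
Lemma smeared_velocity_derive (k t0 : R) : 0 < k -> 0 < t0 ->
  is_derive t0 1 (fun t => \int[leb]_x (ub t x * bump b k (chi t) x)) (momentum_flux b u mu (vel t0) t0 k (chi t0)).
Proof.
move=> k0 t00; set v := vel t0.
pose c0 := chi t0 - v * t0.
have E0 : c0 + v * t0 = chi t0 by rewrite /c0; ring.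
have DI : is_derive t0 1 (fun t => \int[leb]_x (ub t x * bump b k (c0 + v * t) x)) (momentum_flux b u mu v t0 k (chi t0)).
  rewrite -E0; have cJ : continuous (fun s => momentum_flux b u mu v s k (c0 + v * s)).
    apply: (momentum_flux_cont sb hsol (v := fun=> v)) => //; first by move=> s; exact: cvg_cst.
    exact: line_cont.
  apply: (ftc_is_derive cJ _ t00); apply: ftc_between => // t t1.
  by rewrite mulr0 addr0; exact: (momentum_line sb hsol).
have Dg : is_derive t0 1 (fun t => chi t - (c0 + v * t)) 0.
  have D1 := quantile_derive sb PU hsol Hchi t00.
  have D2 : is_derive t0 1 (fun t : R => c0 + v * t) v.
    by apply: is_derive_eq; rewrite /GRing.scale/=; ring.
  by apply: (is_derive_eq (is_deriveB D1 D2)); rewrite subrr.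
have [C C0 HC] := bump_lip k0; have [B B0 HB] := uext_bound PU hsol (t0 + 1).
pose r := `|chi t0| + 1 + k.
have r0 : 0 <= r by rewrite /r; have := normr_ge0 (chi t0); lra.
apply: (is_derive_squeeze (C := B * C * (2 * (r + 1))) DI Dg); first by rewrite E0 subrr.
have /cvgrPdist_le/(_ _ ltr01) n1 : chi @ t0 --> chi t0 by exact: (quantile_cont sb PU hsol Hchi).
have /cvgrPdist_le/(_ _ ltr01) n2 : (fun t => c0 + v * t) @ t0 --> c0 + v * t0 by exact: line_cont.
near=> t.
have t1 : t <= t0 + 1 by apply: ltW; near: t; apply: lt_nbhsl; rewrite ltrDl.
have c1 : `|chi t0 - chi t| <= 1 by near: t.
have c2 : `|chi t0 - (c0 + v * t)| <= 1 by rewrite -[X in X - (_ + _)]E0; near: t.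
have supp c x : `|chi t0 - c| <= 1 -> r < `|x| -> bump b k c x = 0.
  move=> cc xr; apply: bump_supp => //; apply: window_far; apply: le_lt_trans xr; rewrite /r lerD2r.
  by have := ler_normB (chi t0) (chi t0 - c); rewrite (_ : chi t0 - (chi t0 - c) = c); [lra|ring].
have cu (c : R) : continuous (fun x => ub t x * bump b k c x).
  by move=> x; apply: cvgM; [exact: (uext_slice hsol)|exact: bump_cont].
rewrite !(@Rint_symm _ _ r)//; [|by move=> x xr; rewrite supp ?mulr0..].
rewrite -RintegralB//; [|exact: cont_oc_integrable..].
have bd x : `|ub t x * bump b k (chi t) x - ub t x * bump b k (c0 + v * t) x| <= B * C * `|chi t - (c0 + v * t)|.
  by rewrite -mulrBr normrM -mulrA ler_pM// HB.
have rr : - (r + 1) <= r + 1 by lra.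
apply: le_trans; first apply: (Rint_oc_bound _ bd rr (fun x _ => bd x)).
  by apply: measurable_funB; exact: continuous_measurable_fun.
by rewrite (_ : r + 1 - - (r + 1) = 2 * (r + 1)); [rewrite mulrAC|ring].
Unshelve. all: by end_near. Qed.

Lemma smeared_velocity_cont k : 0 < k -> continuous (fun t => \int[leb]_x (ub t x * bump b k (chi t) x)).
Proof. by move=> k0; apply: (bump_int_cont sb hsol k0); exact: (quantile_cont sb PU hsol Hchi). Qed.

Lemma flux_along_cont k : 0 < k -> continuous (fun s => momentum_flux b u mu (vel s) s k (chi s)).
Proof.
move=> k0; apply: (momentum_flux_cont sb hsol (v := vel)) => //; first exact: vel_cont.
exact: (quantile_cont sb PU hsol Hchi).
Qed.

Lemma smeared_velocity_int k t : 0 < k -> 0 < t ->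
  \int[leb]_x (ub t x * bump b k (chi t) x) - \int[leb]_x (ub 0 x * bump b k (chi 0) x) =
  \int[leb]_(s in `]0, t]) momentum_flux b u mu (vel s) s k (chi s).
Proof.
move=> k0 t0; pose h t := \int[leb]_x (ub t x * bump b k (chi t) x).
pose J s := momentum_flux b u mu (vel s) s k (chi s).
have ch : continuous h by exact: smeared_velocity_cont.
have cJ : continuous J by exact: flux_along_cont.
have Dh (s : R) : 0 < s -> is_derive s 1 h (J s) by exact: smeared_velocity_derive.
have := @continuous_FTC2 R J h 0 t t0 (continuous_subspaceT cJ).
have h1 : derivable_oo_LRcontinuous h 0 t.
  split.
  - by move=> s; rewrite in_itv/= => /andP[s0 _]; have [] := Dh s s0.
  - by apply: cvg_at_right_filter; exact: ch.
  - by apply: cvg_at_left_filter; exact: ch.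
have h2 : {in `]0, t[, derive1 h =1 J}.
  by move=> s; rewrite in_itv/= => /andP[s0 _]; apply: derive1_is; exact: Dh.
move=> /(_ h1 h2) E.
rewrite Rintegral_itv_obnd_cbnd; last exact: cont_oc_integrable.
by rewrite /Rintegral E.
Qed.

Definition conc s k := F s (chi s + k) - F s (chi s - k).

Lemma conc_ge0 s k : 0 < k -> 0 <= conc s k.
Proof. by move=> k0; rewrite subr_ge0; apply: cdfm_nd; lra. Qed.

(** In the window [(u - v) ^+ 2] is at most [k] times the energy there, which offsets the size
    [k^-2] of [dbump] over a length of order [k]. The ramp integral differs from [mass 0 - eta] by
    at most the same energy. *)
Lemma flux_conc : exists2 C, 0 <= C & forall s k, 0 < k ->
  `|momentum_flux b u mu (vel s) s k (chi s) - (eta / 2 - mass 0 / 4)| <= C * conc s k.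
Proof.
have [C C0 HC] := step_derive2_bounded sb.
(* The quadratic term gives [2^-1 * k * (C / k ^+ 2) * (4 * k) = 2 * C] times [conc]; the ramp
   contributes one half, rounded up to 1. *)
exists (2 * C + 1); first by rewrite addr_ge0// mulr_ge0.
move=> s k k0; have ik : 0 < k^-1 by rewrite invr_gt0.
have DF := conc_ge0 s k0.
have E1 : 4^-1 * \int[mb s]_x (1 - 2 * ramp b k (chi s) x) - (eta / 2 - mass 0 / 4) =
    2^-1 * (mass 0 - eta - \int[mb s]_x ramp b k (chi s) x).
  by rewrite one_sub_ramp_int// -[fine _]/(mass s) (mass_const sb PU hsol); field.
have B1 : `|mass 0 - eta - \int[mb s]_x ramp b k (chi s) x| <= conc s k.
  have h1 := ramp_mass_le sb (mb s) (chi s) k0; have h2 := ramp_mass_ge sb (mb s) (chi s) k0.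
  have h3 : F s (chi s - k) < eta by apply: (quantile_lt Hchi); lra.
  have h4 : eta <= F s (chi s + k) by rewrite -Hchi lerDl ltW.
  have h5 := mass_const sb PU hsol s; rewrite /total_mass in h5 *.
  by rewrite /conc ler_norml; apply/andP; split; lra.
pose f x := 2^-1 * (ub s x - vel s) ^+ 2 * dbump b k (chi s) x.
have cf : continuous f.
  have cs : continuous (fun x => ub s x - vel s) by move=> x; apply: cvgB; [exact: (uext_slice hsol)|exact: cvg_cst].
  move=> x; apply: cvgM; last exact: dbump_cont.
  by apply: cvgM; [exact: cvg_cst|apply: cvgM; exact: cs].
have fb x : `|f x| <= 2^-1 * (k * conc s k) * (k^-1 * (k^-1 * C)).
  have [xk|xk] := leP `|x - chi s| k; last first.
    by rewrite /f dbump_supp// mulr0 normr0 !mulr_ge0// ltW.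
  rewrite /f normrM normrM [in X in X * _ <= _](@ger0_norm _ 2^-1)//.
  apply: ler_pM => //; last by rewrite /dbump !normrM (gtr0_norm ik) !ler_wpM2l// ltW.
  rewrite ler_wpM2l// normrX real_normK ?num_real//.
  have meas_le y z : chi s - k <= y -> z <= chi s + k -> fine (mb s `]y, z[%classic) <= conc s k.
    move=> hy hz; rewrite /conc -cdfm_oc; last by lra.
    by apply: fine_fm_le => // w /=; rewrite !in_itv/= => /andP[? ?]; apply/andP; split; lra.
  move: xk; rewrite ler_norml => /andP[x1 x2].
  have [xc|xc] := leP x (chi s).
    rewrite -sqrrN opprB; apply: (le_trans (uext_holder s xc)).
    by apply: ler_pM; rewrite ?fine_fm_ge0 ?subr_ge0//; [lra|apply: meas_le; lra].
  apply: (le_trans (uext_holder s (ltW xc))).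
  by apply: ler_pM; [rewrite subr_ge0 ltW|exact: fine_fm_ge0|lra|apply: meas_le; lra].
have E2 : \int[leb]_x f x = \int[leb]_(x in `](chi s - 2 * k), (chi s + 2 * k)]) f x.
  rewrite -(@Rint_support _ `](chi s - 2 * k), (chi s + 2 * k)]%classic)// => x /=.
  rewrite in_itv/= => /negP xk; rewrite /f dbump_supp ?mulr0// ltNge; apply: contra xk.
  by rewrite ler_norml => /andP[? ?]; apply/andP; split; lra.
have B2 : `|\int[leb]_x f x| <= 2 * C * conc s k.
  have kk : chi s - 2 * k <= chi s + 2 * k by lra.
  rewrite E2; apply: (le_trans (Rint_oc_bound (continuous_measurable_fun cf) fb kk (fun x _ => fb x))).
  rewrite le_eqVlt; apply/orP; left; apply/eqP.
  by field; rewrite gt_eqF.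
rewrite /momentum_flux -addrA E1; apply: (le_trans (ler_normD _ _)).
rewrite -[\int[leb]_x _]/(\int[leb]_x f x) mulrDl mul1r lerD// normrM ger0_norm//.
by apply: le_trans B1; rewrite ler_piMl//; lra.
Qed.

End Quantile.

End Velocity.

(** * Uniqueness *)

Section VelocityFormula.
Context {R : realType}.
Local Notation leb := (@lebesgue_measure R).
Local Notation T := (measurableTypeR R).
Local Notation fmeasure := {finite_measure set T -> \bar R}.
Variables (b : R -> R).
Hypothesis sb : smooth_step b.

Lemma smear_bound (g : R -> R) k c e : 0 < k -> continuous g ->
  (forall x, `|x - c| <= k -> `|g x - g c| <= e) -> `|\int[leb]_x (g x * bump b k c x) - g c| <= e.
Proof.
move=> k0 cg ge.
rewrite -(@Rint_support _ `](c - 2 * k), (c + 2 * k)]%classic); last first.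
  move=> x /=; rewrite in_itv/= => /negP xk; rewrite bump_supp ?mulr0// ltNge; apply: contra xk.
  by rewrite ler_norml => /andP[? ?]; apply/andP; split; lra.
under eq_Rintegral do rewrite mulrC.
by apply: (bump_avg sb k0 cg) => //; lra.
Qed.

Lemma smear_cvg (g : R -> R) c : continuous g ->
  (fun n : nat => \int[leb]_x (g x * bump b n.+1%:R^-1 c x)) @ \oo --> g c.
Proof.
move=> cg; apply/cvgrPdist_le => e e0.
have /cvgrPdist_le/(_ _ e0) := cg c; move=> /nbhs_ballP[d /= d0 Hd].
near=> n; rewrite distrC; apply: smear_bound => // x xn; rewrite distrC; apply: Hd.
rewrite /ball/= distrC; apply: (le_lt_trans xn); near: n.
exact: near_infty_natSinv_lt (PosNum d0).
Unshelve. all: by end_near. Qed.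

Variables (pp pm : R -> R) (u : R -> R -> R) (mu : R -> fmeasure).
Hypothesis PU : partition_of_unity pp pm.
Hypothesis hsol : weak_cons_sol pp pm u mu.
Local Notation ub := (uext u).
Local Notation mb := (mext mu).
Local Notation mass := (total_mass mu).
Local Notation F := (fun s => cdfm (mb s)).

Lemma fine_cvg_atom (m : fmeasure) c :
  (fun n : nat => fine (m `](c - n.+1%:R^-1), (c + n.+1%:R^-1)]%classic)) @ \oo --> fine (m [set c]).
Proof.
apply: (@fine_cvg_mu _ m (fun n => `](c - n.+1%:R^-1), (c + n.+1%:R^-1)]%classic)) => //.
have E : [set c] = \bigcap_n `](c - n.+1%:R^-1), (c + n.+1%:R^-1)]%classic.
  apply/seteqP; split => [x -> n _|x H] /=.
    have : 0 < n.+1%:R^-1 :> R by [].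
    by rewrite in_itv/=; move: (n.+1%:R^-1) => r r0; apply/andP; split; lra.
  apply/eqP; rewrite -subr_eq0 -normr_le0; apply/ler_addgt0Pl => e e0; rewrite addr0.
  have [n _ /(_ n (leqnn n)) Hn] := near_infty_natSinv_lt (PosNum e0).
  have := H n I; rewrite /= in_itv/= => /andP[h1 h2].
  by move: Hn h1 h2; rewrite /=; move: (n.+1%:R^-1) => r Hn h1 h2; rewrite ler_norml; apply/andP; split; lra.
rewrite E; apply: nonincreasing_cvg_mu => //.
- by rewrite -ge0_fin_numE// fin_num_measure.
- exact: bigcap_measurable.
- move=> i j ij; apply/subsetPset => x /=; rewrite !in_itv/= => /andP[h1 h2].
  have : j.+1%:R^-1 <= i.+1%:R^-1 :> R by rewrite lef_pV2 ?posrE// ler_nat.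
  by move: h1 h2; move: (i.+1%:R^-1) (j.+1%:R^-1) => ri rj h1 h2 ji; apply/andP; split; lra.
Qed.

Section Quantile.
Variables (eta : R) (chi : R -> R).
Hypothesis Hchi : forall s x, (chi s <= x) = (eta <= F s x).

Lemma conc_ae : exists N : set T, [/\ measurable N, leb N = 0%E &
  forall s, 0 <= s -> ~ N s -> (fun n : nat => conc mu chi s n.+1%:R^-1) @ \oo --> (0 : R)].
Proof.
have [_ _ _ [N [mN N0 HN]] _] := hsol; exists N; split => // s s0 sN.
have [g [_ Hg]] := HN s s0 sN.
have [_ Em] := ext_ge0 u mu s0.
have <- : fine (mb s [set chi s]) = 0.
  by rewrite Em Hg// integral_set1.
have -> : (fun n : nat => conc mu chi s n.+1%:R^-1) =
    (fun n : nat => fine (mb s `](chi s - n.+1%:R^-1), (chi s + n.+1%:R^-1)]%classic)).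
  apply/funext => n; rewrite cdfm_oc//; have : 0 < n.+1%:R^-1 :> R by [].
  by move: (n.+1%:R^-1) => r r0; lra.
exact: fine_cvg_atom.
Qed.

(** The error rate tends to zero only for almost every time, but it is bounded by [C * mass 0]
    throughout, so dominated convergence removes its time integral. *)
Lemma velocity_formula t : 0 <= t ->
  ub t (chi t) = ub 0 (chi 0) + t * (eta / 2 - mass 0 / 4).
Proof.
rewrite le_eqVlt => /predU1P[<-|t0]; first by rewrite mul0r addr0.
pose kn (n : nat) : R := n.+1%:R^-1.
have kn0 n : 0 < kn n by rewrite /kn invr_gt0.
pose Rn n s := momentum_flux b u mu (ub s (chi s)) s (kn n) (chi s).
pose cst0 := eta / 2 - mass 0 / 4.
have cR n : continuous (Rn n) by exact: (flux_along_cont sb PU hsol Hchi).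
pose Dn n s := `|Rn n s - cst0|.
have cRc n : continuous (fun s => Rn n s - cst0).
  by move=> s; apply: cvgB; [exact: cR|exact: cvg_cst].
have cD n : continuous (Dn n) by move=> s; apply: cvg_norm; exact: cRc.
have [C C0 HC] := flux_conc sb PU hsol Hchi.
have concM s n : conc mu chi s (kn n) <= mass 0.
  rewrite -(mass_const sb PU hsol s) /conc /total_mass.
  by have := cdfm_leT (mb s) (chi s + kn n); have := cdfm_ge0 (mb s) (chi s - kn n); lra.
have mset : measurable (`]0, t] : set T) by [].
have mDn n : measurable_fun (`]0, t] : set T) (EFin \o Dn n).
  by apply/measurable_EFinP/measurable_funTS; exact: continuous_measurable_fun.
have m0 : measurable_fun (`]0, t] : set T) (fun _ : T => 0%:E : \bar R) by exact: measurable_cst.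
have ig : leb.-integrable (`]0, t] : set T) (fun=> (C * mass 0)%:E).
  by apply: (@oc_integrable _ (fun=> C * mass 0) `|C * mass 0|).
have aecv : {ae leb, forall s : T, `]0, t]%classic s -> ((EFin \o Dn n) s @[n --> \oo] --> (0%:E : \bar R))}.
  have [N [mN N0 HN]] := conc_ae.
  exists N; split => // s /= H; apply: contrapT => sN; apply: H; rewrite in_itv/= => /andP[s0 _].
  apply: cvg_EFin; first by near=> n.
  have cc := HN s (ltW s0) sN.
  apply: (@squeeze_cvgr _ _ _ _ (fun=> 0) (fun n : nat => C * conc mu chi s (kn n))).
  - by near=> n; rewrite /= normr_ge0/=; exact: HC.
  - exact: cvg_cst.
  - by rewrite -[X in _ --> X](mulr0 C); apply: cvgM; [exact: cvg_cst|exact: cc].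
have aeb : {ae leb, forall (s : T) n, `]0, t]%classic s -> (`|(EFin \o Dn n) s| <= (C * mass 0)%:E)%E}.
  apply: aeW => s n _; rewrite /= lee_fin normr_id.
  by apply: (le_trans (HC s _ (kn0 n))); rewrite ler_wpM2l.
have [_ _ cv] := dominated_convergence mset mDn m0 aecv ig aeb.
have {}cv : (fun n => \int[leb]_(s in `]0, t]) Dn n s) @ \oo --> (0 : R).
  by move: cv; rewrite integral0 => /fine_cvg.
pose hn n s := \int[leb]_x (ub s x * bump b (kn n) (chi s) x).
have c1 : (fun n => hn n t) @ \oo --> ub t (chi t) by apply: (smear_cvg (g := ub t)); exact: (uext_slice hsol).
have c2 : (fun n => hn n 0) @ \oo --> ub 0 (chi 0) by apply: (smear_cvg (g := ub 0)); exact: (uext_slice hsol).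
have c3 : (fun n => hn n t - hn n 0 - t * cst0) @ \oo --> ub t (chi t) - ub 0 (chi 0) - t * cst0.
  by apply: cvgB; [apply: cvgB|exact: cvg_cst].
have c4 : (fun n => hn n t - hn n 0 - t * cst0) @ \oo --> (0 : R).
  apply/cvgrPdist_le => e e0; have /cvgrPdist_le/(_ _ e0) H := cv.
  near=> n; have : `|0 - \int[leb]_(s in `]0, t]) Dn n s| <= e by near: n.
  rewrite !sub0r !normrN => /(le_trans (ler_norm _)); apply: le_trans.
  rewrite /hn (smeared_velocity_int sb PU hsol Hchi (kn0 n) t0).
  have -> : t * cst0 = \int[leb]_(s in `]0, t]) cst0 by rewrite Rint_oc_cst ?ltW// subr0 mulrC.
  rewrite -RintegralB//; [|exact: cont_oc_integrable (cR n)|].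
    by apply: le_normr_Rintegral => //; exact: cont_oc_integrable (cRc n).
  by apply: cont_oc_integrable => s; exact: cvg_cst.
have E : ub t (chi t) - ub 0 (chi 0) - t * cst0 = 0 by exact: (cvg_unique (@Rhausdorff R) c3 c4).
by move/eqP: E; rewrite subr_eq0 subr_eq addrC => /eqP.
Unshelve. all: by end_near. Qed.

(** The energy strictly between a quantile and [x] is at most the gap of levels: an atom at the
    quantile itself does not count, since the open half-line to its left has energy at most
    [eta]. *)
Lemma quantile_holder s x : (ub s x - ub s (chi s)) ^+ 2 <= `|x - chi s| * `|F s x - eta|.
Proof.
have [cx|cx] := leP (chi s) x.
  have h1 : eta <= F s x by rewrite -Hchi.
  rewrite !ger0_norm ?subr_ge0//; apply: (le_trans (uext_holder hsol s cx)).
  rewrite ler_wpM2l ?subr_ge0//.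
  apply: (@le_trans _ _ (fine (mb s `]chi s, x]%classic))).
    by apply: fine_fm_le => // z /=; rewrite !in_itv/= => /andP[-> /ltW].
  by rewrite cdfm_oc// lerB// (quantile_ge Hchi).
have h1 : F s x < eta by exact: (quantile_lt Hchi).
rewrite !ltr0_norm ?subr_lt0// !opprB -sqrrN opprB.
apply: (le_trans (uext_holder hsol s (ltW cx))); rewrite ler_wpM2l ?subr_ge0 ?(ltW cx)//.
have h2 : fine (mb s `]-oo, (chi s)[%classic) <= eta.
  by apply: cdfm_open => y /(quantile_lt Hchi)/ltW.
have : fine (mb s `]-oo, (chi s)[%classic) = F s x + fine (mb s `]x, (chi s)[%classic).
  rewrite /cdfm -fine_fmU//.
  - by congr (fine (mb s _)); rewrite -itv_bndbnd_setU// bnd_simp// ltW.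
  - by apply/seteqP; split => z //= [] /=; rewrite !in_itv/= => h /andP[h' _]; have := le_lt_trans h h'; rewrite ltxx.
by move=> E; rewrite -(lerD2l (F s x)) -E [leRHS]addrC subrK.
Qed.

End Quantile.

(** Without energy there is no level strictly between 0 and the mass, so quantiles say nothing. In
    this case the velocity is constant in space, and the flux vanishes because the second derivative
    of a step integrates to zero. *)
Lemma zero_mass_frozen : mass 0 = 0 -> forall t x, 0 <= t -> ub t x = ub 0 0.
Proof.
move=> M0.
have cst s x z : ub s x = ub s z.
  wlog xz : x z / x <= z.
    by move=> W; have [/W->|/ltW/W->] := leP x z.
  apply/eqP; rewrite eq_sym -subr_eq0 -sqrf_eq0 eq_le sqr_ge0 andbT.
  apply: (le_trans (uext_holder hsol s xz)).
  have : fine (mb s `]x, z[%classic) <= mass s by apply: fine_fm_le.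
  rewrite (mass_const sb PU hsol) M0 => h.
  have -> : fine (mb s `]x, z[%classic) = 0 by apply/eqP; rewrite eq_le h fine_fm_ge0.
  by rewrite mulr0.
have sm s : \int[leb]_x (ub s x * bump b 1 0 x) = ub s 0.
  apply/eqP; rewrite -subr_eq0 -normr_le0; apply: (smear_bound (g := ub s)) => //.
    exact: (uext_slice hsol).
  by move=> x _; rewrite (cst s x 0) subrr normr0.
move=> t x t0; rewrite (cst t x 0).
have := momentum_line sb hsol 0 0 ltr01 t0.
rewrite mul0r addr0 !sm => E; apply/eqP; rewrite -subr_eq0 E; apply/eqP.
rewrite (@eq_Rintegral _ _ _ _ _ (fun=> 0)) ?Rint_oc_cst ?mul0r// => s _.
rewrite mul0r addr0 /momentum_flux one_sub_ramp_int//.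
have -> : \int[leb]_x (2^-1 * (ub s x - 0) ^+ 2 * dbump b 1 0 x) = 0.
  under eq_Rintegral do rewrite (cst s _ 0).
  rewrite RintegralZl// ?dbump_int0 ?mulr0//.
  by apply: (@cont_supp_integrable _ _ 1); [exact: dbump_cont|move=> z z1; rewrite dbump_supp// subr0].
rewrite -[fine _]/(mass s) (mass_const sb PU hsol) M0.
have h1 := ramp_mass_le sb (mb s) 0 ltr01; have h2 := ramp_mass_ge0 sb (mb s) 1 0.
have h3 := cdfm_ge0 (mb s) (0 - 1); have h4 := mass_const sb PU hsol s; rewrite M0 /total_mass in h4.
have -> : \int[mb s]_x ramp b 1 0 x = 0 by apply/eqP; rewrite eq_le h2 andbT; rewrite h4 in h1; lra.
by rewrite mulr0 subr0 mulr0 addr0.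
Qed.

End VelocityFormula.

(** * Comparison of two solutions with the same data *)

Section Uniqueness.
Context {R : realType}.
Local Notation T := (measurableTypeR R).
Local Notation fmeasure := {finite_measure set T -> \bar R}.
Variables (pp pm : R -> R) (u1 u2 : R -> R -> R) (mu1 mu2 : R -> fmeasure).
Hypothesis PU : partition_of_unity pp pm.
Hypothesis h1 : weak_cons_sol pp pm u1 mu1.
Hypothesis h2 : weak_cons_sol pp pm u2 mu2.
Hypothesis u0 : u1 0 = u2 0.
Hypothesis mu0 : forall A, measurable A -> mu1 0 A = mu2 0 A.
Local Notation F1 := (fun s => cdfm (mext mu1 s)).
Local Notation F2 := (fun s => cdfm (mext mu2 s)).

Lemma sq_triangle (p r v z : R) : (p - v) ^+ 2 <= z -> (r - v) ^+ 2 <= z -> (p - r) ^+ 2 <= 4 * z.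
Proof.
have -> : (p - r) ^+ 2 = 2 * (p - v) ^+ 2 + 2 * (r - v) ^+ 2 - (p + r - 2 * v) ^+ 2 by ring.
by have := sqr_ge0 (p + r - 2 * v); lra.
Qed.

(** The velocities on the two quantiles agree before the quantiles are known to agree, because the
    formula involves only the data. The curves then have equal derivatives and a common start. *)
Lemma quantiles_agree (b : R -> R) (eta : R) (chi1 chi2 : R -> R) : smooth_step b ->
  (forall s x, (chi1 s <= x) = (eta <= F1 s x)) -> (forall s x, (chi2 s <= x) = (eta <= F2 s x)) ->
  forall t, 0 <= t -> chi1 t = chi2 t /\ uext u1 t (chi1 t) = uext u2 t (chi2 t).
Proof.
move=> sb H1 H2.
have [e1 m1] := ext_ge0 u1 mu1 (lexx 0); have [e2 m2] := ext_ge0 u2 mu2 (lexx 0).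
have F0 x : F1 0 x = F2 0 x by rewrite /cdfm m1 m2 mu0.
have M0 : total_mass mu1 0 = total_mass mu2 0 by rewrite /total_mass m1 m2 mu0.
have c0 : chi1 0 = chi2 0.
  by apply/eqP; rewrite eq_le H1 F0 -H2 lexx H2 -F0 -H1 lexx.
have V t : 0 <= t -> uext u1 t (chi1 t) = uext u2 t (chi2 t).
  move=> t0; rewrite (velocity_formula sb PU h1 H1 t0) (velocity_formula sb PU h2 H2 t0).
  by rewrite M0 e1 e2 c0 u0.
move=> t t0; split; last exact: V.
move: t0; rewrite le_eqVlt => /predU1P[<-//|t0].
pose g s := chi1 s - chi2 s.
have Dg (s : R) : s \in `]0, t[ -> is_derive s 1 g 0.
  rewrite in_itv/= => /andP[s0 _].
  apply: (is_derive_eq (is_deriveB (quantile_derive sb PU h1 H1 s0) (quantile_derive sb PU h2 H2 s0))).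
  by rewrite V ?subrr// ltW.
have cg : {within `[0, t], continuous g}.
  apply: continuous_subspaceT => s; apply: cvgB.
    exact: (quantile_cont sb PU h1 H1).
  exact: (quantile_cont sb PU h2 H2).
have [c _] := @MVT R g (fun=> 0) 0 t t0 Dg cg.
by rewrite mul0r /g c0 subrr subr0 => /eqP; rewrite subr_eq0 => /eqP.
Qed.

Lemma weak_solution_unique t : 0 <= t -> u1 t = u2 t /\ (forall A, measurable A -> mu1 t A = mu2 t A).
Proof.
move=> t0; have [b sb] := smooth_step_exists PU.
have [e1 m1] := ext_ge0 u1 mu1 (lexx 0); have [e2 m2] := ext_ge0 u2 mu2 (lexx 0).
have [et1 mt1] := ext_ge0 u1 mu1 t0; have [et2 mt2] := ext_ge0 u2 mu2 t0.
have M0 : total_mass mu1 0 = total_mass mu2 0 by rewrite /total_mass m1 m2 mu0.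
have Mt1 := mass_const sb PU h1 t; have Mt2 := mass_const sb PU h2 t.
have Fb1 x : 0 <= F1 t x <= total_mass mu1 0 by rewrite -Mt1 cdfm_ge0 cdfm_leT.
have Fb2 x : 0 <= F2 t x <= total_mass mu1 0 by rewrite M0 -Mt2 cdfm_ge0 cdfm_leT.
have Q eta : 0 < eta -> eta < total_mass mu1 0 -> exists q, [/\ (forall x, (q <= x) = (eta <= F1 t x)),
    (forall x, (q <= x) = (eta <= F2 t x)),
    (forall x, (uext u1 t x - uext u1 t q) ^+ 2 <= `|x - q| * `|F1 t x - eta|),
    (forall x, (uext u2 t x - uext u2 t q) ^+ 2 <= `|x - q| * `|F2 t x - eta|) &
    uext u1 t q = uext u2 t q].
  move=> eta0 etaM; have [chi1 H1] := quantile_exists sb PU h1 eta0 etaM.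
  rewrite M0 in etaM; have [chi2 H2] := quantile_exists sb PU h2 eta0 etaM.
  have [Ec Eu] := quantiles_agree sb H1 H2 t0.
  exists (chi1 t); split.
  - exact: H1.
  - by rewrite Ec; exact: H2.
  - exact: (quantile_holder h1 H1).
  - by rewrite Ec; exact: (quantile_holder h2 H2).
  - by rewrite Eu Ec.
(* If the values differed, the common quantile of the level halfway between would lie at or left of
   [x] for one measure and right of [x] for the other. *)
have FE x : F1 t x = F2 t x.
  have /andP[a1 a2] := Fb1 x; have /andP[c1 c2] := Fb2 x.
  apply/eqP; rewrite eq_le; apply/andP; split; rewrite leNgt; apply/negP => lt12.
    have [||q [K1 K2 _ _ _]] := Q ((F1 t x + F2 t x) / 2); [lra|lra|].
    by have := K1 x; rewrite K2; apply/eqP; have [] := leP _ (F1 t x); have [] := leP _ (F2 t x) => //; lra.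
  have [||q [K1 K2 _ _ _]] := Q ((F1 t x + F2 t x) / 2); [lra|lra|].
  by have := K1 x; rewrite K2; apply/eqP; have [] := leP _ (F1 t x); have [] := leP _ (F2 t x) => //; lra.
split; last first.
  by move=> A mA; rewrite -mt1 -mt2; apply: cdfm_inj.
rewrite -et1 -et2; apply/funext => x.
have [M00|] := leP (total_mass mu1 0) 0.
  have M1 : total_mass mu1 0 = 0.
    by have /andP[a1 a2] := Fb1 x; lra.
  rewrite (zero_mass_frozen sb PU h1 M1 x t0).
  by rewrite (zero_mass_frozen sb PU h2 _ x t0) -?M0// e1 e2 u0.
move=> Mpos; pose D := uext u1 t x - uext u2 t x.
(* Both velocities at [x] are compared with the value they share at the quantile [q]. It remains to
   let the level approach [F1 t x] while [q] stays bounded. *)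
have Db eta : 0 < eta -> eta < total_mass mu1 0 -> exists q, [/\ (forall z, (q <= z) = (eta <= F1 t z)) &
    D ^+ 2 <= 4 * (`|x - q| * `|F1 t x - eta|)].
  move=> p1 p2; have [q [K1 K2 V1 V2 E]] := Q eta p1 p2; exists q; split => //.
  by have := V1 x; have := V2 x; rewrite -FE E => W2 W1; exact: sq_triangle W1 W2.
suff : forall e, 0 < e -> D ^+ 2 <= e.
  move=> H; apply/eqP; rewrite -subr_eq0 -sqrf_eq0 eq_le sqr_ge0 andbT.
  by apply/ler_addgt0Pl => e e0; rewrite addr0; exact: H.
move=> e e0; have /andP[a1 a2] := Fb1 x.
(* When the level moves monotonically from [eta0] towards [F1 t x], its quantile stays between [q0]
   and [x], so the distance factor is bounded by [|x - q0|]. *)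
have key eta0 : 0 < eta0 -> eta0 < total_mass mu1 0 ->
   exists2 L, 0 <= L & forall eta', 0 < eta' -> eta' < total_mass mu1 0 -> (eta0 <= eta' <= F1 t x) \/ (F1 t x < eta' <= eta0) ->
   D ^+ 2 <= L * `|F1 t x - eta'|.
  move=> p1 p2; have [q0 [K0 _]] := Db _ p1 p2.
  exists (4 * `|x - q0|); first by rewrite mulr_ge0.
  move=> eta' r1 r2 H; have [q [K HD]] := Db _ r1 r2.
  apply: (le_trans HD); rewrite mulrA ler_wpM2r// ler_wpM2l//.
  case: H => /andP[w1 w2].
    have qx : q <= x by rewrite K.
    have q0q : q0 <= q by rewrite K0; apply: (le_trans w1); rewrite -K.
    by rewrite !ger0_norm ?subr_ge0// ?lerB// (le_trans q0q).
  have qx : x < q by rewrite ltNge K -ltNge.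
  have q0q : q <= q0 by rewrite K; apply: (le_trans w2); rewrite -K0.
  by rewrite !ltr0_norm ?subr_lt0// ?(lt_le_trans qx)// !opprB lerB.
(* Levels must stay strictly between 0 and the mass: at a point with no energy on its left they
   approach from above, otherwise from below. *)
have [F0|Fp] := leP (F1 t x) 0.
  have Fx : F1 t x = 0 by lra.
  have [||L L0 HL] := key (total_mass mu1 0 / 2); [lra|lra|].
  pose eta' := Num.min (total_mass mu1 0 / 2) (e / (L + 1)).
  have L1 : 0 < L + 1 by lra.
  have p1 : 0 < eta' by rewrite /eta' lt_min !divr_gt0.
  have p2 : eta' <= total_mass mu1 0 / 2 by rewrite /eta' ge_min lexx.
  have p3 : eta' <= e / (L + 1) by rewrite /eta' ge_min lexx orbT.
  apply: (le_trans (HL eta' p1 _ _)); [lra|by right; rewrite Fx p1|].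
  rewrite Fx sub0r normrN gtr0_norm//.
  apply: (@le_trans _ _ ((L + 1) * eta')); first by rewrite ler_wpM2r ?ltW//; lra.
  by rewrite mulrC -ler_pdivlMr.
have [||L L0 HL] := key (F1 t x / 2); [lra|lra|].
have L1 : 0 < L + 1 by lra.
pose th := Num.min (F1 t x / 2) (e / (L + 1)).
have p1 : 0 < th by rewrite /th lt_min !divr_gt0.
have p2 : th <= F1 t x / 2 by rewrite /th ge_min lexx.
have p3 : th <= e / (L + 1) by rewrite /th ge_min lexx orbT.
apply: (le_trans (HL (F1 t x - th) _ _ _)); [lra|lra|by left; apply/andP; split; lra|].
rewrite opprB addrC subrK gtr0_norm//.
apply: (@le_trans _ _ ((L + 1) * th)); first by rewrite ler_wpM2r ?ltW//; lra.
by rewrite mulrC -ler_pdivlMr.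
Qed.

End Uniqueness.

Theorem theorem3p6 (R : realType) (pp pm : R -> R) (u0 : R -> R)
  (mu0 : {finite_measure set (measurableTypeR R) -> \bar R}) :
  partition_of_unity pp pm ->
  in_D pp pm u0 mu0 ->
  (exists (u : R -> R -> R)
          (mu : R -> {finite_measure set (measurableTypeR R) -> \bar R}),
      weak_cons_sol pp pm u mu /\ has_init u mu u0 mu0) /\
  (forall (u1 u2 : R -> R -> R)
          (mu1 mu2 : R -> {finite_measure set (measurableTypeR R) -> \bar R}),
      weak_cons_sol pp pm u1 mu1 -> has_init u1 mu1 u0 mu0 ->
      weak_cons_sol pp pm u2 mu2 -> has_init u2 mu2 u0 mu0 ->
      forall t : R, 0 <= t ->
        u1 t = u2 t /\ (forall A, measurable A -> mu1 t A = mu2 t A)).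
Proof.
move=> PU D0; split; first exact: conservative_solution_exists.
move=> u1 u2 mu1 mu2 h1 [i1 j1] h2 [i2 j2] t t0.
apply: (weak_solution_unique PU h1 h2) => //; first by rewrite i1 i2.
by move=> A mA; rewrite j1// j2.
Qed.
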